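(* Let $f\in C^\alpha(D)$ and let $k>0$ be an integer. Then $T^kf$ and $\overline{T}^kf$ belong to $C^{k+\alpha}(D)$, and for $z\in D$ $$T^kf(z)=\frac{(-1)^k}{(k-1)!\, 2\pi i}\int_D\frac{(\bar\zeta-\bar z)^{k-1}f(\zeta)}{\zeta-z}\,d\bar\zeta\wedge d\zeta,$$ $$\overline{T}^kf(z)=\frac{(-1)^k}{(k-1)!\, 2\pi i}\int_D\frac{(\zeta-z)^{k-1}f(\zeta)}{\bar\zeta-\bar z}\,d\bar\zeta\wedge d\zeta.$$
   Context: Fix $R>0$ and $0<\alpha<1$. $D=\{z\in\mathbb{C}: |z|\le R\}$ is the closed disk. Functions are complex valued. $C^\alpha(D)$ is the set of functions $f$ on $D$ with $\sup\{|f(z)-f(z')|/|z-z'|^\alpha : z,z'\in D,\ z\ne z'\}<\infty$. For an integer $k\ge 0$, $C^{k+\alpha}(D)$ is the set of functions on $D$ all of whose $k$th order partial derivatives exist and belong to $C^\alpha(D)$ (at boundary points of $D$, derivatives are understood as continuous extensions from the interior). The 2-form $d\bar\zeta\wedge d\zeta$ equals $2i\,dx\,dy$ for $\zeta=x+iy$. The operators are $$Tf(z)=\frac{-1}{2\pi i}\int_D\frac{f(\zeta)\,d\bar\zeta\wedge d\zeta}{\zeta-z},\qquad \overline{T}f(z)=\frac{-1}{2\pi i}\int_D\frac{f(\zeta)\,d\bar\zeta\wedge d\zeta}{\bar\zeta-\bar z},$$ and $T^k$, $\overline{T}^k$ denote their $k$-fold compositions. *)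

(* Defs.v *)
From HB Require Import structures.
From mathcomp Require Import all_boot all_order all_algebra.
From mathcomp Require Import all_classical all_reals all_analysis.
From mathcomp Require Import complex.

Set Implicit Arguments.
Unset Strict Implicit.
Unset Printing Implicit Defensive.

Import Order.TTheory GRing.Theory Num.Theory.
Import numFieldNormedType.Exports.

Local Open Scope classical_set_scope.
Local Open Scope ring_scope.
Local Open Scope complex_scope.

Section CauchyOperators.
Variable R : realType.
Local Notation C := R[i].

(* The modulus as an element of R: the norm `|z| of R[i] lives in R[i]. *)
Definition cabs (z : C) : R := ComplexField.Normc.normc z.

Definition cdisk (r : R) : set C := [set z | cabs z <= r].
Definition odisk (r : R) : set C := [set z | cabs z < r].

(* Functions on the closed disk are represented by total functions on C;
   everything below depends only on their values on the disk. *)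

Definition holder (r alpha : R) (f : C -> C) : Prop :=
  has_ubound [set q : R | exists z z' : C,
    [/\ cdisk r z, cdisk r z', z != z' &
        q = cabs (f z - f z') / (cabs (z - z') `^ alpha)]].

(* Partial derivatives are indexed by booleans: false stands for d/dx (the
   derivative along 1) and true for d/dy (the derivative along i).  A complex
   function is differentiated componentwise along the real line z + t v. *)
Definition pdir (b : bool) : C := if b then 'i%C else 1.

Definition slice_Re (f : C -> C) (b : bool) (z : C) : R -> R :=
  fun t => complex.Re (f (z + t%:C * pdir b)).
Definition slice_Im (f : C -> C) (b : bool) (z : C) : R -> R :=
  fun t => complex.Im (f (z + t%:C * pdir b)).

Definition pderivable (b : bool) (f : C -> C) (z : C) : Prop :=
  derivable (slice_Re f b z) 0 1 /\ derivable (slice_Im f b z) 0 1.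

Definition pderiv (b : bool) (f : C -> C) : C -> C :=
  fun z => derive1 (slice_Re f b z) 0 +i* derive1 (slice_Im f b z) 0.

(* pderivs [:: b1; ...; bn] f is the iterated derivative d_b1 (... (d_bn f)). *)
Definition pderivs (s : seq bool) (f : C -> C) : C -> C := foldr pderiv f s.

(* C^{k+alpha} of the closed disk: all partial derivatives up to order k exist
   in the open disk, and those of order k extend to the closed disk as
   alpha-Hoelder functions.  The continuity clause fixes the boundary values of
   f itself, on which interior derivatives have no bearing; for k = 0 it makes
   the definition agree with holder. *)
Definition holder_class (k : nat) (r alpha : R) (f : C -> C) : Prop :=
  [/\ {within cdisk r : set C^o, continuous (f : C^o -> C^o)},
      forall (s : seq bool) (b : bool), (size s < k)%N ->
        forall z, odisk r z -> pderivable b (pderivs s f) z &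
      forall s : seq bool, size s = k ->
        exists2 g : C -> C, holder r alpha g &
          forall z, odisk r z -> g z = pderivs s f z].

Definition area_int (r : R) (F : C -> C) : C :=
  let mu := (@lebesgue_measure R \x @lebesgue_measure R)%E in
  let D := [set p : R * R | cdisk r (p.1 +i* p.2)] in
  Rintegral mu D (fun p => complex.Re (F (p.1 +i* p.2)))
  +i* Rintegral mu D (fun p => complex.Im (F (p.1 +i* p.2))).

(* Integral against the 2-form  d zeta-bar /\ d zeta = 2 i dx dy. *)
Definition form_int (r : R) (F : C -> C) : C := 2%:R * 'i%C * area_int r F.

Definition two_pi_i : C := 2%:R * (pi : R)%:C * 'i%C.

(* The integrands have value 0 at the singular point, since x / 0 = 0. *)
Definition cauchyT (r : R) (f : C -> C) : C -> C := fun z =>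
  - 1 / two_pi_i * form_int r (fun zeta => f zeta / (zeta - z)).

Definition cauchyTbar (r : R) (f : C -> C) : C -> C := fun z =>
  - 1 / two_pi_i * form_int r (fun zeta => f zeta / (zeta^*%C - z^*%C)).

End CauchyOperators.

(* Main.v *)
Require Import Defs.
From HB Require Import structures.
From mathcomp Require Import all_boot all_order all_algebra.
From mathcomp Require Import all_classical all_reals all_analysis.
From mathcomp Require Import complex measurable_realfun.
From mathcomp Require Import ring lra zify.

Set Implicit Arguments.
Unset Strict Implicit.
Unset Printing Implicit Defensive.

Import Order.TTheory GRing.Theory Num.Theory.
Import numFieldNormedType.Exports.

Local Open Scope classical_set_scope.
Local Open Scope ring_scope.
Local Open Scope complex_scope.

(** Up to constants, [cauchyT r] is convolution of [f], cut off by the indicator of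
the disk, with the kernel [1 / u]; more generally [potential p q g] is the
convolution of [g] with [conj u ^ p / u ^ q].

Integral formula.  By induction on [k], one more application of the operator to
[potential k 1 g] is, after exchanging the two integrals, governed by
  int_D conj (w - v) ^ k / ((v - z) * (w - v)) dA(v).
Partial fractions reduce it to two Cauchy integrals of one polynomial in [conj v],
evaluated in [pint_cauchy_poly] by expanding the Cauchy kernel in powers of [v]:
rotation invariance of the plane measure kills all the terms but one.  The result is
[pint_cauchy_potential].

Regularity.  Each derivative of the potential of order [k], of degree [k - 2], lowers
the degree of the kernel by one.  As long as the kernel stays integrable one may
differentiate under the integral sign ([wdiff_potential]); the kernel of degree [-2]
reached after [k] steps is no longer integrable, and the last derivative is computed
by writing [f v] as [f v - f z] plus the constant [f z]: the first part vanishes to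
order [alpha] at [z], and the potential of a constant is explicit
([wdiff_potential_holder]).  So derivatives of order [k] are combinations of [f] and of
the singular integrals [beurling r p f].  Those are Hoelder up to the boundary
([beurling_holder]) by the usual separation of near and far contributions; the
cancellation it relies on is that the kernel of degree [-2] has integral zero over the
complement in the disk of any smaller disk around its pole ([pint_kern_complement_eq0]).
The smaller disk has to lie inside [D], so both points are compared with a third one,
pulled away from the circle.

All derivatives are taken in the Wirtinger sense ([wdiff]), for which the kernels form
a closed family, and converted into partial derivatives at the end
([holder_class_of_filtration]).  The statements on [cauchyTbar] follow by complex
conjugation. *)

(** * The modulus of a complex number *)

Section Modulus.
Variable R : realType.
Implicit Types z w : R[i].

Lemma cabsE z : (cabs z)%:C = `|z|.
Proof. by case: z. Qed.

Lemma cabs_ge0 z : 0 <= cabs z.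
Proof. by case: z => a b; exact: sqrtr_ge0. Qed.

Lemma cabs0 : cabs (0 : R[i]) = 0.
Proof. exact: ComplexField.Normc.normc0. Qed.

Lemma cabs1 : cabs (1 : R[i]) = 1.
Proof. exact: ComplexField.Normc.normc1. Qed.

Lemma cabsM z w : cabs (z * w) = cabs z * cabs w.
Proof. exact: ComplexField.Normc.normcM. Qed.

Lemma cabsV z : cabs z^-1 = (cabs z)^-1.
Proof. exact: ComplexField.Normc.normcV. Qed.

Lemma cabsX z n : cabs (z ^+ n) = cabs z ^+ n.
Proof. by elim: n => [|n IH]; rewrite ?expr0 ?cabs1// !exprS cabsM IH. Qed.

Lemma cabs_eq0 z : (cabs z == 0) = (z == 0).
Proof. by rewrite -(inj_eq (@complexI R)) cabsE normr_eq0. Qed.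

Lemma cabs_gt0 z : (0 < cabs z) = (z != 0).
Proof. by rewrite lt0r cabs_eq0 cabs_ge0 andbT. Qed.

Lemma cabsD z w : cabs (z + w) <= cabs z + cabs w.
Proof. by rewrite -lecR rmorphD /= !cabsE ler_normD. Qed.

Lemma cabsN z : cabs (- z) = cabs z.
Proof. by apply: (@complexI R); rewrite !cabsE normrN. Qed.

Lemma cabsB z w : cabs (z - w) <= cabs z + cabs w.
Proof. by rewrite (le_trans (cabsD _ _))// cabsN. Qed.

Lemma cabsC z w : cabs (z - w) = cabs (w - z).
Proof. by rewrite -cabsN opprB. Qed.

Lemma cabs_triangle z w v : cabs (z - v) <= cabs (z - w) + cabs (w - v).
Proof. by rewrite -[z - v](subrKA w) cabsD. Qed.

Lemma cabs_real (x : R) : cabs x%:C = `|x|.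
Proof. by rewrite /cabs /= expr0n addr0 sqrtr_sqr. Qed.

Lemma cabs_conj z : cabs z^*%C = cabs z.
Proof. by case: z => a b; rewrite /cabs /= sqrrN. Qed.

Lemma cabs_i : cabs ('i%C : R[i]) = 1.
Proof. by rewrite /cabs /= expr0n add0r expr1n sqrtr1. Qed.

Lemma cabs_sqr z : cabs z ^+ 2 = complex.Re z ^+ 2 + complex.Im z ^+ 2.
Proof. by case: z => a b; rewrite /cabs sqr_sqrtr// addr_ge0// sqr_ge0. Qed.

Lemma Re_le_cabs z : `|complex.Re z| <= cabs z.
Proof.
rewrite -(@ler_pXn2r _ 2) ?nnegrE ?normr_ge0 ?cabs_ge0//.
by rewrite real_normK ?num_real// cabs_sqr lerDl sqr_ge0.
Qed.

Lemma Im_le_cabs z : `|complex.Im z| <= cabs z.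
Proof.
rewrite -(@ler_pXn2r _ 2) ?nnegrE ?normr_ge0 ?cabs_ge0//.
by rewrite real_normK ?num_real// cabs_sqr lerDr sqr_ge0.
Qed.

Lemma cabs_le_ReIm z : cabs z <= `|complex.Re z| + `|complex.Im z|.
Proof.
rewrite -(@ler_pXn2r _ 2) ?nnegrE ?addr_ge0 ?cabs_ge0//.
rewrite sqrrD !real_normK ?num_real// cabs_sqr addrAC lerDl.
by rewrite mulrn_wge0// mulr_ge0.
Qed.

Lemma mul_conjc z : z * z^*%C = ((cabs z) ^+ 2)%:C.
Proof. by rewrite cabs_sqr; case: z => a b; simpc; congr (_ +i* _); ring. Qed.

Lemma cReD z w : complex.Re (z + w) = complex.Re z + complex.Re w.
Proof. by case: z w => [a b] []. Qed.

Lemma cImD z w : complex.Im (z + w) = complex.Im z + complex.Im w.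
Proof. by case: z w => [a b] []. Qed.

Lemma cReM z w : complex.Re (z * w) =
  complex.Re z * complex.Re w - complex.Im z * complex.Im w.
Proof. by case: z w => [a b] []. Qed.

Lemma cImM z w : complex.Im (z * w) =
  complex.Re z * complex.Im w + complex.Im z * complex.Re w.
Proof. by case: z w => [a b] []. Qed.

Lemma cRe_conj z : complex.Re z^*%C = complex.Re z. Proof. by case: z. Qed.
Lemma cIm_conj z : complex.Im z^*%C = - complex.Im z. Proof. by case: z. Qed.

Lemma cReV z : complex.Re z^-1 = complex.Re z * (cabs z ^+ 2)^-1.
Proof. by rewrite cabs_sqr; case: z. Qed.

Lemma cImV z : complex.Im z^-1 = - (complex.Im z * (cabs z ^+ 2)^-1).
Proof. by rewrite cabs_sqr; case: z. Qed.

Lemma complex_eta z : complex.Re z +i* complex.Im z = z.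
Proof. by case: z. Qed.

End Modulus.

(** * Measurability of complex functions *)

Section RealMeasurability.
Context d (T : measurableType d) (R : realType).
Implicit Types g : T -> R.

Lemma measurable_sqrt g : measurable_fun setT g -> (forall x, 0 <= g x) ->
  measurable_fun setT (fun x => Num.sqrt (g x)).
Proof.
move=> mg g0; rewrite (_ : (fun _ => _) = (fun x => g x `^ 2^-1)).
  exact: (measurableT_comp (measurable_powR _) mg).
by apply/funext => x; rewrite powR12_sqrt.
Qed.

Lemma measurable_inv_ge0 g : measurable_fun setT g -> (forall x, 0 <= g x) ->
  measurable_fun setT (fun x => (g x)^-1).
Proof.
move=> mg g0; rewrite (_ : (fun _ => _) = (fun x => g x `^ (-1))).
  exact: (measurableT_comp (measurable_powR _) mg).
by apply/funext => x; rewrite powR_inv1.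
Qed.

End RealMeasurability.

Section ComplexMeasurability.
Context d (T : measurableType d) (R : realType).
Implicit Types F G : T -> R[i].

Definition cmeasurable F :=
  measurable_fun setT (fun x => complex.Re (F x)) /\
  measurable_fun setT (fun x => complex.Im (F x)).

Lemma cmeasurable_cst (c : R[i]) : cmeasurable (fun=> c).
Proof. by split; exact: measurable_cst. Qed.

Lemma cmeasurableD F G : cmeasurable F -> cmeasurable G ->
  cmeasurable (fun x => F x + G x).
Proof.
move=> [F1 F2] [G1 G2]; split; under eq_fun do rewrite ?cReD ?cImD;
  exact: measurable_funD.
Qed.

Lemma cmeasurableM F G : cmeasurable F -> cmeasurable G ->
  cmeasurable (fun x => F x * G x).
Proof.
move=> [F1 F2] [G1 G2]; split; under eq_fun do rewrite ?cReM ?cImM.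
  by apply: measurable_funB; exact: measurable_funM.
by apply: measurable_funD; exact: measurable_funM.
Qed.

Lemma cmeasurableN F : cmeasurable F -> cmeasurable (fun x => - F x).
Proof.
move=> mF; under eq_fun do rewrite -mulN1r.
by apply: cmeasurableM => //; exact: cmeasurable_cst.
Qed.

Lemma cmeasurableB F G : cmeasurable F -> cmeasurable G ->
  cmeasurable (fun x => F x - G x).
Proof. by move=> mF mG; apply: cmeasurableD => //; exact: cmeasurableN. Qed.

Lemma cmeasurableX F n : cmeasurable F -> cmeasurable (fun x => F x ^+ n).
Proof.
move=> mF; elim: n => [|n IH].
  by under eq_fun do rewrite expr0; exact: cmeasurable_cst.
by under eq_fun do rewrite exprS; exact: cmeasurableM.
Qed.

Lemma cmeasurable_conj F : cmeasurable F -> cmeasurable (fun x => (F x)^*%C).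
Proof.
move=> [F1 F2]; split; under eq_fun do rewrite ?cRe_conj ?cIm_conj; first by [].
exact: measurable_funN.
Qed.

Lemma measurable_cabs F : cmeasurable F ->
  measurable_fun setT (fun x => cabs (F x)).
Proof.
move=> [F1 F2].
have -> : (fun x => cabs (F x)) =
    (fun x => Num.sqrt (complex.Re (F x) ^+ 2 + complex.Im (F x) ^+ 2)).
  by apply/funext => x; case: (F x).
apply: measurable_sqrt; last by move=> x; rewrite addr_ge0// sqr_ge0.
by apply: measurable_funD; exact: measurable_funX.
Qed.

Lemma cmeasurableV F : cmeasurable F -> cmeasurable (fun x => (F x)^-1).
Proof.
move=> mF; have mn : measurable_fun setT (fun x => (cabs (F x) ^+ 2)^-1).
  apply: measurable_inv_ge0; last by move=> x; rewrite sqr_ge0.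
  by apply: measurable_funX; exact: measurable_cabs.
case: mF => F1 F2; split; under eq_fun do rewrite ?cReV ?cImV.
  exact: measurable_funM.
by apply: measurable_funN; exact: measurable_funM.
Qed.

End ComplexMeasurability.

Lemma cmeasurable_comp d d' (T : measurableType d) (T' : measurableType d')
    (R : realType) (F : T' -> R[i]) (phi : T -> T') :
  measurable_fun setT phi -> cmeasurable F -> cmeasurable (fun x => F (phi x)).
Proof.
move=> mphi [F1 F2].
by split; [exact: (measurableT_comp F1)|exact: (measurableT_comp F2)].
Qed.

(** * Integrals of complex functions *)

Section MassBound.
Context d (T : measurableType d) (R : realType).
Variable mu : {measure set T -> \bar R}.
Implicit Types G H : T -> R.

(** Finiteness of the integral, measurability and sign in one predicate, with an explicit
bound: all the estimates below are of this kind. *)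
Definition mass_le G (K : R) := [/\ measurable_fun setT G, forall x, 0 <= G x &
  (\int[mu]_x (G x)%:E <= K%:E)%E].

Lemma mass_le_bound_ge0 G K : mass_le G K -> 0 <= K.
Proof.
by case=> _ G0 GK; rewrite -lee_fin (le_trans _ GK)// integral_ge0// => x _;
  rewrite lee_fin.
Qed.

Lemma mass_leD G H K L : mass_le G K -> mass_le H L ->
  mass_le (fun x => G x + H x) (K + L).
Proof.
move=> [mG G0 GK] [mH H0 HL]; split; first exact: measurable_funD.
  by move=> x; rewrite addr_ge0.
under eq_integral do rewrite EFinD.
rewrite ge0_integralD//; [|by move=> ? _; rewrite lee_fin|exact/measurable_EFinP
  |by move=> ? _; rewrite lee_fin|exact/measurable_EFinP].
by rewrite EFinD leeD.
Qed.

Lemma mass_leZ G K (c : R) : 0 <= c -> mass_le G K ->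
  mass_le (fun x => c * G x) (c * K).
Proof.
move=> c0 [mG G0 GK]; split; first exact: measurable_funM.
  by move=> x; rewrite mulr_ge0.
under eq_integral do rewrite EFinM.
rewrite ge0_integralZl_EFin//; [|by move=> ? _; rewrite lee_fin|
  exact/measurable_EFinP].
by rewrite EFinM lee_wpmul2l// lee_fin.
Qed.

End MassBound.

Section ComplexIntegral.
Context d (T : measurableType d) (R : realType).
Variable mu : {measure set T -> \bar R}.
Implicit Types F G : T -> R[i].

Definition cintegrable F :=
  mu.-integrable setT (fun x => (complex.Re (F x))%:E) /\
  mu.-integrable setT (fun x => (complex.Im (F x))%:E).

Definition cintegral F : R[i] :=
  Rintegral mu setT (fun x => complex.Re (F x)) +i*
  Rintegral mu setT (fun x => complex.Im (F x)).

Lemma cintegrable_measurable F : cintegrable F -> cmeasurable F.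
Proof.
by move=> [/measurable_int/measurable_EFinP ? /measurable_int/measurable_EFinP].
Qed.

Lemma real_dominated (f G : T -> R) K : measurable_fun setT f ->
  {ae mu, forall x, `|f x| <= G x} -> mass_le mu G K ->
  mu.-integrable setT (fun x => (f x)%:E) /\ `|Rintegral mu setT f| <= K.
Proof.
move=> mf fG [mG G0 GK].
have fK : (\int[mu]_x `|(f x)%:E| <= K%:E)%E.
  apply: le_trans GK; apply: ae_ge0_le_integral => //.
  - by apply: measurableT_comp => //; exact/measurable_EFinP.
  - by move=> x _; rewrite lee_fin.
  - exact/measurable_EFinP.
  - by apply: filterS fG => x fGx _; rewrite lee_fin.
have fi : mu.-integrable setT (fun x => (f x)%:E).
  apply/integrableP; split; first exact/measurable_EFinP.
  by rewrite (le_lt_trans fK)// ltry.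
split => //; apply: le_trans (le_normr_Rintegral _ fi) _ => //.
rewrite /Rintegral -lee_fin fineK//.
by rewrite ge0_fin_numE ?integral_ge0// (le_lt_trans fK) ?ltry.
Qed.

Lemma cintegrable_dominated F (G : T -> R) K : cmeasurable F ->
  {ae mu, forall x, cabs (F x) <= G x} -> mass_le mu G K -> cintegrable F.
Proof.
move=> [F1 F2] FG GK; split.
- apply: (real_dominated F1 _ GK).1; apply: filterS FG => x.
  exact: le_trans (Re_le_cabs _).
- apply: (real_dominated F2 _ GK).1; apply: filterS FG => x.
  exact: le_trans (Im_le_cabs _).
Qed.

(** The factor [2] is lost in bounding the real and the imaginary part separately. *)
Lemma cabs_cintegral_le F (G : T -> R) K : cmeasurable F ->
  {ae mu, forall x, cabs (F x) <= G x} -> mass_le mu G K ->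
  cabs (cintegral F) <= 2 * K.
Proof.
move=> [F1 F2] FG GK; rewrite mulr2n mulrDl mul1r.
apply: le_trans (cabs_le_ReIm _) _ => /=; apply: lerD.
- apply: (real_dominated F1 _ GK).2; apply: filterS FG => x.
  exact: le_trans (Re_le_cabs _).
- apply: (real_dominated F2 _ GK).2; apply: filterS FG => x.
  exact: le_trans (Im_le_cabs _).
Qed.

Lemma cintegrableD F G : cintegrable F -> cintegrable G ->
  cintegrable (fun x => F x + G x).
Proof.
move=> [F1 F2] [G1 G2]; split; under eq_fun do rewrite ?cReD ?cImD EFinD;
  exact: integrableD.
Qed.

Lemma cintegralD F G : cintegrable F -> cintegrable G ->
  cintegral (fun x => F x + G x) = cintegral F + cintegral G.
Proof.
move=> [F1 F2] [G1 G2]; rewrite /cintegral.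
under eq_Rintegral do rewrite cReD.
under [X in _ +i* X]eq_Rintegral do rewrite cImD.
by rewrite !RintegralD.
Qed.

Lemma cintegrableZ (c : R[i]) F : cintegrable F ->
  cintegrable (fun x => c * F x).
Proof.
move=> [F1 F2]; split.
- under eq_fun do rewrite cReM EFinB !EFinM.
  by apply: integrableB => //; exact: integrableZl.
- under eq_fun do rewrite cImM EFinD !EFinM.
  by apply: integrableD => //; exact: integrableZl.
Qed.

Lemma cintegralZ (c : R[i]) F : cintegrable F ->
  cintegral (fun x => c * F x) = c * cintegral F.
Proof.
move=> [F1 F2]; rewrite /cintegral.
under eq_Rintegral do rewrite cReM.
under [X in _ +i* X]eq_Rintegral do rewrite cImM.
have Z (k : R) f : mu.-integrable setT (fun x => (f x)%:E) ->
    mu.-integrable setT (EFin \o (fun x => k * f x)).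
  by move=> fi; rewrite /comp; under eq_fun do rewrite EFinM; exact: integrableZl.
rewrite RintegralB//; [|exact: Z|exact: Z].
rewrite RintegralD//; [|exact: Z|exact: Z].
by rewrite !RintegralZl//; case: c.
Qed.

Lemma cintegrableN F : cintegrable F -> cintegrable (fun x => - F x).
Proof.
by move=> iF; under eq_fun do rewrite -mulN1r; exact: cintegrableZ.
Qed.

Lemma cintegrableB F G : cintegrable F -> cintegrable G ->
  cintegrable (fun x => F x - G x).
Proof. by move=> iF iG; apply: cintegrableD => //; exact: cintegrableN. Qed.

Lemma cintegralN F : cintegrable F -> cintegral (fun x => - F x) = - cintegral F.
Proof.
move=> iF; under [X in cintegral X]eq_fun do rewrite -mulN1r.
by rewrite cintegralZ// mulN1r.
Qed.

Lemma cintegralB F G : cintegrable F -> cintegrable G ->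
  cintegral (fun x => F x - G x) = cintegral F - cintegral G.
Proof.
by move=> iF iG; rewrite cintegralD// ?cintegralN//; exact: cintegrableN.
Qed.

Lemma cintegral_ae_eq F G : cmeasurable F -> cmeasurable G ->
  {ae mu, forall x, F x = G x} -> cintegral F = cintegral G.
Proof.
move=> [F1 F2] [G1 G2] FG; rewrite /cintegral /Rintegral.
congr (fine _ +i* fine _); apply: ae_eq_integral => //;
  do ?exact/measurable_EFinP; by apply: filterS FG => x ->.
Qed.

Lemma cintegral0 : cintegral (fun=> 0) = 0.
Proof. by rewrite /cintegral /= !Rintegral_cst// !mul0r. Qed.

Lemma cintegral_change (phi : T -> T) F : measurable_fun setT phi ->
  (forall A, measurable A -> mu (phi @^-1` A) = mu A) ->
  cintegrable (fun x => F (phi x)) -> cmeasurable F ->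
  cintegral (fun x => F (phi x)) = cintegral F.
Proof.
move=> mphi phimu [i1 i2] [F1 F2]; rewrite /cintegral /Rintegral.
have E (f : T -> R) : measurable_fun setT f ->
    mu.-integrable setT (fun x => (f (phi x))%:E) ->
    (\int[mu]_x (f (phi x))%:E = \int[mu]_x (f x)%:E)%E.
  move=> mf fi; have := integral_pushforward mphi (mu := mu) (D := setT)
      (f := EFin \o f).
  rewrite preimage_setT => <- //; last exact/measurable_EFinP.
  by apply: eq_measure_integral => A mA _; exact: phimu.
by congr (fine _ +i* fine _); exact: E.
Qed.

End ComplexIntegral.

(** * Translations and dilations of the line *)

Section LebesgueAffine.
Variable R : realType.
Local Notation leb := (@lebesgue_measure R).
Implicit Types A : set (measurableTypeR R).

Lemma lebesgue_measure_translate (a : R) A : measurable A ->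
  leb ((fun x => x + a) @^-1` A) = leb A.
Proof.
have mt : measurable_fun setT ((fun x => x + a) : measurableTypeR R -> measurableTypeR R).
  exact: measurable_funD.
move=> mA; apply/esym.
apply: (@lebesgue_measure_unique _ (measure_function_pushforward__canonical__measure_function_Measure leb mt)) => //= _ [[b c]] _ <-.
rewrite /pushforward (_ : _ @^-1` _ = `]b - a, c - a]%classic).
  rewrite !lebesgue_measure_itv/= !lte_fin ltrD2r -!EFinB.
  by case: ifP => // _; congr (_%:E); ring.
by apply/seteqP; split => x /=; rewrite !in_itv/= ltrBlDr lerBrDr.
Qed.

Lemma lebesgue_measure_scale (c : R) A : 0 < c -> measurable A ->
  leb ((fun x => c * x) @^-1` A) = (c^-1%:E * leb A)%E.
Proof.
move=> c0 mA.
have mt : measurable_fun setT ((fun x => c * x) : measurableTypeR R -> measurableTypeR R).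
  exact: mulrl_measurable.
have c00 : 0 <= c by exact: ltW.
suff -> : leb A = (c%:E * leb ((fun x => c * x)%R @^-1` A))%E.
  by rewrite muleA -EFinM mulVf ?gt_eqF// mul1e.
pose nu := measure_function_pushforward__canonical__measure_function_Measure leb mt.
apply: (@lebesgue_measure_unique _ (mscale (NngNum c00) nu)) => //= _ [[a b]] _ <-.
rewrite /mscale/= /pushforward (_ : _ @^-1` _ = `]a / c, b / c]%classic).
  rewrite !lebesgue_measure_itv/= !lte_fin ltr_pM2r ?invr_gt0// -!EFinB.
  case: ifP => // _; last by rewrite mule0.
  by rewrite -EFinM; congr (_%:E); field; rewrite gt_eqF.
by apply/seteqP; split => x /=; rewrite !in_itv/= ltr_pdivrMr// ler_pdivlMr// mulrC.
Qed.

Lemma ge0_integral_lebesgue_scale (c : R) (f : R -> \bar R) : 0 < c ->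
  measurable_fun setT f -> (forall x, 0 <= f x)%E ->
  (c%:E * \int[leb]_x f (c * x)%R = \int[leb]_x f x)%E.
Proof.
move=> c0 mf f0.
have mt : measurable_fun setT ((fun x => c * x) : measurableTypeR R -> measurableTypeR R).
  exact: mulrl_measurable.
have := ge0_integral_pushforward mt leb (D := setT) (f := f) measurableT mf _.
rewrite preimage_setT => <-; last by move=> ? _; exact: f0.
have c00 : 0 <= c^-1 by rewrite invr_ge0 ltW.
rewrite (eq_measure_integral (mscale (NngNum c00) leb)); last first.
  by move=> A mA _; exact: lebesgue_measure_scale.
by rewrite ge0_integral_mscale//= muleA -EFinM divff ?gt_eqF// mul1e.
Qed.

End LebesgueAffine.

(** * The plane measure and its isometries *)

Section PlaneMeasure.
Variable R : realType.
Local Notation leb := (@lebesgue_measure R).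
Local Notation RR := (measurableTypeR R * measurableTypeR R)%type.

(** A constant of its own, so that the product measure is known to be sigma-finite and can
in turn be a factor of a product. *)
Definition plane_measure : set RR -> \bar R := (leb \x leb)%E.

HB.instance Definition _ := Measure.on plane_measure.

Lemma plane_measure_sigma_finite : sigma_finite setT plane_measure.
Proof.
exists (fun n => `[- n%:R, n%:R]%classic `*` `[- n%:R, n%:R]%classic).
  rewrite predeqE => -[x y]; split=> // _.
  exists (Num.bound (`|x| + `|y|)) => //=.
  have /ltW := archi_boundP (addr_ge0 (normr_ge0 x) (normr_ge0 y)).
  rewrite !in_itv /= -!ler_norml => xy.
  by split; apply: le_trans xy; rewrite ?lerDl ?lerDr.
have fin (n : nat) : (leb [set` `[- n%:R, n%:R]%R] < +oo)%E.
  by rewrite lebesgue_measure_itv/=; case: ifP => _; rewrite ?ltry.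
move=> n; split; first exact: measurableX.
rewrite [ltLHS]product_measure1E// lte_mul_pinfty//; last exact: fin.
by rewrite ge0_fin_numE//; exact: fin.
Qed.

HB.instance Definition _ := Measure_isSigmaFinite.Build _ _ _ plane_measure
  plane_measure_sigma_finite.

Local Notation mu2 := plane_measure.

Definition mpreserving (phi : RR -> RR) := measurable_fun setT phi /\
  forall A, measurable A -> mu2 (phi @^-1` A) = mu2 A.

Lemma mpreserving_comp phi psi : mpreserving phi -> mpreserving psi ->
  mpreserving (psi \o phi).
Proof.
move=> [mf f] [mg g]; split; first exact: measurableT_comp.
move=> A mA; rewrite comp_preimage f ?g//.
by rewrite -[X in measurable X]setTI; exact: mg.
Qed.

Lemma mpreserving_shear_snd (g : R -> R) : measurable_fun setT g ->
  mpreserving (fun p => (p.1, p.2 + g p.1)).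
Proof.
move=> mg; split.
  apply: measurable_fun_pair => //; apply: measurable_funD => //.
  exact: measurableT_comp.
move=> A mA; rewrite /mu2 /product_measure1; apply: eq_integral => x _ /=.
rewrite -(lebesgue_measure_translate (g x) (A := xsection A x)); last exact: measurable_xsection.
by congr (leb _); apply/seteqP; split => y; rewrite /xsection/= !inE.
Qed.

Lemma plane_measure_ysection (A : set RR) : measurable A ->
  mu2 A = (\int[leb]_y leb (ysection A y))%E.
Proof.
move=> mA; rewrite -[RHS]/((leb \x^ leb)%E A).
by apply: product_measure_unique => // B C mB mC; exact: product_measure2E.
Qed.

Lemma mpreserving_shear_fst (g : R -> R) : measurable_fun setT g ->
  mpreserving (fun p => (p.1 + g p.2, p.2)).
Proof.
move=> mg; have mphi : measurable_fun setT
    ((fun p => (p.1 + g p.2, p.2)) : RR -> RR).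
  apply: measurable_fun_pair => //; apply: measurable_funD => //.
  exact: measurableT_comp.
split => // A mA; rewrite !plane_measure_ysection//; last first.
  by rewrite -[X in measurable X]setTI; exact: mphi.
apply: eq_integral => y _ /=.
rewrite -(lebesgue_measure_translate (g y) (A := ysection A y)); last exact: measurable_ysection.
by congr (leb _); apply/seteqP; split => x; rewrite /ysection/= !inE.
Qed.

Lemma mpreserving_translate (a b : R) :
  mpreserving (fun p => (p.1 + a, p.2 + b)).
Proof.
exact: (mpreserving_comp (mpreserving_shear_snd (measurable_cst b))
                         (mpreserving_shear_fst (measurable_cst a))).
Qed.

(** A rotation is the product of a horizontal, a vertical and a horizontal shear; the
slope [(cos - 1) / sin] of the horizontal ones excludes [sin = 0]. *)
Lemma mpreserving_rotate_neq0 (a b : R) : a ^+ 2 + b ^+ 2 = 1 -> b != 0 ->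
  mpreserving (fun p => (a * p.1 - b * p.2, b * p.1 + a * p.2)).
Proof.
move=> ab b0; pose s := (a - 1) / b.
have Sx := mpreserving_shear_fst (@mulrl_measurable R setT s).
have Sy := mpreserving_shear_snd (@mulrl_measurable R setT b).
have := mpreserving_comp (mpreserving_comp Sx Sy) Sx.
set F := _ \o _; set G := (fun _ => _); suff -> : F = G by [].
apply/funext => -[x y]; rewrite /F /G /= /s.
have b2 : b * b = (1 - a) * (1 + a) by move: ab; rewrite !expr2 => ab; lra.
have sb : (a - 1) / b * b = a - 1 by rewrite mulfVK.
have sa : (a - 1) / b * (1 + a) = - b.
  by apply: (mulIf b0); rewrite mulrAC sb mulNr b2; ring.
congr (_, _).
  transitivity (x * (1 + (a - 1) / b * b) + y * ((a - 1) / b * (1 + (a - 1) / b * b + 1 ))).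
    ring.
  by rewrite sb (_ : 1 + (a - 1) + 1 = 1 + a); [rewrite sa; ring|ring].
transitivity (y * (1 + (a - 1) / b * b) + b * x); first by ring.
by rewrite sb; ring.
Qed.

Lemma mpreserving_rotate (a b : R) : a ^+ 2 + b ^+ 2 = 1 ->
  mpreserving (fun p => (a * p.1 - b * p.2, b * p.1 + a * p.2)).
Proof.
move=> ab; have [b0|b0] := eqVneq b 0; last exact: mpreserving_rotate_neq0.
(* A half turn is a double quarter turn, and the identity is four of them. *)
have quarter : mpreserving (fun p => (0 * p.1 - 1 * p.2, 1 * p.1 + 0 * p.2)).
  by apply: mpreserving_rotate_neq0; rewrite ?oner_eq0// expr0n expr1n add0r.
have half := mpreserving_comp quarter quarter.
move: ab; rewrite b0 expr0n addr0 => /eqP; rewrite sqrf_eq1 => /orP[] /eqP ->.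
  have := mpreserving_comp half half.
  set F := _ \o _; set G := (fun _ => _); suff -> : F = G by [].
  by apply/funext => -[x y]; rewrite /F /G /=; congr (_, _); ring.
move: half; set F := _ \o _; set G := (fun _ => _); suff -> : F = G by [].
by apply/funext => -[x y]; rewrite /F /G /=; congr (_, _); ring.
Qed.

End PlaneMeasure.

(** * Polar coordinates *)

Section Radial.
Variable R : realType.
Local Notation leb := (@lebesgue_measure R).
Local Notation RR := (measurableTypeR R * measurableTypeR R)%type.
Local Notation mu2 := (@plane_measure R).

Definition toC (p : RR) : R[i] := (p.1 : R) +i* (p.2 : R).

Lemma cmeasurable_toC : cmeasurable toC.
Proof. by split; [exact: measurable_fst|exact: measurable_snd]. Qed.

Lemma integral_inv_oneDsqr :
  (\int[leb]_x ((oneDsqr x)^-1)%:E = (pi : R)%:E)%E.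
Proof.
rewrite ge0_symfun_integralT; last 3 first.
- by move=> x; rewrite invr_ge0 (le_trans ler01)// oneDsqr_ge1.
- exact: continuous_oneDsqrV.
- by move=> x /=; rewrite /oneDsqr sqrrN.
rewrite (_ : [set x | _] = `[0, +oo[%classic); last first.
  by apply/seteqP; split => x /=; rewrite in_itv/= andbT.
by rewrite integral0y_oneDsqr -EFinM; congr (_%:E); field.
Qed.

Lemma cabs_toC_scale (x t : R) :
  cabs (toC (x, `|x| * t)) = `|x| * Num.sqrt (oneDsqr t).
Proof.
rewrite /toC /cabs /= /oneDsqr -[in RHS]sqrtr_sqr -sqrtrM ?sqr_ge0//.
by congr Num.sqrt; rewrite exprMn real_normK ?num_real//; ring.
Qed.

Lemma measurable_comp_cabs d (T : measurableType d) (g : R -> R) :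
  measurable_fun setT g -> forall F : T -> R[i], cmeasurable F ->
  measurable_fun setT (fun p => (g (cabs (F p)))%:E).
Proof.
move=> mg F mF; apply/measurable_EFinP; apply: (measurableT_comp mg).
exact: measurable_cabs.
Qed.

(** Polar coordinates, with the slope [t = y / |x|] as the angular variable: the
two changes of variables involved are then linear in one real variable, and the
angular measure is [dt / (1 + t ^ 2)] on each half plane. *)
Lemma integral_radial (g : R -> R) : measurable_fun setT g ->
  (forall x, 0 <= g x) ->
  (\int[mu2]_p (g (cabs (toC p)))%:E =
   (pi : R)%:E * \int[leb]_x (`|x| * g `|x|)%:E)%E.
Proof.
move=> mg g0.
have mga d (T : measurableType d) := @measurable_comp_cabs d T g mg.
pose k (x t : R) : \bar R := (`|x| * g (`|x| * Num.sqrt (oneDsqr t)))%:E.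
have mk : measurable_fun setT (fun p : RR => k p.1 p.2).
  apply/measurable_EFinP; apply: measurable_funM.
    exact: (measurableT_comp (@normr_measurable R setT)).
  apply: (measurableT_comp mg); apply: measurable_funM.
    exact: (measurableT_comp (@normr_measurable R setT)).
  apply: measurable_sqrt.
    rewrite /oneDsqr; apply: measurable_funD => //; exact: measurable_funX.
  by move=> p; rewrite (le_trans ler01)// oneDsqr_ge1.
have k0 (p : RR) : (0 <= k p.1 p.2)%E by rewrite lee_fin mulr_ge0.
transitivity (\int[leb]_x \int[leb]_t k x t)%E.
  rewrite fubini_tonelli1//; last 2 first.
  - exact: (mga _ _ _ (cmeasurable_toC)).
  - by move=> p; rewrite lee_fin.
  apply: ge0_ae_eq_integral => //.
  - apply: measurable_fun_fubini_tonelli_F => //.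
      exact: (mga _ _ _ (cmeasurable_toC)).
    by move=> p; rewrite lee_fin.
  - exact: (@measurable_fun_fubini_tonelli_F _ _ _ _ _ leb (fun p => k p.1 p.2)).
  - by move=> x _; apply: integral_ge0 => y _; rewrite lee_fin.
  - by move=> x _; apply: integral_ge0 => y _; rewrite lee_fin mulr_ge0.
  exists [set 0]; split => //; first exact: lebesgue_measure_set1.
  move=> x /=; apply: contra_notP => /eqP x0 _.
  have nx0 : 0 < `|x| by rewrite normr_gt0.
  have mgx : measurable_fun setT (fun t : R => (g (cabs (toC (x, t))))%:E).
    by apply: mga; split => //=; exact: measurable_cst.
  transitivity (`|x|%:E * \int[leb]_t (g (cabs (toC (x, `|x| * t)%R)))%:E)%E.
    by apply/esym/(ge0_integral_lebesgue_scale nx0 mgx) => t; rewrite lee_fin.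
  rewrite -ge0_integralZl_EFin//.
  - by apply: eq_integral => t _; rewrite cabs_toC_scale -EFinM.
  - by move=> t _; rewrite lee_fin.
  - apply: mga; split => /=; first exact: measurable_cst.
    exact: mulrl_measurable.
transitivity (\int[leb]_t \int[leb]_x k x t)%E.
  exact: (fubini_tonelli (fun p : RR => k p.1 p.2)).
pose h (x : R) : \bar R := (`|x| * g `|x|)%:E.
have mh : measurable_fun setT h.
  apply/measurable_EFinP; apply: measurable_funM => //.
  exact: measurableT_comp.
have h0 x : (0 <= h x)%E by rewrite lee_fin mulr_ge0.
have mo : measurable_fun setT (fun x : R => ((oneDsqr x)^-1)%:E).
  apply/measurable_EFinP; apply: continuous_measurable_fun.
  exact: continuous_oneDsqrV.
rewrite -/h muleC -integral_inv_oneDsqr -ge0_integralZl//=; last first.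
  by apply: integral_ge0 => ? _; exact: h0.
apply: eq_integral => t _.
have c1 : 1 <= oneDsqr t by exact: oneDsqr_ge1.
set c := Num.sqrt (oneDsqr t); have c0 : 0 < c.
  by rewrite sqrtr_gt0 (lt_le_trans ltr01).
have -> : oneDsqr t = c * c.
  by rewrite -expr2 sqr_sqrtr// (le_trans ler01).
have -> : (\int[leb]_x h x = c%:E * \int[leb]_x h (c * x)%R)%E.
  by rewrite ge0_integral_lebesgue_scale.
rewrite muleAC -EFinM.
rewrite -ge0_integralZl_EFin//; last 2 first.
- exact: (measurableT_comp mh (@mulrl_measurable R setT c)).
- by rewrite mulr_ge0 ?invr_ge0 ?mulr_ge0 ?ltW.
apply: eq_integral => x _; rewrite /k /h -EFinM; congr (_%:E).
rewrite !normrM (gtr0_norm c0) [`|x| * c]mulrC; field.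
by rewrite gt_eqF.
Qed.

End Radial.

(** * Integrals of powers on half lines *)

Section OneDimensional.
Variable R : realType.
Local Notation leb := (@lebesgue_measure R).

Lemma integral_even (h : R -> R) : measurable_fun setT h -> (forall x, 0 <= h x) ->
  (\int[leb]_x (h `|x|)%:E = 2%:E * \int[leb]_(x in `]0%R, +oo[) (h x)%:E)%E.
Proof.
move=> mh h0.
have mha : measurable_fun setT (fun x : R => (h `|x|)%:E).
  by apply/measurable_EFinP; apply: measurableT_comp.
have mhE : measurable_fun setT (fun x : R => (h x)%:E) by exact/measurable_EFinP.
have -> : [set: R] = `]-oo, 0] `|` `]0, +oo[.
  apply/esym/seteqP; split => // x _ /=; rewrite !in_itv/= andbT.
  by case: (leP x 0); [left|right].
rewrite ge0_integral_setU//=; last 3 first.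
- exact: measurable_funTS.
- by move=> x _; rewrite lee_fin.
- rewrite disj_set2E; apply/eqP/seteqP; split => // x /= [].
  by rewrite !in_itv/= andbT leNgt => /negP.
have -> : (\int[leb]_(x in `]-oo, 0%R]) (h `|x|)%:E =
    \int[leb]_(x in `]-oo, 0%R]) (h (- x)%R)%:E)%E.
  by apply: eq_integral => x; rewrite inE/= in_itv/= => x0; rewrite ler0_norm.
rewrite -(ge0_integration_by_substitution0 mhE); last by move=> ?; rewrite lee_fin.
rewrite -integral_itv_obnd_cbnd; last exact: measurable_funTS.
rewrite (_ : 2%:E = 1 + 1)%E// ge0_muleDl// !mul1e; congr (_ + _)%E.
by apply: eq_integral => x; rewrite inE/= in_itv/= andbT => x0; rewrite gtr0_norm.
Qed.

Lemma integral_segment_derive (F f : R -> R) (a b : R) : a < b ->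
  (forall x, a <= x <= b -> is_derive x 1 F (f x)) ->
  (forall x, a <= x <= b -> {for x, continuous f}) ->
  (\int[leb]_(x in `[a, b]) (f x)%:E = (F b - F a)%:E)%E.
Proof.
move=> ab dF cf.
have cF x : a <= x <= b -> {for x, continuous F}.
  by move=> /dF dFx; apply/differentiable_continuous/derivable1_diffP.
rewrite (continuous_FTC2 ab (F := F))//.
- apply: continuous_in_subspaceT => x; rewrite inE/= in_itv/=; exact: cf.
- split; first by move=> x; rewrite in_itv/= => /andP[/ltW ax /ltW xb];
    have [] := dF x; rewrite ?ax ?xb.
  + by apply: cvg_at_right_filter; apply: cF; rewrite lexx ltW.
  + by apply: cvg_at_left_filter; apply: cF; rewrite lexx ltW.
- move=> x; rewrite in_itv/= => /andP[/ltW ax /ltW xb].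
  by rewrite derive1E; apply: derive_val; apply: dF; rewrite ax xb.
Qed.

Lemma integral_powR_segment (s a b : R) : s != 0 -> 0 < a -> a < b ->
  (\int[leb]_(x in `[a, b]) (x `^ (s - 1))%:E = ((b `^ s - a `^ s) / s)%:E)%E.
Proof.
move=> s0 a0 ab.
have -> : (b `^ s - a `^ s) / s = b `^ s / s - a `^ s / s by rewrite mulrBl.
apply: (integral_segment_derive (F := fun x => x `^ s / s)) => // x /andP[ax xb].
- have x0 : 0 < x by exact: lt_le_trans ax.
  have := is_derive1_powR s x0.
  move=> dx; have := is_deriveM dx (is_derive_cst (s^-1) x 1).
  rewrite scaler0 add0r; set F := _ * _; rewrite (_ : F = fun x => x `^ s / s)//.
  by move=> /is_derive_eq; apply; rewrite /GRing.scale/=; field.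
- apply/differentiable_continuous/derivable1_diffP.
  by apply: derivable_powR; rewrite in_itv/= andbT (lt_le_trans a0).
Qed.

(** The bound is uniform in the truncation, so it passes to the limit. *)
Lemma integral_bigcup_segment_le (f : R -> R) (u v : nat -> R) (K : R) :
  measurable_fun setT f -> (forall x, 0 <= f x) ->
  {homo u : m n / (m <= n)%N >-> n <= m} ->
  {homo v : m n / (m <= n)%N >-> m <= n} ->
  (forall n, (\int[leb]_(x in `[u n, v n]) (f x)%:E <= K%:E)%E) ->
  (\int[leb]_(x in \bigcup_n `[u n, v n]%classic) (f x)%:E <= K%:E)%E.
Proof.
move=> mf f0 hu hv uvK.
pose F i : set (measurableTypeR R) := `[u i, v i]%classic.
have F1 : {homo F : n m / (n <= m)%N >-> (n <= m)%O}.
  move=> m n mn; apply/subsetPset => x /=; rewrite /F/= !in_itv/= => /andP[ux xv].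
  by rewrite (le_trans (hu _ _ mn) ux) (le_trans xv (hv _ _ mn)).
have F2 i : measurable (F i) by exact: measurable_itv.
have F3 i : measurable_fun (F i) (fun x => (f x)%:E).
  by apply: measurable_funTS; exact/measurable_EFinP.
have F4 i x : F i x -> (0 <= (f x)%:E)%E by rewrite lee_fin.
have c := ge0_nondecreasing_set_cvg_integral (mu := leb) F1 F2 F3 F4.
rewrite -(cvg_lim _ c)//; apply: lime_le; first exact: cvgP c.
exact: nearW.
Qed.

Lemma integral_powR_near0 (s b : R) : 0 < s -> 0 < b ->
  (\int[leb]_(x in `]0%R, b]) (x `^ (s - 1))%:E <= (b `^ s / s)%:E)%E.
Proof.
move=> s0 b0.
have -> : `]0, b]%classic = \bigcup_n `[b / n.+2%:R, b]%classic.
  apply/seteqP; split => x /=.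
    rewrite in_itv/= => /andP[x0 xb]; exists (Num.bound (b / x)) => //=.
    rewrite in_itv/= xb andbT ler_pdivrMr// mulrC -ler_pdivrMr//.
    apply: le_trans (ltW (archi_boundP _)) _; first by rewrite divr_ge0// ltW.
    by rewrite ler_nat -addn2 leq_addr.
  move=> [n _] /=; rewrite !in_itv/= => /andP[nx ->]; rewrite andbT.
  by rewrite (lt_le_trans _ nx)// divr_gt0.
apply: (@integral_bigcup_segment_le (fun x => x `^ (s - 1)) _ (fun=> b)) => //.
- by move=> x; exact: powR_ge0.
- move=> m n mn /=; rewrite ler_pM2l// lef_pV2 ?posrE// ler_nat.
  by rewrite !ltnS.
- move=> n; rewrite integral_powR_segment ?gt_eqF ?divr_gt0//.
    rewrite lee_fin ler_pM2r ?invr_gt0// lerBlDr lerDl; exact: powR_ge0.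
  by rewrite ltr_pdivrMr// ltr_pMr// ltr1n.
Qed.

Lemma integral_powR_neary (s a : R) : s < 0 -> 0 < a ->
  (\int[leb]_(x in `[a, +oo[) (x `^ (s - 1))%:E <= (a `^ s / - s)%:E)%E.
Proof.
move=> s0 a0.
have -> : `[a, +oo[%classic = \bigcup_n `[a, a + n.+1%:R]%classic.
  apply/seteqP; split => x /=.
    rewrite in_itv/= andbT => ax; exists (Num.bound (x - a)) => //=.
    rewrite in_itv/= ax /= -lerBlDl.
    apply: le_trans (ltW (archi_boundP _)) _; first by rewrite subr_ge0.
    by rewrite ler_nat.
  by move=> [n _] /=; rewrite !in_itv/= => /andP[->].
apply: (@integral_bigcup_segment_le (fun x => x `^ (s - 1)) (fun=> a)) => //.
- by move=> x; exact: powR_ge0.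
- by move=> m n mn /=; rewrite lerD2l ler_nat.
- move=> n; rewrite integral_powR_segment ?lt_eqF ?ltrDl//.
  rewrite lee_fin -[leLHS]mulrNN -invrN ler_pM2r ?invr_gt0 ?oppr_gt0//.
  by rewrite opprB lerBlDr lerDl powR_ge0.
Qed.

Lemma integral_exprn_segment (n : nat) (b : R) : 0 < b ->
  (\int[leb]_(x in `[0%R, b]) (x ^+ n)%:E = (b ^+ n.+1 / n.+1%:R)%:E)%E.
Proof.
move=> b0; have -> : b ^+ n.+1 / n.+1%:R =
    b ^+ n.+1 / n.+1%:R - 0 ^+ n.+1 / n.+1%:R by rewrite expr0n mul0r subr0.
apply: (integral_segment_derive (F := fun x => x ^+ n.+1 / n.+1%:R)) => // x _.
- have dx := is_deriveX n.+1 (is_derive_id x (1 : R)).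
  have := is_deriveZ (n.+1%:R^-1 : R) dx.
  rewrite (_ : _ \*: _ = fun x => x ^+ n.+1 / n.+1%:R); last first.
    by apply/funext => y; rewrite /= mulrC; congr (_ * _); rewrite fctE.
  move=> /is_derive_eq; apply; rewrite /GRing.scale/= mulr1.
  by rewrite mulrA mulVf ?mul1r ?pnatr_eq0.
- exact: exprn_continuous.
Qed.

End OneDimensional.

(** * Power singularities in the plane *)

Section PlaneMass.
Variable R : realType.
Local Notation leb := (@lebesgue_measure R).
Local Notation RR := (measurableTypeR R * measurableTypeR R)%type.
Local Notation mu2 := (@plane_measure R).
Local Notation toC := (@toC R).

Lemma ge0_integral_mpreserving (phi : RR -> RR) (f : RR -> \bar R) :
  mpreserving phi -> measurable_fun setT f -> (forall x, 0 <= f x)%E ->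
  (\int[mu2]_p f (phi p) = \int[mu2]_p f p)%E.
Proof.
move=> [mphi phimu] mf f0.
have := ge0_integral_pushforward mphi mu2 (D := setT) (f := f) measurableT mf _.
rewrite preimage_setT => <-; last by move=> ? _; exact: f0.
by apply: eq_measure_integral => A mA _; exact: phimu.
Qed.

Lemma toC_translate (z : R[i]) (p : RR) :
  toC p - z = toC (p.1 - complex.Re z, p.2 - complex.Im z).
Proof. by case: z. Qed.

Lemma cmeasurable_toCB (z : R[i]) : cmeasurable (fun p => toC p - z).
Proof.
by apply: cmeasurableB; [exact: cmeasurable_toC|exact: cmeasurable_cst].
Qed.

Lemma integral_radial_half (g : R -> R) : measurable_fun setT g ->
  (forall x, 0 <= g x) ->
  (\int[mu2]_p (g (cabs (toC p)))%:E =
   (2 * pi)%:E * \int[leb]_(x in `]0%R, +oo[) (x * g x)%:E)%E.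
Proof.
move=> mg g0; rewrite integral_radial// mulrC EFinM -muleA; congr (_ * _)%E.
have mh : measurable_fun setT (fun x : R => `|x| * g x) by exact: measurable_funM.
have h0 x : 0 <= `|x| * g x by rewrite mulr_ge0.
transitivity (\int[leb]_x (`|(`|x|)| * g `|x|)%:E)%E.
  by apply: eq_integral => x _; rewrite normr_id.
rewrite (integral_even mh h0); congr (_ * _)%E.
by apply: eq_integral => x; rewrite inE/= in_itv/= andbT => x0; rewrite gtr0_norm.
Qed.

Lemma mass_radial (g : R -> R) (K : R) (z : R[i]) : measurable_fun setT g ->
  (forall x, 0 <= g x) ->
  (\int[leb]_(x in `]0%R, +oo[) (x * g x)%:E <= K%:E)%E ->
  mass_le mu2 (fun p => g (cabs (toC p - z))) (2 * pi * K).
Proof.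
move=> mg g0 gK; split; last 1 first.
- under eq_integral do rewrite toC_translate.
  rewrite (ge0_integral_mpreserving
     (mpreserving_translate (- complex.Re z) (- complex.Im z))
     (f := fun p => (g (cabs (toC p)))%:E)); last 2 first.
  + exact: measurable_comp_cabs mg _ (@cmeasurable_toC R).
  + by move=> p; rewrite lee_fin.
  rewrite integral_radial_half// [leRHS]EFinM lee_wpmul2l//.
  by rewrite lee_fin mulr_ge0// pi_ge0.
- by apply: (measurableT_comp mg); apply: measurable_cabs; exact: cmeasurable_toCB.
- by move=> p.
Qed.

Lemma measurable_if_lt (g : R -> R) (d : R) : measurable_fun setT g ->
  measurable_fun setT (fun x : R => if x < d then g x else 0).
Proof.
by move=> mg; apply: measurable_fun_ifT => //; exact: measurable_fun_ltr.
Qed.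

Lemma mass_near (b d : R) (z : R[i]) : 0 < b -> 0 < d ->
  mass_le mu2 (fun p => let u := cabs (toC p - z) in
    if u < d then u `^ (b - 2) else 0) (2 * pi * (d `^ b / b)).
Proof.
move=> b0 d0.
pose g (x : R) := if x < d then x `^ (b - 2) else 0.
apply: (@mass_radial g) => //.
- by apply: measurable_if_lt; exact: measurable_powR.
- by move=> x; rewrite /g; case: ifP => // _; exact: powR_ge0.
apply: le_trans (integral_powR_near0 b0 d0).
have m1 : measurable_fun setT (fun x : R => (x * g x)%:E).
  apply/measurable_EFinP; apply: measurable_funM => //.
  by apply: measurable_if_lt; exact: measurable_powR.
have m2 : measurable_fun setT (fun x : R => (x `^ (b - 1))%:E).
  by apply/measurable_EFinP; exact: measurable_powR.
rewrite [leLHS]integral_mkcond [leRHS]integral_mkcond.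
apply: ge0_le_integral => //.
- move=> x _; rewrite patchE; case: ifPn => //.
  rewrite inE/= in_itv/= andbT => x0; rewrite lee_fin mulr_ge0 ?(ltW x0)//.
  by rewrite /g; case: ifP => // _; exact: powR_ge0.
- apply/(measurable_restrictT _ _).1 => //; exact: measurable_funTS.
- apply/(measurable_restrictT _ _).1 => //; exact: measurable_funTS.
move=> x _; rewrite !patchE; case: ifPn => [|_]; last first.
  by case: ifPn => // _; rewrite lee_fin powR_ge0.
rewrite inE/= in_itv/= andbT => x0; rewrite /g.
have [xd|xd] := ltP x d; last first.
  by rewrite mulr0; case: ifP => _; rewrite lee_fin ?powR_ge0.
rewrite ifT; last by rewrite inE/= in_itv/= x0 ltW.
rewrite lee_fin -{1}[x]powRr1 ?(ltW x0)// -powRD; last by rewrite (gt_eqF x0) implybT.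
by have -> : 1 + (b - 2) = b - 1 by ring.
Qed.

Lemma mass_far (b d : R) (z : R[i]) : b < 0 -> 0 < d ->
  mass_le mu2 (fun p => let u := cabs (toC p - z) in
    if u < d then 0 else u `^ (b - 2)) (2 * pi * (d `^ b / - b)).
Proof.
move=> b0 d0.
pose g (x : R) := if x < d then 0 else x `^ (b - 2).
have mg : measurable_fun setT g.
  by apply: measurable_fun_ifT => //; exact: measurable_fun_ltr.
apply: (@mass_radial g) => //.
- by move=> x; rewrite /g; case: ifP => // _; exact: powR_ge0.
apply: le_trans (integral_powR_neary b0 d0).
have m1 : measurable_fun setT (fun x : R => (x * g x)%:E).
  by apply/measurable_EFinP; apply: measurable_funM.
have m2 : measurable_fun setT (fun x : R => (x `^ (b - 1))%:E).
  by apply/measurable_EFinP; exact: measurable_powR.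
rewrite [leLHS]integral_mkcond [leRHS]integral_mkcond.
apply: ge0_le_integral => //.
- move=> x _; rewrite patchE; case: ifPn => //.
  rewrite inE/= in_itv/= andbT => x0; rewrite lee_fin mulr_ge0 ?(ltW x0)//.
  by rewrite /g; case: ifP => // _; exact: powR_ge0.
- apply/(measurable_restrictT _ _).1 => //; exact: measurable_funTS.
- apply/(measurable_restrictT _ _).1 => //; exact: measurable_funTS.
move=> x _; rewrite !patchE; case: ifPn => [|_]; last first.
  by case: ifPn => // _; rewrite lee_fin powR_ge0.
rewrite inE/= in_itv/= andbT => x0; rewrite /g.
have [xd|xd] := ltP x d.
  by rewrite mulr0; case: ifP => _; rewrite lee_fin ?powR_ge0.
rewrite ifT; last by rewrite inE/= in_itv/= xd.
rewrite lee_fin -{1}[x]powRr1 ?(ltW x0)// -powRD; last by rewrite (gt_eqF x0) implybT.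
by have -> : 1 + (b - 2) = b - 1 by ring.
Qed.

Lemma ae_neq_point (z : R[i]) : {ae mu2, forall p, toC p != z}.
Proof.
exists ([set complex.Re z] `*` [set complex.Im z]); split.
- exact: measurableX.
- rewrite [LHS]product_measure1E//.
  by rewrite (_ : _ [set complex.Re z] = 0%E) ?mul0e//; exact: lebesgue_measure_set1.
- by move=> [a b] /= /negP/negPn/eqP <-.
Qed.

Lemma ae_neq_circle (s : R) : {ae mu2, forall p, cabs (toC p) != s}.
Proof.
pose g (x : R) : R := (x == s)%:R.
have mg : measurable_fun setT g.
  rewrite (_ : g = \1_[set s]); first exact: measurable_indic.
  by apply/funext => x; rewrite /g indicE; congr (_ %:R); congr nat_of_bool;
    apply/idP/idP; rewrite inE => /eqP.
have mS : measurable [set p : RR | cabs (toC p) = s].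
  rewrite -[X in measurable X]setTI.
  exact: (measurable_cabs (@cmeasurable_toC R)) (measurable_set1 s).
exists [set p | cabs (toC p) = s]; split => //; last first.
  by move=> p /= /negP/negPn/eqP.
have := integral_radial_half mg (fun x => ler0n _ _).
have -> : (\int[leb]_(x in `]0%R, +oo[) (x * g x)%:E = 0)%E.
  rewrite (ge0_negligible_integral (mu := leb) (N := [set s] : set (measurableTypeR R)))//.
  - rewrite integral0_eq// => x [] _ /eqP/negbTE xs.
    by rewrite /g xs mulr0.
  - apply: measurable_funTS; apply/measurable_EFinP.
    exact: measurable_funM.
  - by move=> x /=; rewrite in_itv/= andbT => /ltW x0; rewrite lee_fin mulr_ge0.
  - exact: lebesgue_measure_set1.
rewrite mule0 => <-; have := integral_indic mu2 measurableT mS.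
rewrite setIT => <-.
apply: eq_integral => p _; rewrite indicE /g; congr (nat_of_bool _)%:R%:E.
by apply/idP/idP; rewrite inE => /eqP.
Qed.

End PlaneMass.

(** * Exchange of complex integrals *)

Section ComplexFubini.
Context d1 d2 (T1 : measurableType d1) (T2 : measurableType d2) (R : realType).
Variable m1 : {sigma_finite_measure set T1 -> \bar R}.
Variable m2 : {sigma_finite_measure set T2 -> \bar R}.

(** Tonelli with a bound [K * A x] on the inner integrals: an iterated estimate of two
singularities, each integrable for fixed position of the other. *)
Lemma mass_le_prod (G : T1 * T2 -> R) (A : T1 -> R) (K L : R) : 0 <= K ->
  measurable_fun setT G -> (forall p, 0 <= G p) ->
  (forall x, mass_le m2 (fun y => G (x, y)) (K * A x)) ->
  mass_le m1 A L -> mass_le (m1 \x m2)%E G (K * L).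
Proof.
move=> K0 mG G0 GA AL; split => //.
have mGE : measurable_fun setT (fun p => (G p)%:E) by exact/measurable_EFinP.
have GE0 p : (0 <= (G p)%:E)%E by rewrite lee_fin.
rewrite fubini_tonelli1//.
have [mKA KA0 KAL] := mass_leZ K0 AL.
apply: le_trans KAL; apply: ge0_le_integral => //.
- by move=> x _; apply: integral_ge0.
- exact: measurable_fun_fubini_tonelli_F.
- exact/measurable_EFinP.
- by move=> x _; have [] := GA x.
Qed.

Lemma Rintegral_fubini1 (f : T1 * T2 -> R) :
  (m1 \x m2)%E.-integrable setT (fun p => (f p)%:E) ->
  Rintegral m1 setT (fun x => Rintegral m2 setT (fun y => f (x, y))) =
  Rintegral (m1 \x m2)%E setT f.
Proof.
move=> fi; rewrite /Rintegral; congr fine.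
rewrite -(integral12_prod_meas1 fi).
have Fi := integrable_fubini_F fi.
have mF := measurable_int _ Fi.
apply: ae_eq_integral => //.
  by apply/measurable_EFinP; exact: (measurableT_comp (fine_measurable _)).
have /= := integrable_ae measurableT Fi.
by apply: filterS => x /(_ I) Fx _; rewrite -[RHS]fineK.
Qed.

Lemma Rintegral_fubini2 (f : T1 * T2 -> R) :
  (m1 \x m2)%E.-integrable setT (fun p => (f p)%:E) ->
  Rintegral m2 setT (fun y => Rintegral m1 setT (fun x => f (x, y))) =
  Rintegral (m1 \x m2)%E setT f.
Proof.
move=> fi; rewrite /Rintegral; congr fine.
rewrite -(integral21_prod_meas1 fi).
have mf := measurable_int _ fi.
have mF : measurable_fun setT (fubini_G m1 (fun p => (f p)%:E)).
  exact: (measurable_fubini_G fi).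
have Fi : m2.-integrable setT (fubini_G m1 (fun p => (f p)%:E)).
  apply/integrableP; split => //.
  apply: le_lt_trans _ ((integrable21ltyP m1 m2 mf).1 fi).
  have ma : measurable_fun setT (fun p => `|(f p)%:E|%E) by exact: measurableT_comp.
  apply: ge0_le_integral => //.
  - exact: measurableT_comp.
  - by apply: (measurable_fun_fubini_tonelli_G (fun p => `|(f p)%:E|%E)).
  - move=> y _; apply: le_abse_integral => //.
    exact: (measurableT_comp mf).
apply: ae_eq_integral => //.
  by apply/measurable_EFinP; exact: (measurableT_comp (fine_measurable _)).
have /= := integrable_ae measurableT Fi.
by apply: filterS => x /(_ I) Fx _; rewrite -[RHS]fineK.
Qed.

Lemma cintegral_fubini (F : T1 * T2 -> R[i]) :
  cintegrable (m1 \x m2)%E F ->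
  cintegral m1 (fun x => cintegral m2 (fun y => F (x, y))) =
  cintegral m2 (fun y => cintegral m1 (fun x => F (x, y))).
Proof.
move=> [F1 F2]; congr (_ +i* _).
- exact: (etrans (Rintegral_fubini1 F1) (esym (Rintegral_fubini2 F1))).
- exact: (etrans (Rintegral_fubini1 F2) (esym (Rintegral_fubini2 F2))).
Qed.

End ComplexFubini.

(** * Integrals over the complex plane *)

Section PlanarIntegral.
Variable R : realType.
Local Notation C := R[i].
Local Notation leb := (@lebesgue_measure R).
Local Notation RR := (measurableTypeR R * measurableTypeR R)%type.
Local Notation mu2 := (@plane_measure R).
Local Notation toC := (@toC R).
Implicit Types (F G : C -> C) (z w : C).

Definition pmeasurable F := cmeasurable (fun p : RR => F (toC p)).
Definition pintegrable F := cintegrable mu2 (fun p : RR => F (toC p)).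
Definition pint F : C := cintegral mu2 (fun p : RR => F (toC p)).

Lemma pint_translate F z : pmeasurable F -> pintegrable (fun w => F (w + z)) ->
  pint (fun w => F (w + z)) = pint F.
Proof.
move=> mF iF; pose phi (p : RR) : RR := (p.1 + complex.Re z, p.2 + complex.Im z).
have toCphi p : toC p + z = toC (phi p) by rewrite /phi; case: (z).
have [mphi phimu] := mpreserving_translate (complex.Re z) (complex.Im z).
have E : (fun p => F (toC p + z)) = (fun p => F (toC (phi p))).
  by apply/funext => p; rewrite toCphi.
have iF' : cintegrable mu2 (fun p => F (toC (phi p))) by rewrite -E.
rewrite /pint E.
exact: (cintegral_change (F := fun p => F (toC p)) mphi phimu iF' mF).
Qed.

Lemma pint_rotate F w : cabs w = 1 -> pmeasurable F ->
  pintegrable (fun z => F (w * z)) -> pint (fun z => F (w * z)) = pint F.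
Proof.
move=> w1 mF iF.
have ab : complex.Re w ^+ 2 + complex.Im w ^+ 2 = 1.
  by rewrite -cabs_sqr w1 expr1n.
have [mphi phimu] := mpreserving_rotate ab.
move: mphi phimu; set phi := (fun _ => _) => mphi phimu.
have toCphi p : w * toC p = toC (phi p).
  by apply/eqP; rewrite eq_complex cReM cImM /=; apply/andP; split; apply/eqP; ring.
have E : (fun p => F (w * toC p)) = (fun p => F (toC (phi p))).
  by apply/funext => p; rewrite toCphi.
have iF' : cintegrable mu2 (fun p => F (toC (phi p))) by rewrite -E.
rewrite /pint E.
exact: (cintegral_change (F := fun p => F (toC p)) mphi phimu iF' mF).
Qed.

(** The integral is equal to itself times [c]. *)
Lemma pint_rotation_eq0 F w (c : C) : cabs w = 1 -> c != 1 -> pintegrable F ->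
  (forall z, F (w * z) = c * F z) -> pint F = 0.
Proof.
move=> w1 c1 iF Fw.
have E : (fun z => F (w * z)) = (fun z => c * F z) by apply/funext.
have := pint_rotate w1 (cintegrable_measurable iF); rewrite E.
have -> : pint (fun z => c * F z) = c * pint F by exact: cintegralZ.
move=> /(_ (cintegrableZ c iF)) /eqP; rewrite -subr_eq0 -{2}[pint F]mul1r -mulrBl.
by rewrite mulf_eq0 subr_eq0 (negbTE c1)/= => /eqP.
Qed.

Lemma unimodular_root (n : nat) : (0 < n)%N ->
  exists2 w : C, cabs w = 1 & w ^+ n = -1.
Proof.
move=> n0; pose w := n.-root (-1 : C); have wn : w ^+ n = -1 by rewrite rootCK.
exists w => //; apply/eqP; rewrite -(@pexpr_eq1 _ _ n) ?cabs_ge0 -?lt0n//.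
by rewrite -cabsX wn cabsN cabs1.
Qed.

Lemma unimodular_conj w : cabs w = 1 -> w * w^*%C = 1.
Proof. by move=> w1; rewrite mul_conjc w1 expr1n. Qed.

Lemma pint_radial_open_disk (s : R) (m : nat) : 0 < s ->
  pint (fun z => if cabs z < s then ((cabs z) ^+ m.*2)%:C else 0) =
  (pi * s ^+ m.+1.*2 / m.+1%:R)%:C.
Proof.
move=> s0; rewrite /pint /cintegral.
pose g (x : R) := if x < s then x ^+ m.*2 else 0.
have mg : measurable_fun setT g.
  by apply: measurable_if_lt; exact: exprn_measurable.
have g0 x : 0 <= g x.
  by rewrite /g; case: ifP => // _; rewrite -mul2n mulnC exprM sqr_ge0.
rewrite (_ : (fun p => complex.Re _) = (fun p => g (cabs (toC p)))); last first.
  by apply/funext => p; rewrite /g; case: ifP.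
rewrite (_ : (fun p => complex.Im _) = (fun p => 0)); last first.
  by apply/funext => p; case: ifP.
rewrite [X in _ +i* X]Rintegral_cst// mul0r; congr (_ +i* _).
rewrite /Rintegral integral_radial_half//.
have -> : (\int[leb]_(x in `]0%R, +oo[) (x * g x)%:E =
    \int[leb]_(x in `]0%R, s[) (x ^+ m.*2.+1)%:E)%E.
  rewrite [LHS]integral_mkcond [RHS]integral_mkcond; apply: eq_integral => x _.
  rewrite !patchE /g; have [xs|xs] := ltP x s.
    have -> : (x \in `]0%R, +oo[%classic) = (x \in `]0%R, s[%classic).
      by apply/idP/idP; rewrite !inE/= !in_itv/= ?andbT ?xs ?andbT.
    by case: ifP => // _; rewrite exprS.
  rewrite mulr0 [LHS]if_same.
  by rewrite ifF//; apply/negP; rewrite inE/= in_itv/= [x < s]ltNge xs andbF.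
have mx (A : set R) : measurable_fun A (fun x : R => (x ^+ m.*2.+1)%:E).
  by apply/measurable_EFinP; exact: exprn_measurable.
rewrite integral_itv_obnd_cbnd// integral_itv_bndo_bndc//.
rewrite integral_exprn_segment// -EFinM /= doubleS.
have -> : (m.*2.+2)%:R = 2 * m.+1%:R :> R by rewrite -natrM mul2n doubleS.
have : m.+1%:R != 0 :> R by rewrite pnatr_eq0.
by move: (m.+1%:R) => x x0; field.
Qed.

End PlanarIntegral.

(** * Weakly singular integrands *)

Section WeakSingularity.
Variable R : realType.
Local Notation C := R[i].
Local Notation RR := (measurableTypeR R * measurableTypeR R)%type.
Local Notation mu2 := (@plane_measure R).
Local Notation toC := (@toC R).
Implicit Types (F G : C -> C) (z w : C).

Lemma pmeasurable_id : pmeasurable (fun z : C => z).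
Proof. exact: cmeasurable_toC. Qed.

Lemma pmeasurable_cst (c : C) : pmeasurable (fun=> c).
Proof. exact: cmeasurable_cst. Qed.

Lemma pmeasurableB F G : pmeasurable F -> pmeasurable G ->
  pmeasurable (fun z => F z - G z).
Proof. exact: cmeasurableB. Qed.

Lemma pmeasurableM F G : pmeasurable F -> pmeasurable G ->
  pmeasurable (fun z => F z * G z).
Proof. exact: cmeasurableM. Qed.

Lemma pmeasurableX F n : pmeasurable F -> pmeasurable (fun z => F z ^+ n).
Proof. exact: cmeasurableX. Qed.

Lemma pmeasurableV F : pmeasurable F -> pmeasurable (fun z => (F z)^-1).
Proof. exact: cmeasurableV. Qed.

Lemma pmeasurable_conj F : pmeasurable F -> pmeasurable (fun z => (F z)^*%C).
Proof. exact: cmeasurable_conj. Qed.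

Lemma pmeasurable_if_lt (s : R) (z : C) F G : pmeasurable F -> pmeasurable G ->
  pmeasurable (fun w => if cabs (w - z) < s then F w else G w).
Proof.
move=> [F1 F2] [G1 G2].
have mb : measurable_fun setT (fun p : RR => cabs (toC p - z) < s).
  by apply: measurable_fun_ltr => //; apply: measurable_cabs; exact: cmeasurable_toCB.
by split; [have := measurable_fun_ifT mb F1 G1|have := measurable_fun_ifT mb F2 G2];
  congr measurable_fun; apply/funext => p; case: ifP.
Qed.

Lemma pmeasurable_if_le (s : R) (z : C) F G : pmeasurable F -> pmeasurable G ->
  pmeasurable (fun w => if cabs (w - z) <= s then F w else G w).
Proof.
move=> [F1 F2] [G1 G2].
have mb : measurable_fun setT (fun p : RR => cabs (toC p - z) <= s).
  by apply: measurable_fun_ler => //; apply: measurable_cabs; exact: cmeasurable_toCB.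
by split; [have := measurable_fun_ifT mb F1 G1|have := measurable_fun_ifT mb F2 G2];
  congr measurable_fun; apply/funext => p; case: ifP.
Qed.

Definition disk_ind (r : R) (z : C) : C := if cabs z <= r then 1 else 0.

Lemma disk_ind1 r z : cabs z <= r -> disk_ind r z = 1.
Proof. by rewrite /disk_ind => ->. Qed.

Lemma disk_ind0 r z : r < cabs z -> disk_ind r z = 0.
Proof. by rewrite /disk_ind leNgt => ->. Qed.

Lemma pmeasurable_disk_ind r : pmeasurable (disk_ind r).
Proof.
have := pmeasurable_if_le r 0 (pmeasurable_cst 1) (pmeasurable_cst 0).
by congr pmeasurable; apply/funext => z; rewrite subr0.
Qed.

(** The mass of the singularity [|u| ^ (b - 2)] over a ball that contains the disk from any
of its points; the factor [4] is [2] for the complex integral and [2] for two poles. *)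
Definition sing_mass (r b : R) : R := 4 * (2 * pi * ((3 * r) `^ b / b)).

Lemma sing_mass_ge0 r b : 0 < b -> 0 <= sing_mass r b.
Proof.
by move=> b0; rewrite !mulr_ge0 ?pi_ge0 ?powR_ge0 ?invr_ge0 ?(ltW b0).
Qed.

(** A difference of kernels is singular at two points: estimates with a sum of two powers
are what the interpolation below produces. *)
Lemma weak_singular_pair F z w (r b c : R) : 0 < r -> 0 < b -> 0 <= c ->
  pmeasurable F -> cabs z <= r -> cabs w <= r ->
  (forall v, r < cabs v -> F v = 0) ->
  (forall v, v != z -> v != w -> cabs v <= r ->
    cabs (F v) <= c * (cabs (v - z) `^ (b - 2) + cabs (v - w) `^ (b - 2))) ->
  pintegrable F /\ cabs (pint F) <= c * sing_mass r b.
Proof.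
move=> r0 b0 c0 mF zr wr F0 FG; have r30 : 0 < 3 * r by rewrite mulr_gt0.
pose G (p : RR) := c * ((let u := cabs (toC p - z) in
    if u < 3 * r then u `^ (b - 2) else 0) + (let u := cabs (toC p - w) in
    if u < 3 * r then u `^ (b - 2) else 0)).
have mG : mass_le mu2 G (c * (2 * pi * ((3 * r) `^ b / b) + 2 * pi * ((3 * r) `^ b / b))).
  by apply: mass_leZ => //; apply: mass_leD; exact: mass_near.
have FG' : {ae mu2, forall p, cabs (F (toC p)) <= G p}.
  apply: filterS2 (ae_neq_point z) (ae_neq_point w) => p pz pw.
  have [pr|pr] := leP (cabs (toC p)) r; last first.
    rewrite F0// cabs0 mulr_ge0// addr_ge0//=; case: ifP => // _; exact: powR_ge0.
  have near (v : C) : cabs v <= r -> cabs (toC p - v) < 3 * r.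
    by move=> vr; apply: le_lt_trans (cabsB _ _) _; lra.
  by rewrite /G /= !near//; exact: FG.
split; first exact: cintegrable_dominated mF FG' mG.
apply: le_trans (cabs_cintegral_le mF FG' mG) _.
by rewrite /sing_mass le_eqVlt; apply/orP; left; apply/eqP; ring.
Qed.

Lemma weak_singular F z (r b c : R) : 0 < r -> 0 < b -> 0 <= c ->
  pmeasurable F -> cabs z <= r -> (forall v, r < cabs v -> F v = 0) ->
  (forall v, v != z -> cabs v <= r -> cabs (F v) <= c * cabs (v - z) `^ (b - 2)) ->
  pintegrable F /\ cabs (pint F) <= c * sing_mass r b.
Proof.
move=> r0 b0 c0 mF zr F0 FG; apply: (weak_singular_pair (z := z) (w := z)) => //.
move=> v vz _ vr; apply: le_trans (FG v vz vr) _.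
by rewrite ler_wpM2l// lerDl powR_ge0.
Qed.

Lemma pintegrable_bounded F (r M : R) : 0 < r -> pmeasurable F ->
  (forall v, r < cabs v -> F v = 0) -> (forall v, cabs (F v) <= M) ->
  pintegrable F.
Proof.
move=> r0 mF F0 FM; have M0 : 0 <= M by exact: le_trans (cabs_ge0 _) (FM 0).
apply: (weak_singular (z := 0) (b := 2) (c := M) r0 _ M0 mF _ F0 _).1 => //.
  by rewrite cabs0 ltW.
by move=> v _ _; rewrite subrr powRr0 mulr1.
Qed.

(** By dominated convergence the integrals of [q ^ n * F] tend to zero. *)
Lemma pint_decay_eq0 F (q : C -> C) V (n0 : nat) : pintegrable F ->
  pmeasurable q -> (forall z, cabs (q z) <= 1) ->
  {ae mu2, forall p, cabs (q (toC p)) < 1} ->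
  (forall n, (n0 <= n)%N -> pint (fun z => q z ^+ n * F z) = V) -> V = 0.
Proof.
move=> iF mq q1 q1ae VE.
have mF := cintegrable_measurable iF.
have iN : mu2.-integrable setT (fun p : RR => (cabs (F (toC p)))%:E).
  have [[/integrable_norm i1] /integrable_norm i2] := iF.
  apply: le_integrable (integrableD _ i1 i2) => //.
    by apply/measurable_EFinP; exact: measurable_cabs.
  move=> p _ /=; rewrite lee_fin ger0_norm ?cabs_ge0//.
  by rewrite (le_trans (cabs_le_ReIm _))// ler_norm.
pose f n (p : RR) : \bar R := (cabs (q (toC p)) ^+ n * cabs (F (toC p)))%:E.
have mf n : measurable_fun setT (f n).
  apply/measurable_EFinP; apply: measurable_funM; last exact: measurable_cabs.
  by apply: measurable_funX; exact: measurable_cabs.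
have f0 n p : (0 <= f n p)%E by rewrite lee_fin mulr_ge0 ?exprn_ge0 ?cabs_ge0.
have fcvg : {ae mu2, forall p, setT p -> f n p @[n --> \oo] --> 0%E}.
  apply: filterS q1ae => p qp _; rewrite /f.
  apply: cvg_EFin; first exact: nearW.
  rewrite -[X in _ --> X](mul0r (cabs (F (toC p)))).
  apply: cvgMl; apply: cvg_expr; by rewrite ger0_norm ?cabs_ge0.
have fdom : {ae mu2, forall p, forall n, setT p ->
    (`|f n p| <= (cabs (F (toC p)))%:E)%E}.
  apply: aeW => p n _; rewrite gee0_abs// lee_fin ler_piMl ?cabs_ge0//.
  by rewrite exprn_ile1 ?cabs_ge0.
have [_ _] := dominated_convergence measurableT mf (measurable_cst _) fcvg iN fdom.
rewrite integral0 => cv.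
apply/eqP; rewrite -cabs_eq0; apply/eqP/le_anti; rewrite cabs_ge0 andbT.
suff : ((cabs V / 2)%:E <= 0)%E by rewrite lee_fin pmulr_lle0 ?invr_gt0.
rewrite -(cvg_lim _ cv)//; apply: lime_ge; first exact: cvgP cv.
exists n0 => // n /= n0n; rewrite -(VE n n0n).
have fK : (\int[mu2]_p f n p \is a fin_num)%E.
  rewrite ge0_fin_numE ?integral_ge0//.
  apply: le_lt_trans (integrable_lty _ iN) => //; apply: ge0_le_integral => //.
    by apply/measurable_EFinP; exact: measurable_cabs.
  by move=> p _; rewrite lee_fin ler_piMl ?cabs_ge0// exprn_ile1 ?cabs_ge0.
rewrite -[leRHS]fineK// lee_fin ler_pdivrMr// mulrC.
apply: (cabs_cintegral_le (G := fun p => cabs (q (toC p)) ^+ n * cabs (F (toC p)))).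
- by apply: cmeasurableM => //; exact: cmeasurableX.
- by apply: aeW => p; rewrite cabsM cabsX.
- split; first by apply/measurable_EFinP; exact: mf.
    by move=> p; rewrite mulr_ge0 ?exprn_ge0 ?cabs_ge0.
  by rewrite fineK.
Qed.

End WeakSingularity.

(** * Cauchy integrals of antiholomorphic polynomials *)

Section CauchyMonomials.
Variable R : realType.
Local Notation C := R[i].
Implicit Types (F G : C -> C) (z w : C).

Lemma pintD F G : pintegrable F -> pintegrable G ->
  pint (fun z => F z + G z) = pint F + pint G.
Proof. exact: cintegralD. Qed.

Lemma pintB F G : pintegrable F -> pintegrable G ->
  pint (fun z => F z - G z) = pint F - pint G.
Proof. exact: cintegralB. Qed.

Lemma pintZ (c : C) F : pintegrable F -> pint (fun z => c * F z) = c * pint F.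
Proof. exact: cintegralZ. Qed.

Lemma pintegrableD F G : pintegrable F -> pintegrable G ->
  pintegrable (fun z => F z + G z).
Proof. exact: cintegrableD. Qed.

Lemma pintegrableB F G : pintegrable F -> pintegrable G ->
  pintegrable (fun z => F z - G z).
Proof. exact: cintegrableB. Qed.

Lemma pintegrableZ (c : C) F : pintegrable F -> pintegrable (fun z => c * F z).
Proof. exact: cintegrableZ. Qed.

Lemma eq_pint F G : F =1 G -> pint F = pint G.
Proof. by move=> /funext ->. Qed.

Lemma eq_pint_off (w : C) F G : pmeasurable F -> pmeasurable G ->
  (forall v, v != w -> F v = G v) -> pint F = pint G.
Proof.
move=> mF mG FG; apply: cintegral_ae_eq => //.
by apply: filterS (ae_neq_point w) => p pw; exact: FG.
Qed.

(** A rotation by a [k]-th root of [-1] changes the sign of the integral. *)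
Lemma pint_weight_eq0 F (k : nat) : (0 < k)%N -> pintegrable F ->
  (forall w, cabs w = 1 -> forall z, F (w * z) = w ^+ k * F z) -> pint F = 0.
Proof.
move=> k0 iF Fw; have [w w1 wk] := unimodular_root R k0.
apply: (pint_rotation_eq0 w1 (c := -1)) => //; last by move=> z; rewrite Fw// wk.
by rewrite eqr_oppLR -subr_eq0 opprK -mulr2n pnatr_eq0.
Qed.

Lemma pint_coweight_eq0 F (k : nat) : (0 < k)%N -> pintegrable F ->
  (forall w, cabs w = 1 -> forall z, F (w * z) = (w^*%C) ^+ k * F z) ->
  pint F = 0.
Proof.
move=> k0 iF Fw; have [w w1 wk] := unimodular_root R k0.
apply: (pint_rotation_eq0 w1 (c := -1)) => //; last first.
  by move=> z; rewrite Fw// -rmorphXn /= wk rmorphN1.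
by rewrite eqr_oppLR -subr_eq0 opprK -mulr2n pnatr_eq0.
Qed.

Definition open_disk_ind (s : R) z : C := if cabs z < s then 1 else 0.
Definition annulus_ind (s r : R) z : C := if cabs z < s then 0 else disk_ind r z.

Lemma pmeasurable_open_disk_ind s : pmeasurable (open_disk_ind s).
Proof.
have := pmeasurable_if_lt s 0 (pmeasurable_cst (1 : C)) (pmeasurable_cst 0).
by congr pmeasurable; apply/funext => z; rewrite subr0.
Qed.

Lemma pmeasurable_annulus_ind s r : pmeasurable (annulus_ind s r).
Proof.
have := pmeasurable_if_lt s 0 (pmeasurable_cst (0 : C)) (pmeasurable_disk_ind r).
by congr pmeasurable; apply/funext => z; rewrite subr0.
Qed.

Lemma pmeasurable_conjX m : pmeasurable (fun z : C => z^*%C ^+ m).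
Proof. by apply: pmeasurableX; apply: pmeasurable_conj; exact: pmeasurable_id. Qed.

Lemma pmeasurable_subc w : pmeasurable (fun z : C => z - w).
Proof. exact: cmeasurable_toCB. Qed.

Hint Resolve pmeasurable_id pmeasurable_cst pmeasurable_conjX pmeasurable_subc
  pmeasurable_open_disk_ind pmeasurable_annulus_ind pmeasurable_disk_ind : core.

Lemma expr_cabs_le z (r : R) m : cabs z <= r -> cabs z ^+ m <= r ^+ m.
Proof. by move=> zr; rewrite lerXn2r ?nnegrE ?cabs_ge0// (le_trans (cabs_ge0 z)). Qed.

Lemma pint_open_disk_moment (s : R) m n : 0 < s ->
  pintegrable (fun z => open_disk_ind s z * (z^*%C ^+ m * z ^+ n)) /\
  pint (fun z => open_disk_ind s z * (z^*%C ^+ m * z ^+ n)) =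
  if n == m then (pi * s ^+ m.+1.*2 / m.+1%:R)%:C else 0.
Proof.
move=> s0; set F := (fun _ => _).
have iF : pintegrable F.
  apply: (@pintegrable_bounded _ _ s (s ^+ m * s ^+ n)) => //.
  - by apply: pmeasurableM => //; apply: pmeasurableM => //; exact: pmeasurableX.
  - by move=> v sv; rewrite /F /open_disk_ind ltNge ltW//= mul0r.
  - move=> v; rewrite /F /open_disk_ind; case: ifP => [vs|_].
      rewrite mul1r cabsM !cabsX cabs_conj ler_pM ?exprn_ge0 ?cabs_ge0//;
      by apply: expr_cabs_le; exact: ltW.
    by rewrite mul0r cabs0 mulr_ge0// exprn_ge0// ltW.
split => //; case: eqP => [nm|/eqP nm].
  rewrite -pint_radial_open_disk//; apply: eq_pint => z.
  rewrite /F /open_disk_ind nm; case: ifP => _; last by rewrite mul0r.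
  by rewrite mul1r -exprMn mulrC mul_conjc -rmorphXn/= -exprM mul2n.
have inv w z : cabs w = 1 -> open_disk_ind s (w * z) = open_disk_ind s z.
  by move=> w1; rewrite /open_disk_ind cabsM w1 mul1r.
move: nm; rewrite neq_ltn => /orP[] nm.
  apply: (pint_coweight_eq0 (k := (m - n)%N)) => //; first by rewrite subn_gt0.
  move=> w w1 z; rewrite /F inv// rmorphM /= !exprMn -{1}(subnK (ltnW nm)).
  rewrite exprD.
  have -> : (w^*%C) ^+ (m - n) * (open_disk_ind s z * (z^*%C ^+ m * z ^+ n)) =
    (w^*%C) ^+ (m - n) * (w * w^*%C) ^+ n * (open_disk_ind s z * (z^*%C ^+ m * z ^+ n)).
    by rewrite unimodular_conj// expr1n mulr1.
  by rewrite exprMn; ring.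
apply: (pint_weight_eq0 (k := (n - m)%N)) => //; first by rewrite subn_gt0.
move=> w w1 z; rewrite /F inv// rmorphM /= !exprMn -{1}(subnK (ltnW nm)) exprD.
have -> : w ^+ (n - m) * (open_disk_ind s z * (z^*%C ^+ m * z ^+ n)) =
  w ^+ (n - m) * (w * w^*%C) ^+ m * (open_disk_ind s z * (z^*%C ^+ m * z ^+ n)).
  by rewrite unimodular_conj// expr1n mulr1.
by rewrite exprMn; ring.
Qed.

Lemma pint_annulus_moment_eq0 (s r : R) m n :
  pintegrable (fun z => annulus_ind s r z * (z^*%C ^+ m / z ^+ n.+1)) ->
  pint (fun z => annulus_ind s r z * (z^*%C ^+ m / z ^+ n.+1)) = 0.
Proof.
move=> iF; apply: (pint_coweight_eq0 (k := (m + n.+1)%N)) => //.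
  by rewrite addnS.
move=> w w1 z; rewrite /annulus_ind /disk_ind cabsM w1 mul1r rmorphM /= !exprMn.
have wi : w^*%C = w^-1.
  have w0 : w != 0 by rewrite -cabs_gt0 w1.
  by apply: (mulfI w0); rewrite unimodular_conj// divff.
by rewrite wi exprD !exprVn invfM; move: (w ^+ n.+1)^-1 (z ^+ n.+1)^-1 => x y; ring.
Qed.

(** Expanding the Cauchy kernel in powers of [zeta / z] inside the circle through
[z] and of [z / zeta] outside, every term but one has non trivial weight under
rotations.  The telescoping recurrence is that of the remainders, which tend to
zero. *)
Lemma pint_cauchy_monomial (r : R) m z : 0 < r -> cabs z <= r ->
  pint (fun w => disk_ind r w * (w^*%C ^+ m / (w - z))) =
  - ((pi : R)%:C * z^*%C ^+ m.+1 / m.+1%:R).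
Proof.
move=> r0 zr; pose F w := disk_ind r w * (w^*%C ^+ m / (w - z)).
have bound (G : C -> C) : pmeasurable G -> (forall v, cabs (G v) <= 1) ->
    pintegrable (fun w => G w * F w).
  move=> mG G1.
  apply: (weak_singular (z := z) (b := 1) (c := r ^+ m) r0 _ _ _ zr _ _).1 => //.
  - by rewrite exprn_ge0// ltW.
  - apply: pmeasurableM => //; apply: pmeasurableM => //.
    by apply: pmeasurableM => //; exact: pmeasurableV.
  - by move=> v rv; rewrite /F /disk_ind leNgt rv/= mul0r mulr0.
  - move=> v vz vr; rewrite /F /disk_ind vr mul1r !cabsM cabsX cabs_conj cabsV.
    rewrite (_ : 1 - 2 = -1 :> R); last by ring.
    rewrite powR_inv1 ?cabs_ge0// -[leRHS]mul1r ler_pM ?cabs_ge0//.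
      by rewrite mulr_ge0 ?exprn_ge0 ?invr_ge0 ?cabs_ge0.
    by rewrite ler_wpM2r ?invr_ge0 ?cabs_ge0// expr_cabs_le.
have [z0|z0] := eqVneq z 0.
  rewrite z0 [RHS](_ : _ = 0); last by rewrite conjc0 expr0n/= mulr0 mul0r oppr0.
  have E : (fun w => disk_ind r w * (w^*%C ^+ m / (w - 0))) =
     (fun w => annulus_ind 0 r w * (w^*%C ^+ m / w ^+ 1)).
    by apply/funext => w; rewrite /annulus_ind ltNge cabs_ge0/= subr0.
  rewrite E; apply: pint_annulus_moment_eq0; rewrite -E -z0.
  have := bound (fun=> 1) (pmeasurable_cst _) _.
  by under eq_fun do rewrite mul1r; apply => v; rewrite cabs1.
pose s := cabs z; have s0 : 0 < s by rewrite cabs_gt0.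
pose V := (pi * s ^+ m.+1.*2 / m.+1%:R : R)%:C.
(* The remainders after [n] terms of the expansions inside and outside the circle
   through [z]. *)
pose a n := pint (fun w => (w / z) ^+ n * (open_disk_ind s w * F w)).
pose b n := pint (fun w => (z / w) ^+ n * (annulus_ind s r w * F w)).
(* The ratios, cut off where their powers do not matter so as to be bounded by [1]. *)
pose qa w := open_disk_ind s w * (w / z).
pose qb w := if cabs w < s then 0 else z / w.
have mqa : pmeasurable qa by apply: pmeasurableM => //; apply: pmeasurableM.
have mqb : pmeasurable qb.
  have := pmeasurable_if_lt s 0 (pmeasurable_cst (0 : C)) (pmeasurableM (pmeasurable_cst z)
     (pmeasurableV (pmeasurable_id R))).
  by congr pmeasurable; apply/funext => w; rewrite subr0.
have qa1 w : cabs w != s -> cabs (qa w) < 1.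
  move=> ws; rewrite /qa /open_disk_ind; case: ifP => [wls|_].
    by rewrite mul1r cabsM cabsV ltr_pdivrMr// mul1r.
  by rewrite mul0r cabs0.
have qb1 w : cabs w != s -> cabs (qb w) < 1.
  move=> ws; rewrite /qb; case: (ltP (cabs w) s) => [_|sw]; first by rewrite cabs0.
  have sw' : s < cabs w by rewrite lt_neqAle eq_sym ws.
  by rewrite cabsM cabsV ltr_pdivrMr ?mul1r// (lt_trans s0).
have qa_le w : cabs (qa w) <= 1.
  have [ws|/qa1/ltW//] := eqVneq (cabs w) s.
  by rewrite /qa /open_disk_ind ws ltxx mul0r cabs0.
have qb_le w : cabs (qb w) <= 1.
  have [ws|/qb1/ltW//] := eqVneq (cabs w) s.
  by rewrite /qb ws ltxx cabsM cabsV ws divff ?gt_eqF.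
have mind (G : C -> C) n (q : C -> C) : pmeasurable q -> (forall v, cabs (q v) <= 1) ->
    pmeasurable G -> (forall v, cabs (G v) <= 1) ->
    pintegrable (fun w => q w ^+ n * (G w * F w)).
  move=> mq q1 mG G1.
  have -> : (fun w => q w ^+ n * (G w * F w)) = (fun w => (q w ^+ n * G w) * F w).
    by apply/funext => w; rewrite mulrA.
  apply: bound; first by apply: pmeasurableM => //; exact: pmeasurableX.
  move=> v; rewrite cabsM cabsX -[leRHS]mul1r ler_pM ?exprn_ge0 ?cabs_ge0//.
  by rewrite exprn_ile1 ?cabs_ge0.
have ind1 w : cabs (open_disk_ind s w) <= 1.
  by rewrite /open_disk_ind; case: ifP; rewrite ?cabs0 ?cabs1.
have ind2 w : cabs (annulus_ind s r w) <= 1.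
  rewrite /annulus_ind /disk_ind; case: ifP; rewrite ?cabs0//.
  by case: ifP; rewrite ?cabs0 ?cabs1.
have ia n := mind _ n _ mqa qa_le (pmeasurable_open_disk_ind s) ind1.
have ib n := mind _ n _ mqb qb_le (pmeasurable_annulus_ind s r) ind2.
have qaE n w : qa w ^+ n * (open_disk_ind s w * F w) =
    (w / z) ^+ n * (open_disk_ind s w * F w).
  by rewrite /qa /open_disk_ind; case: ifP => _; rewrite ?mul1r ?mul0r ?mulr0.
have qbE n w : qb w ^+ n * (annulus_ind s r w * F w) =
    (z / w) ^+ n * (annulus_ind s r w * F w).
  by rewrite /qb /annulus_ind; case: ifP => _; rewrite ?mul1r ?mul0r ?mulr0.
have aE n : a n = pint (fun w => qa w ^+ n * (open_disk_ind s w * F w)).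
  by apply: eq_pint => w; rewrite qaE.
have bE n : b n = pint (fun w => qb w ^+ n * (annulus_ind s r w * F w)).
  by apply: eq_pint => w; rewrite qbE.
have a_step n : a n - a n.+1 = - (z^-1 ^+ n.+1) * (if n == m then V else 0).
  have [im <-] := pint_open_disk_moment m n s0.
  rewrite -pintZ// !aE -pintB//; apply: eq_pint => w; rewrite !qaE.
  rewrite /F /open_disk_ind /disk_ind; case: ifP => [ws|_]; last by rewrite !(mul0r, mulr0) subrr.
  rewrite (le_trans (ltW ws) zr) !mul1r.
  have wz : w - z != 0.
    by rewrite subr_eq0; apply: contraTneq ws => ->; rewrite -leNgt.
  by rewrite !exprMn !exprS; move: (w ^+ n) (z^-1 ^+ n) (w^*%C ^+ m) => x y t; field; rewrite z0.
have b_step n : b n - b n.+1 = 0.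
  have iG : pintegrable (fun w => annulus_ind s r w * (w^*%C ^+ m / w ^+ n.+1)).
    apply: (@pintegrable_bounded _ _ r (r ^+ m / s ^+ n.+1)) => //.
    - apply: pmeasurableM => //; apply: pmeasurableM => //.
      by apply: pmeasurableV; exact: pmeasurableX.
    - move=> v rv; rewrite /annulus_ind /disk_ind [cabs v <= r]leNgt rv/=.
      by rewrite if_same mul0r.
    - move=> v; rewrite /annulus_ind /disk_ind; case: (ltP (cabs v) s) => sv; last case: ifP => vr.
      + by rewrite mul0r cabs0 divr_ge0// exprn_ge0// ltW.
      + rewrite mul1r cabsM cabsV !cabsX cabs_conj ler_pM ?invr_ge0 ?exprn_ge0 ?cabs_ge0//.
          exact: expr_cabs_le.
        rewrite lef_pV2 ?posrE ?exprn_gt0 ?(lt_le_trans s0)//.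
        by rewrite lerXn2r ?nnegrE ?cabs_ge0// ltW.
      + by rewrite mul0r cabs0 divr_ge0// exprn_ge0// ltW.
  rewrite -[RHS](mulr0 (z ^+ n)) -(pint_annulus_moment_eq0 iG) -pintZ// !bE -pintB//.
  apply: (eq_pint_off (w := z)).
  - by have /cintegrable_measurable := pintegrableB (ib n) (ib n.+1).
  - by apply: pmeasurableM => //; exact: cintegrable_measurable iG.
  move=> w wz; rewrite !qbE /F /annulus_ind /disk_ind.
  case: (ltP (cabs w) s) => sw; first by rewrite !(mul0r, mulr0) subrr.
  case: ifP => _; last by rewrite !(mul0r, mulr0) subrr.
  have w0 : w != 0 by rewrite -cabs_gt0 (lt_le_trans s0).
  have wz0 : w - z != 0 by rewrite subr_eq0.
  rewrite !mul1r !exprMn !exprS invfM -exprVn.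
  by move: (z ^+ n) (w^-1 ^+ n) (w^*%C ^+ m) => x y t; field; rewrite w0.
clearbody a b.
have bn n : b n = b 0.
  by elim: n => // n <-; apply/esym/eqP; rewrite -subr_eq0 b_step.
have b0 : b 0 = 0.
  apply: (pint_decay_eq0 (n0 := 0) (bound _ (pmeasurable_annulus_ind s r) ind2) mqb qb_le).
    by apply: filterS (ae_neq_circle s) => p; exact: qb1.
  by move=> n _; rewrite -(bn n) bE.
have an n : a (m.+1 + n)%N = a m.+1.
  elim: n => [|n IH]; first by rewrite addn0.
  rewrite addnS -IH; apply/esym/eqP; rewrite -subr_eq0 a_step ifF ?mulr0//.
  by apply/negbTE; rewrite gtn_eqF// addSn ltnS leq_addr.
have aS : a m.+1 = 0.
  apply: (pint_decay_eq0 (n0 := m.+1) (bound _ (pmeasurable_open_disk_ind s) ind1) mqa qa_le).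
    by apply: filterS (ae_neq_circle s) => p; exact: qa1.
  by move=> n mn; rewrite -aE -(subnKC mn) an.
have a_0 : a 0 = a m.
  have : forall n, (n <= m)%N -> a n = a 0.
    elim=> // n IH nm; rewrite -(IH (ltnW nm)); apply/esym/eqP; rewrite -subr_eq0.
    by rewrite a_step ifF ?mulr0//; apply/negbTE; rewrite ltn_eqF.
  by move=> ->.
have am : a m = - (z^-1 ^+ m.+1) * V by have := a_step m; rewrite eqxx aS subr0.
have -> : pint F = a 0 + b 0.
  rewrite aE bE -pintD//; apply: eq_pint => w.
  rewrite !expr0 !mul1r -mulrDl /open_disk_ind /annulus_ind.
  case: (ltP (cabs w) s) => ws; first by rewrite addr0 mul1r.
  by rewrite add0r /F /disk_ind; case: ifP => _; rewrite ?mul1r ?mul0r.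
rewrite b0 addr0 a_0 am /V rmorphM rmorphM /= fmorphV rmorph_nat -mul2n exprM.
rewrite rmorphXn /= /s -mul_conjc exprMn exprVn.
have zm : z ^+ m.+1 != 0 by rewrite expf_neq0.
have mm : m.+1%:R != 0 :> C by rewrite pnatr_eq0.
move: (z ^+ m.+1) zm (m.+1%:R : C) mm => x x0 y y0; field; exact/andP.
Qed.

(** This is the Cauchy-Pompeiu formula for [P (conj zeta)]: the boundary integral only sees
[P 0], since [conj zeta = r ^ 2 / zeta] on the circle.  By linearity it is enough to treat
monomials. *)
Lemma pint_cauchy_poly (r : R) (P : {poly C}) z : 0 < r -> cabs z <= r ->
  pintegrable (fun w => disk_ind r w * (P^`().[w^*%C] / (w - z))) /\
  pint (fun w => disk_ind r w * (P^`().[w^*%C] / (w - z))) =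
  - ((pi : R)%:C * (P.[z^*%C] - P.[0])).
Proof.
move=> r0 zr.
pose K (P : {poly C}) :=
  pintegrable (fun w => disk_ind r w * (P^`().[w^*%C] / (w - z))) /\
  pint (fun w => disk_ind r w * (P^`().[w^*%C] / (w - z))) =
  - ((pi : R)%:C * (P.[z^*%C] - P.[0])).
have KD (P1 P2 : {poly C}) : K P1 -> K P2 -> K (P1 + P2).
  move=> [i1 E1] [i2 E2].
  have E : (fun w => disk_ind r w * ((P1 + P2)^`().[w^*%C] / (w - z))) =
    (fun w => disk_ind r w * (P1^`().[w^*%C] / (w - z)) +
              disk_ind r w * (P2^`().[w^*%C] / (w - z))).
    by apply/funext => w; rewrite derivD hornerD mulrDl mulrDr.
  rewrite /K E; split; first exact: pintegrableD.
  by rewrite pintD// E1 E2 !hornerD; ring.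
have KZ (c : C) (P1 : {poly C}) : K P1 -> K (c *: P1).
  move=> [i1 E1].
  have E : (fun w => disk_ind r w * ((c *: P1)^`().[w^*%C] / (w - z))) =
    (fun w => c * (disk_ind r w * (P1^`().[w^*%C] / (w - z)))).
    by apply/funext => w; rewrite derivZ hornerZ; ring.
  rewrite /K E; split; first exact: pintegrableZ.
  by rewrite pintZ// E1 !hornerZ; ring.
have Kc (c : C) : K c%:P.
  have E : (fun w => disk_ind r w * ((c%:P)^`().[w^*%C] / (w - z))) = (fun=> 0).
    by apply/funext => w; rewrite derivC horner0 mul0r mulr0.
  rewrite /K E; split.
    by apply: (pintegrable_bounded r0 (M := 0)) => // v; rewrite cabs0.
  by rewrite !hornerC subrr mulr0 oppr0; exact: cintegral0.
suff KX n : K 'X^n.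
  rewrite -/(K P) -[P]coefK poly_def; apply: big_ind => //.
  - by rewrite -polyC0; exact: Kc.
  - by move=> i _; apply: KZ.
case: n => [|m]; first by rewrite expr0; exact: Kc.
have E : (fun w => disk_ind r w * (('X^(m.+1))^`().[w^*%C] / (w - z))) =
  (fun w => m.+1%:R * (disk_ind r w * (w^*%C ^+ m / (w - z)))).
  apply/funext => w; rewrite derivXn hornerMn hornerXn -mulr_natl; ring.
rewrite /K E.
have i : pintegrable (fun w => disk_ind r w * (w^*%C ^+ m / (w - z))).
  apply: (weak_singular (z := z) (b := 1) (c := r ^+ m) r0 _ _ _ zr _ _).1 => //.
  - by rewrite exprn_ge0// ltW.
  - apply: pmeasurableM => //; apply: pmeasurableM => //; exact: pmeasurableV.
  - by move=> v rv; rewrite /disk_ind leNgt rv/= mul0r.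
  - move=> v vz vr; rewrite /disk_ind vr mul1r !cabsM cabsX cabs_conj cabsV.
    rewrite (_ : 1 - 2 = -1 :> R); last by ring.
    by rewrite powR_inv1 ?cabs_ge0// ler_wpM2r ?invr_ge0 ?cabs_ge0// expr_cabs_le.
split; first exact: pintegrableZ.
rewrite pintZ// pint_cauchy_monomial// !hornerXn expr0n/= subr0.
have mm : m.+1%:R != 0 :> C by rewrite pnatr_eq0.
by move: (m.+1%:R : C) mm => x x0; field.
Qed.

End CauchyMonomials.

(** * Potentials *)

Section FubiniMeasurability.
Context d1 d2 (T1 : measurableType d1) (T2 : measurableType d2) (R : realType).
Variable m1 : {sigma_finite_measure set T1 -> \bar R}.
Variable m2 : {sigma_finite_measure set T2 -> \bar R}.

Lemma cmeasurable_cintegral1 (F : T1 * T2 -> R[i]) :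
  cintegrable (m1 \x m2)%E F ->
  cmeasurable (fun y => cintegral m1 (fun x => F (x, y))).
Proof.
move=> [F1 F2]; split.
- exact: (measurableT_comp (fine_measurable measurableT) (measurable_fubini_G F1)).
- exact: (measurableT_comp (fine_measurable measurableT) (measurable_fubini_G F2)).
Qed.

End FubiniMeasurability.

Section CauchyPotentials.
Variable R : realType.
Local Notation C := R[i].
Local Notation RR := (measurableTypeR R * measurableTypeR R)%type.
Local Notation mu2 := (@plane_measure R).
Local Notation toC := (@toC R).
Implicit Types (F G g : C -> C) (z w : C).

Definition weight (r M : R) g := [/\ pmeasurable g, forall z, cabs (g z) <= M &
  forall z, r < cabs z -> g z = 0].

(** A family of kernels, of degree [p - q], that is stable under both Wirtinger
derivatives. *)
Definition kern (p q : nat) (u : C) : C := u^*%C ^+ p / u ^+ q.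

Definition potential (p q : nat) g z : C := pint (fun w => kern p q (w - z) * g w).

Lemma pmeasurable_kern p q z : pmeasurable (fun w => kern p q (w - z)).
Proof.
apply: pmeasurableM; last apply: pmeasurableV; apply: pmeasurableX;
  [apply: pmeasurable_conj|]; exact: pmeasurable_subc.
Qed.

Lemma eq_pint_off2 (w1 w2 : C) F G : pmeasurable F -> pmeasurable G ->
  (forall v, v != w1 -> v != w2 -> F v = G v) -> pint F = pint G.
Proof.
move=> mF mG FG; apply: cintegral_ae_eq => //.
by apply: filterS2 (ae_neq_point w1) (ae_neq_point w2) => p pw1 pw2; exact: FG.
Qed.

Lemma pintegrable_off2 (w1 w2 : C) F G : pmeasurable F -> pintegrable G ->
  (forall v, v != w1 -> v != w2 -> F v = G v) -> pintegrable F.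
Proof.
move=> [F1 F2] [G1 G2] FG.
have FGae : {ae mu2, forall p, F (toC p) = G (toC p)}.
  by apply: filterS2 (ae_neq_point w1) (ae_neq_point w2) => p pw1 pw2; exact: FG.
have ae (f g : RR -> R) : measurable_fun setT f ->
    mu2.-integrable setT (fun p => (g p)%:E) -> {ae mu2, forall p, f p = g p} ->
    mu2.-integrable setT (fun p => (f p)%:E).
  move=> mf /integrableP[mg gy] fg; apply/integrableP; split.
    exact/measurable_EFinP.
  rewrite (ae_eq_integral (fun p => `|(g p)%:E|%E))//.
  - by apply: measurableT_comp => //; exact/measurable_EFinP.
  - by apply: measurableT_comp.
  - by apply: filterS fg => p -> _.
by split; [apply: ae F1 G1 _|apply: ae F2 G2 _]; apply: filterS FGae => p ->.
Qed.

Lemma weight_disk_ind r : weight r 1 (@disk_ind R r).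
Proof.
split; first exact: pmeasurable_disk_ind.
  by move=> z; rewrite /disk_ind; case: ifP; rewrite ?cabs0 ?cabs1.
by move=> z rz; rewrite /disk_ind leNgt rz.
Qed.

Lemma weightM_le r M N g h : weight r M g -> pmeasurable h ->
  (forall z, cabs z <= r -> cabs (h z) <= N) -> 0 <= N ->
  weight r (N * M) (fun z => h z * g z).
Proof.
move=> [mg gM g0] mh hN N0; split; first exact: pmeasurableM.
  move=> z; rewrite cabsM; have [zr|rz] := leP (cabs z) r.
    by rewrite ler_pM ?cabs_ge0// hN.
  by rewrite g0// cabs0 mulr0 mulr_ge0// (le_trans (cabs_ge0 _) (gM 0)).
by move=> z rz; rewrite g0// mulr0.
Qed.

Lemma cabs_kern_le p q u (s : R) : cabs u <= s -> (0 < q)%N -> (q <= p.+1)%N ->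
  cabs (kern p q u) <= s ^+ (p.+1 - q) * (cabs u)^-1.
Proof.
move=> us q0 qp; have [->|u0] := eqVneq u 0.
  by rewrite /kern [0 ^+ q]expr0n (gtn_eqF q0) invr0 mulr0 cabs0 invr0 mulr0.
have c0 : 0 < cabs u by rewrite cabs_gt0.
rewrite /kern cabsM cabsV !cabsX cabs_conj.
have -> : cabs u ^+ p / cabs u ^+ q = cabs u ^+ (p.+1 - q) * (cabs u)^-1.
  have E : (p.+1 = (p.+1 - q) + q)%N by rewrite subnK.
  apply: (mulIf (x := cabs u ^+ q * cabs u)).
    by rewrite mulf_neq0// ?expf_neq0// gt_eqF.
  have c1 : cabs u != 0 by rewrite gt_eqF.
  have -> : cabs u ^+ p / cabs u ^+ q * (cabs u ^+ q * cabs u) = cabs u ^+ p.+1.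
    by rewrite mulrA divfK ?expf_neq0// -exprSr.
  rewrite [in LHS]E exprD.
  by rewrite [cabs u ^+ q * _]mulrC [RHS]mulrA mulfVK.
by rewrite ler_wpM2r ?invr_ge0 ?cabs_ge0// lerXn2r ?nnegrE ?cabs_ge0// (le_trans (ltW c0)).
Qed.

Lemma cabs_sub_disk (r : R) z w : cabs z <= r -> cabs w <= r -> cabs (z - w) <= 2 * r.
Proof. by move=> zr wr; apply: le_trans (cabsB _ _) _; lra. Qed.

Lemma pintegrable_potential r M g p q z : 0 < r -> weight r M g -> cabs z <= r ->
  (0 < q)%N -> (q <= p.+1)%N -> pintegrable (fun w => kern p q (w - z) * g w).
Proof.
move=> r0 [mg gM g0] zr q0 qp.
have M0 : 0 <= M by exact: le_trans (cabs_ge0 _) (gM 0).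
have r20 : 0 <= 2 * r by rewrite mulr_ge0// ltW.
apply: (weak_singular (z := z) (b := 1) (c := (2 * r) ^+ (p.+1 - q) * M) r0 _ _ _ zr _ _).1 => //.
- by rewrite mulr_ge0 ?exprn_ge0.
- by apply: pmeasurableM => //; exact: pmeasurable_kern.
- by move=> v rv; rewrite g0// mulr0.
- move=> v vz vr; rewrite cabsM mulrAC (_ : 1 - 2 = -1 :> R); last by ring.
  rewrite powR_inv1 ?cabs_ge0// ler_pM ?cabs_ge0//.
  by rewrite cabs_kern_le// cabs_sub_disk.
Qed.

Lemma kern_poly (a : C) (k : nat) : exists2 P : {poly C},
  forall x, P.[x] = - (a - x) ^+ k.+1 / k.+1%:R & forall x, P^`().[x] = (a - x) ^+ k.
Proof.
have kk : k.+1%:R != 0 :> C by rewrite pnatr_eq0.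
exists ((- k.+1%:R^-1) *: (a%:P - 'X) ^+ k.+1) => x.
  by rewrite hornerZ horner_exp hornerD hornerN hornerC hornerX mulrC mulNr mulrN.
rewrite derivZ deriv_exp derivB derivC derivX sub0r hornerZ hornerMn mulN1r.
rewrite hornerN horner_exp hornerD hornerN hornerC hornerX /= -[(- _) *+ _]mulr_natl.
by move: (k.+1%:R) kk => y y0; field.
Qed.

(** Partial fractions reduce the inner integral of [T (T ^ k)] to two Cauchy
integrals of the same polynomial. *)
Lemma pint_two_poles r k z w : 0 < r -> cabs z <= r -> cabs w <= r -> w != z ->
  pintegrable (fun v => disk_ind r v / (v - z) * kern k 1 (w - v)) /\
  pint (fun v => disk_ind r v / (v - z) * kern k 1 (w - v)) =
  (pi : R)%:C / k.+1%:R * kern k.+1 1 (w - z).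
Proof.
move=> r0 zr wr wz; have [P PE P'E] := kern_poly w^*%C k.
have [iz Ez] := pint_cauchy_poly P r0 zr.
have [iw Ew] := pint_cauchy_poly P r0 wr.
have wz0 : w - z != 0 by rewrite subr_eq0.
pose D v := disk_ind r v * (P^`().[v^*%C] / (v - z)) -
            disk_ind r v * (P^`().[v^*%C] / (v - w)).
have iD : pintegrable (fun v => (w - z)^-1 * D v).
  exact: (pintegrableZ _ (pintegrableB iz iw)).
set F := fun v => _ : C.
have mF : pmeasurable F.
  apply: pmeasurableM.
    apply: pmeasurableM; first exact: pmeasurable_disk_ind.
    by apply: pmeasurableV; exact: pmeasurable_subc.
  apply: pmeasurableM; last apply: pmeasurableV; apply: pmeasurableX;
  [apply: pmeasurable_conj|];
  by apply: pmeasurableB; [exact: pmeasurable_cst|exact: pmeasurable_id].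
have FD v : v != z -> v != w -> F v = (w - z)^-1 * D v.
  move=> vz vw; rewrite /F /D /kern !P'E expr1 rmorphB /=.
  have v1 : v - z != 0 by rewrite subr_eq0.
  have v2 : v - w != 0 by rewrite subr_eq0.
  have v3 : w - v != 0 by rewrite subr_eq0 eq_sym.
  move: (_ ^+ k) => x; field.
  by rewrite v1 v2 v3 wz0.
split; first exact: pintegrable_off2 mF iD FD.
transitivity ((w - z)^-1 * (- ((pi : R)%:C * (P.[z^*%C] - P.[0])) -
                            - ((pi : R)%:C * (P.[w^*%C] - P.[0])))).
  rewrite -Ez -Ew -pintB// -pintZ; last exact: pintegrableB.
  apply: (eq_pint_off2 mF _ FD); exact: cintegrable_measurable iD.
rewrite !PE subrr expr0n/= oppr0 mul0r /kern expr1 rmorphB /=.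
have kk : k.+1%:R != 0 :> C by rewrite pnatr_eq0.
move: (k.+1%:R) kk (_ ^+ k.+1) => y y0 x; field; exact/andP.
Qed.

End CauchyPotentials.

(** * The Cauchy operator applied to a potential *)

Section Iteration.
Variable R : realType.
Local Notation C := R[i].
Local Notation RR := (measurableTypeR R * measurableTypeR R)%type.
Local Notation mu2 := (@plane_measure R).
Local Notation toC := (@toC R).
Implicit Types (F G g : C -> C) (z w : C).

Lemma pmeasurable_invB z : pmeasurable (fun v : C => (v - z)^-1).
Proof. by apply: pmeasurableV; exact: pmeasurable_subc. Qed.

(** The two singularities [1 / (v - z)] and [1 / (w - v)] are integrable one after
the other, which is what the exchange of the order of integration requires. *)
Lemma cintegrable_two_poles r M g k z : 0 < r -> weight r M g -> cabs z <= r ->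
  cintegrable (mu2 \x mu2)%E (fun p : RR * RR =>
    disk_ind r (toC p.1) / (toC p.1 - z) * (kern k 1 (toC p.2 - toC p.1) * g (toC p.2))).
Proof.
move=> r0 [mg gM g0] zr; have r30 : 0 < 3 * r by rewrite mulr_gt0.
have M0 : 0 <= M by exact: le_trans (cabs_ge0 _) (gM 0).
(* [3 * r] exceeds the distance between any two points of the disk. *)
pose sing v w : R := if cabs (w - v) < 3 * r then cabs (w - v) `^ (1 - 2) else 0.
have sing_ge0 v w : 0 <= sing v w.
  by rewrite /sing; case: ifP => // _; exact: powR_ge0.
pose K := (2 * r) ^+ k * M.
have K0 : 0 <= K by rewrite mulr_ge0// exprn_ge0// mulr_ge0// ltW.
pose G (p : RR * RR) : R := K * (sing z (toC p.1) * sing (toC p.1) (toC p.2)).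
pose N := 2 * pi * ((3 * r) `^ 1 / 1).
have massz v : mass_le mu2 (fun p => sing v (toC p)) N by exact: mass_near.
have m1 : cmeasurable (fun p : RR * RR => toC p.1).
  exact: (cmeasurable_comp measurable_fst (@cmeasurable_toC R)).
have m2 : cmeasurable (fun p : RR * RR => toC p.2).
  exact: (cmeasurable_comp measurable_snd (@cmeasurable_toC R)).
have msing : measurable_fun setT (fun p : RR * RR => sing (toC p.1) (toC p.2)).
  have mB : measurable_fun setT (fun p : RR * RR => cabs (toC p.2 - toC p.1)).
    by apply: measurable_cabs; exact: cmeasurableB.
  apply: measurable_fun_ifT => //; first exact: measurable_fun_ltr.
  exact: (measurableT_comp (measurable_powR _) mB).
have mG : measurable_fun setT G.
  apply: measurable_funM => //; apply: measurable_funM => //.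
  have [ms _ _] := massz z.
  exact: (measurableT_comp ms measurable_fst).
have GN : mass_le (mu2 \x mu2)%E G (K * N * N).
  apply: (mass_le_prod (A := fun p => sing z (toC p))) => //.
  - have [? ? ?] := massz 0; rewrite mulr_ge0// (mass_le_bound_ge0 (massz 0))//.
  - by move=> p; rewrite mulr_ge0// mulr_ge0.
  - move=> p; have c0 : 0 <= K * sing z (toC p) by rewrite mulr_ge0.
    have := mass_leZ c0 (massz (toC p)).
    rewrite (_ : K * sing z (toC p) * N = K * N * sing z (toC p)); last by ring.
    rewrite (_ : (fun q => _) = (fun q => G (p, q)))//.
    by apply/funext => q; rewrite /G /= mulrA.
apply: (cintegrable_dominated (G := G) _ _ GN).
  apply: cmeasurableM.
    apply: cmeasurableM.
      exact: (cmeasurable_comp measurable_fst (pmeasurable_disk_ind r)).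
    exact: (cmeasurable_comp measurable_fst (pmeasurable_invB z)).
  apply: cmeasurableM; last exact: (cmeasurable_comp measurable_snd mg).
  apply: cmeasurableM; last apply: cmeasurableV; apply: cmeasurableX;
    [apply: cmeasurable_conj|]; exact: cmeasurableB.
apply: aeW => -[p q] /=; rewrite /G /=.
have [pr|pr] := leP (cabs (toC p)) r; last first.
  by rewrite disk_ind0// !mul0r cabs0 mulr_ge0 // mulr_ge0.
have [qr|qr] := leP (cabs (toC q)) r; last first.
  by rewrite g0// !mulr0 cabs0 mulr_ge0 // mulr_ge0.
have near v w : cabs v <= r -> cabs w <= r -> cabs (w - v) < 3 * r.
  by move=> vr wr; apply: le_lt_trans (cabsB _ _) _; lra.
rewrite /sing !near// (_ : 1 - 2 = -1 :> R); last by ring.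
rewrite !powR_inv1 ?cabs_ge0// disk_ind1// mul1r cabsM [cabs (kern _ _ _ * _)]cabsM cabsV.
rewrite [K * _]mulrCA ler_wpM2l ?invr_ge0 ?cabs_ge0//.
rewrite mulrAC ler_pM ?cabs_ge0//.
have := @cabs_kern_le _ k 1 (toC q - toC p) (2 * r).
by rewrite subSS subn0; apply => //; exact: cabs_sub_disk.
Qed.

(** The order of integration is exchanged; the inner integral is then [pint_two_poles]. *)
Lemma pint_cauchy_potential r M g k z : 0 < r -> weight r M g -> cabs z <= r ->
  pint (fun v => disk_ind r v * (potential k 1 g v / (v - z))) =
  (pi : R)%:C / k.+1%:R * potential k.+1 1 g z.
Proof.
move=> r0 wg zr; have [mg gM g0] := wg.
have iPhi := cintegrable_two_poles k r0 wg zr.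
transitivity (pint (fun v => pint (fun w => disk_ind r v / (v - z) *
    (kern k 1 (w - v) * g w)))).
  apply: eq_pint => v; rewrite /disk_ind; case: ifP => vr; last first.
    rewrite mul0r (_ : (fun _ => _) = fun=> 0); first by rewrite [RHS]cintegral0.
    by apply/funext => w; rewrite !mul0r.
  rewrite pintZ; last exact: pintegrable_potential wg vr _ _.
  by rewrite !mul1r mulrC.
transitivity (pint (fun w => pint (fun v => disk_ind r v / (v - z) *
    (kern k 1 (w - v) * g w)))).
  exact: (cintegral_fubini iPhi).
rewrite /potential -pintZ; last exact: pintegrable_potential wg zr _ _.
apply: (eq_pint_off (w := z)).
- exact: (cmeasurable_cintegral1 iPhi).
- by apply: pmeasurableM => //; apply: pmeasurableM => //; exact: pmeasurable_kern.
move=> w wz; have [wr|rw] := leP (cabs w) r; last first.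
  rewrite g0// !mulr0 (_ : (fun _ => _) = fun=> 0); first exact: cintegral0.
  by apply/funext => v; rewrite !mulr0.
have [iK EK] := pint_two_poles k r0 zr wr wz.
transitivity (pint (fun v => g w * (disk_ind r v / (v - z) * kern k 1 (w - v)))).
  by apply: eq_pint => v; rewrite [RHS]mulrC mulrA.
by rewrite pintZ// EK; ring.
Qed.

Lemma area_intE r F : area_int r F = pint (fun w => disk_ind r w * F w).
Proof.
rewrite /area_int /pint /cintegral; congr (_ +i* _);
rewrite Rintegral_mkcond; apply: eq_Rintegral => p _; rewrite patchE /disk_ind;
rewrite (_ : (p \in _) = (cabs (toC p) <= r)); do ?[by apply/idP/idP; rewrite inE];
by case: ifP => _; rewrite ?mul1r ?mul0r.
Qed.

End Iteration.

(** * First order expansions of the kernels *)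

Section KernelEstimates.
Variable R : realType.
Local Notation C := R[i].
Implicit Types (u h : C) (a A B : C -> C) (c s t m : R).

Lemma cabsM_le (x y : C) (X Y : R) : cabs x <= X -> cabs y <= Y ->
  cabs (x * y) <= X * Y.
Proof. by move=> xX yY; rewrite cabsM ler_pM ?cabs_ge0. Qed.

Lemma cabsD_le (x y : C) (X Y : R) : cabs x <= X -> cabs y <= Y ->
  cabs (x + y) <= X + Y.
Proof. by move=> xX yY; apply: le_trans (cabsD _ _) _; exact: lerD. Qed.

(** Estimates of a kernel [a] of degree [-1] and of its first order increment
[h * A - h^* * B], at two points [u] and [u - h] away from the origin. *)
Definition singular_kernel c a A B := forall u h, u != 0 -> u - h != 0 ->
  let m := (cabs u)^-1 in let m' := (cabs (u - h))^-1 in let t := cabs h in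
  [/\ cabs (a u) <= c * m, cabs (a (u - h) - a u) <= c * t * m * m' &
      cabs (a (u - h) - a u - (h * A u - h^*%C * B u)) <= c * t ^+ 2 * m ^+ 2 * m'].

(** The analogue in degree [0] or more, in the disk of radius [s]. *)
Definition bounded_kernel s c a A B := forall u h, u != 0 -> u - h != 0 ->
  cabs u <= s -> cabs (u - h) <= s ->
  let m := (cabs u)^-1 in let m' := (cabs (u - h))^-1 in let t := cabs h in
  [/\ cabs (a u) <= c, cabs (a (u - h) - a u) <= c * t * m * m' &
      cabs (a (u - h) - a u - (h * A u - h^*%C * B u)) <= c * t ^+ 2 * m * m'].

Lemma singular_kernel_inv :
  singular_kernel 1 (fun u => u^-1) (fun u => (u ^+ 2)^-1) (fun=> 0).
Proof.
move=> u h u0 uh0 /=; have E1 : (u - h)^-1 - u^-1 = h * u^-1 * (u - h)^-1.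
  by field; exact/andP.
split; first by rewrite cabsV mul1r.
  by rewrite E1 !cabsM !cabsV mul1r.
have -> : (u - h)^-1 - u^-1 - (h * (u ^+ 2)^-1 - h^*%C * 0) =
    h ^+ 2 * u^-1 ^+ 2 * (u - h)^-1.
  by rewrite mulr0 subr0; field; exact/andP.
by rewrite cabsM [cabs (_ ^+ 2 * _)]cabsM !cabsX !cabsV mul1r.
Qed.

Let phase u := u^*%C / u.

Lemma cabs_phase_le u : cabs (phase u) <= 1.
Proof.
have [->|u0] := eqVneq u 0; first by rewrite /phase invr0 mulr0 cabs0.
by rewrite cabsM cabsV cabs_conj divff// cabs_eq0.
Qed.

(** Leibniz rule for the product with [conj u / u], which is bounded, with increments
controlled from either end point.  Starting from [1 / u] it gives all the kernels
[conj u ^ p / u ^ p.+1]. *)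
Lemma singular_kernel_phase c a A B : 0 <= c -> singular_kernel c a A B ->
  singular_kernel (5 * c) (fun u => a u * phase u)
    (fun u => A u * phase u + a u * (u^*%C / u ^+ 2))
    (fun u => B u * phase u + a u / u).
Proof.
move=> c0 ka u h u0 uh0 /=; have [a1 a2 a3] := ka u h u0 uh0.
move: a1 a2 a3 => /=; set m := (cabs u)^-1; set m' := (cabs (u - h))^-1.
set t := cabs h; move=> a1 a2 a3.
have m0 : 0 <= m by rewrite invr_ge0 cabs_ge0.
have m'0 : 0 <= m' by rewrite invr_ge0 cabs_ge0.
have t0 : 0 <= t by exact: cabs_ge0.
have w1 : cabs (phase u) <= 1 by exact: cabs_phase_le.
have w1' : cabs (phase (u - h)) <= 1 by exact: cabs_phase_le.
have conj0 (x : C) : x != 0 -> x^*%C != 0 by rewrite conjc_eq0.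
have w2 : cabs (phase (u - h) - phase u) <= 2 * t * m.
  have -> : phase (u - h) - phase u = (h * phase (u - h) - h^*%C) * u^-1.
    by rewrite /phase rmorphB /=; field; exact/andP.
  apply: cabsM_le; last by rewrite cabsV.
  rewrite mulr2n mulrDl mul1r; apply: cabsD_le; last by rewrite cabsN cabs_conj.
  by rewrite -[leRHS]mulr1; apply: cabsM_le.
have w2' : cabs (phase (u - h) - phase u) <= 2 * t * m'.
  have -> : phase (u - h) - phase u = (h * phase u - h^*%C) * (u - h)^-1.
    by rewrite /phase rmorphB /=; field; exact/andP.
  apply: cabsM_le; last by rewrite cabsV.
  rewrite mulr2n mulrDl mul1r; apply: cabsD_le; last by rewrite cabsN cabs_conj.
  by rewrite -[leRHS]mulr1; apply: cabsM_le.
have w3 : cabs (phase (u - h) - phase u - (h * (u^*%C / u ^+ 2) - h^*%C / u)) <=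
    2 * t ^+ 2 * m * m'.
  have -> : phase (u - h) - phase u - (h * (u^*%C / u ^+ 2) - h^*%C / u) =
      h * (h * phase u - h^*%C) * u^-1 * (u - h)^-1.
    by rewrite /phase rmorphB /=; field; exact/andP.
  apply: cabsM_le; last by rewrite cabsV.
  apply: cabsM_le; last by rewrite cabsV.
  rewrite (_ : 2 * t ^+ 2 = t * (t + t)); last by ring.
  apply: cabsM_le => //; apply: cabsD_le; last by rewrite cabsN cabs_conj.
  by rewrite -[leRHS]mulr1; apply: cabsM_le.
have P1 : 0 <= c * m by rewrite mulr_ge0.
have P2 : 0 <= c * t * m * m' by rewrite !mulr_ge0.
have P3 : 0 <= c * t ^+ 2 * m ^+ 2 * m' by rewrite !mulr_ge0 ?exprn_ge0.
split.
- apply: le_trans (cabsM_le a1 w1) _; rewrite mulr1; lra.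
- have -> : a (u - h) * phase (u - h) - a u * phase u =
    (a (u - h) - a u) * phase (u - h) + a u * (phase (u - h) - phase u) by ring.
  apply: le_trans (cabsD_le (cabsM_le a2 w1') (cabsM_le a1 w2')) _.
  rewrite (_ : _ + _ = 3 * (c * t * m * m')); last by ring.
  by rewrite -!mulrA in P2 *; lra.
- set X := (X in cabs X <= _).
  have -> : X = (a (u - h) - a u) * (phase (u - h) - phase u) +
    ((a (u - h) - a u - (h * A u - h^*%C * B u)) * phase u +
     a u * (phase (u - h) - phase u - (h * (u^*%C / u ^+ 2) - h^*%C / u))).
    by rewrite /X /=; ring.
  apply: le_trans (cabsD_le (cabsM_le a2 w2) (cabsD_le (cabsM_le a3 w1)
     (cabsM_le a1 w3))) _.
  rewrite le_eqVlt; apply/orP; left; apply/eqP; ring.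
Qed.

(** A factor [conj u] raises the degree from [-1] to [0] and compensates one of the powers
of [1 / |u|]; from then on the bounds depend on the size [s] of the region. *)
Lemma bounded_kernel_of_singular s c a A B : 0 < s -> 0 <= c ->
  singular_kernel c a A B ->
  bounded_kernel s (2 * c * (1 + s)) (fun u => u^*%C * a u)
    (fun u => u^*%C * A u) (fun u => u^*%C * B u + a u).
Proof.
move=> s0 c0 ka u h u0 uh0 us uhs /=; have [a1 a2 a3] := ka u h u0 uh0.
have mm : cabs u * (cabs u)^-1 = 1 by rewrite divff// cabs_eq0.
have mm' : cabs (u - h) * (cabs (u - h))^-1 = 1 by rewrite divff// cabs_eq0.
move: a1 a2 a3 mm mm' => /=; set m := (cabs u)^-1; set m' := (cabs (u - h))^-1.
set t := cabs h; move=> a1 a2 a3 mm mm'.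
have m0 : 0 <= m by rewrite invr_ge0 cabs_ge0.
have m'0 : 0 <= m' by rewrite invr_ge0 cabs_ge0.
have t0 : 0 <= t by exact: cabs_ge0.
have cu : cabs u^*%C <= cabs u by rewrite cabs_conj.
have cuh : cabs (u - h)^*%C <= s by rewrite cabs_conj.
have ch : cabs (- h^*%C) <= t by rewrite cabsN cabs_conj.
have sm' : 1 <= s * m' by rewrite -mm' ler_wpM2r.
split.
- apply: le_trans (cabsM_le cu a1) _; rewrite mulrCA mm; nra.
- have -> : (u - h)^*%C * a (u - h) - u^*%C * a u =
    (u - h)^*%C * (a (u - h) - a u) + - h^*%C * a u by rewrite rmorphB /=; ring.
  apply: le_trans (cabsD_le (cabsM_le cuh a2) (cabsM_le ch a1)) _.
  have P : 0 <= c * t * m by rewrite !mulr_ge0.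
  have : c * t * m <= c * t * m * (s * m') by rewrite ler_peMr.
  have : 0 <= c * t * m * m' by rewrite mulr_ge0.
  set x := c * t * m in P *.
  rewrite (_ : s * (x * m') + t * (c * m) = s * (x * m') + x); last by rewrite /x; ring.
  rewrite (_ : 2 * c * (1 + s) * t * m * m' = 2 * (x * m') + 2 * (x * (s * m'))); last by rewrite /x; ring.
  rewrite (_ : s * (x * m') = x * (s * m')); last by ring.
  lra.
- set X := (X in cabs X <= _).
  have -> : X = - h^*%C * (a (u - h) - a u) +
     u^*%C * (a (u - h) - a u - (h * A u - h^*%C * B u)).
    by rewrite /X /= rmorphB /=; ring.
  apply: le_trans (cabsD_le (cabsM_le ch a2) (cabsM_le cu a3)) _.
  rewrite [X in X <= _](_ : _ = c * t ^+ 2 * m * m' * (1 + cabs u * m)); last by ring.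
  rewrite mm; have P : 0 <= c * t ^+ 2 * m * m' by rewrite !mulr_ge0 ?exprn_ge0.
  rewrite (_ : 2 * c * (1 + s) * t ^+ 2 * m * m' = c * t ^+ 2 * m * m' * (2 * (1 + s))); last by ring.
  by rewrite ler_wpM2l//; lra.
Qed.

Lemma bounded_kernelM_conj s c a A B : 0 < s -> 0 <= c ->
  bounded_kernel s c a A B ->
  bounded_kernel s (c * (1 + s) ^+ 2) (fun u => u^*%C * a u)
    (fun u => u^*%C * A u) (fun u => u^*%C * B u + a u).
Proof.
move=> s0 c0 ka u h u0 uh0 us uhs /=; have [a1 a2 a3] := ka u h u0 uh0 us uhs.
have mm : cabs u * (cabs u)^-1 = 1 by rewrite divff// cabs_eq0.
have mm' : cabs (u - h) * (cabs (u - h))^-1 = 1 by rewrite divff// cabs_eq0.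
move: a1 a2 a3 mm mm' => /=; set m := (cabs u)^-1; set m' := (cabs (u - h))^-1.
set t := cabs h; move=> a1 a2 a3 mm mm'.
have m0 : 0 <= m by rewrite invr_ge0 cabs_ge0.
have m'0 : 0 <= m' by rewrite invr_ge0 cabs_ge0.
have t0 : 0 <= t by exact: cabs_ge0.
have cu : cabs u^*%C <= s by rewrite cabs_conj.
have cuh : cabs (u - h)^*%C <= s by rewrite cabs_conj.
have ch : cabs (- h^*%C) <= t by rewrite cabsN cabs_conj.
have sm' : 1 <= s * m' by rewrite -mm' ler_wpM2r.
have sm : 1 <= s * m by rewrite -mm ler_wpM2r.
split.
- apply: le_trans (cabsM_le cu a1) _; nra.
- have -> : (u - h)^*%C * a (u - h) - u^*%C * a u =
    (u - h)^*%C * (a (u - h) - a u) + - h^*%C * a u by rewrite rmorphB /=; ring.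
  apply: le_trans (cabsD_le (cabsM_le cuh a2) (cabsM_le ch a1)) _.
  have P : 0 <= c * t by rewrite !mulr_ge0.
  have : c * t <= c * t * (s * m * (s * m')) by rewrite ler_peMr// mulr_ege1.
  have : 0 <= c * t * m * m' by rewrite !mulr_ge0.
  have : 0 <= s * (c * t * m * m') by rewrite !mulr_ge0// ltW.
  set x := c * t * m * m'.
  rewrite (_ : c * t * (s * m * (s * m')) = s ^+ 2 * x); last by rewrite /x; ring.
  rewrite (_ : c * (1 + s) ^+ 2 * t * m * m' = x + 2 * (s * x) + s ^+ 2 * x); last by rewrite /x; ring.
  rewrite (_ : t * c = c * t); last by ring.
  lra.
- set X := (X in cabs X <= _).
  have -> : X = - h^*%C * (a (u - h) - a u) +
     u^*%C * (a (u - h) - a u - (h * A u - h^*%C * B u)).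
    by rewrite /X /= rmorphB /=; ring.
  apply: le_trans (cabsD_le (cabsM_le ch a2) (cabsM_le cu a3)) _.
  rewrite [X in X <= _](_ : _ = c * t ^+ 2 * m * m' * (1 + s)); last by ring.
  have P : 0 <= c * t ^+ 2 * m * m' by rewrite !mulr_ge0 ?exprn_ge0.
  rewrite (_ : c * (1 + s) ^+ 2 * t ^+ 2 * m * m' = c * t ^+ 2 * m * m' * ((1 + s) ^+ 2)); last by ring.
  by rewrite ler_wpM2l//; nra.
Qed.

Lemma singular_kern p : exists2 c, 0 <= c & singular_kernel c (kern p p.+1)
  (fun u => p.+1%:R * kern p p.+2 u) (fun u => p%:R * kern p.-1 p.+1 u).
Proof.
elim: p => [|p [c c0 IH]].
  exists 1 => // u h u0 uh0; have := singular_kernel_inv u0 uh0.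
  by rewrite /kern !expr0 !expr1 !mul1r mul0r.
exists (5 * c); first by rewrite mulr_ge0.
move=> u h u0 uh0; have := singular_kernel_phase c0 IH u0 uh0.
have kE (v : C) : v != 0 -> kern p p.+1 v * phase v = kern p.+1 p.+2 v.
  by move=> v0; rewrite /kern /phase ![v^*%C ^+ p.+1]exprSr ![v ^+ p.+2]exprSr invfM; ring.
rewrite !kE//=; set x := h * (_ + _) - _; set y := h * _ - _; suff -> : x = y by [].
rewrite /x /y /kern /phase.
have -> : (p%:R : C) * (u^*%C ^+ p.-1 / u ^+ p.+1) * (u^*%C / u) =
   p%:R * (u^*%C ^+ p / u ^+ p.+2).
  case: (p) => [|n]; first by rewrite !mul0r.
  rewrite -[n.+1.-1]/n.
  rewrite [u^*%C ^+ n.+1]exprSr [u ^+ n.+3]exprSr.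
  by rewrite [(u ^+ n.+2 * u)^-1]invfM; ring.
have pE : p.+2%:R = p.+1%:R + 1 :> C by rewrite -addn1 natrD.
have pE' : p.+1%:R = p%:R + 1 :> C by rewrite -addn1 natrD.
rewrite pE pE' !exprS !invfM; move: (u ^+ p)^-1 (u^*%C ^+ p) (p%:R : C) => e f g.
by rewrite expr0 invr1 mulr1; ring.
Qed.

Lemma bounded_kern p q s : (0 < q <= p)%N -> 0 < s ->
  exists2 c, 0 <= c & bounded_kernel s c (kern p q)
  (fun u => q%:R * kern p q.+1 u) (fun u => p%:R * kern p.-1 q u).
Proof.
case: q => [//|q] /= qp s0; rewrite -(subnKC qp).
elim: (p - q.+1)%N => [|n [c c0 IH]].
  rewrite addn0; have [c c0 sk] := singular_kern q.
  exists (2 * c * (1 + s)); first by rewrite !mulr_ge0// addr_ge0// ltW.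
  move=> u h u0 uh0 us uhs; have := bounded_kernel_of_singular s0 c0 sk u0 uh0 us uhs.
  have kE (v : C) : v^*%C * kern q q.+1 v = kern q.+1 q.+1 v.
    by rewrite /kern [v^*%C ^+ q.+1]exprS mulrA.
  rewrite !kE/=; set x := h * _ - _; set y := h * _ - _; suff -> : x = y by [].
  rewrite /x /y /kern.
  have -> : u^*%C * (q%:R * (u^*%C ^+ q.-1 / u ^+ q.+1)) = q%:R * (u^*%C ^+ q / u ^+ q.+1).
    case: (q) => [|i]; first by rewrite !mul0r mulr0.
  by rewrite -[i.+1.-1]/i [u^*%C ^+ i.+1]exprS; ring.
  have pE' : q.+1%:R = q%:R + 1 :> C by rewrite -addn1 natrD.
  by rewrite pE' [u^*%C ^+ q.+1]exprS; ring.
exists (c * (1 + s) ^+ 2); first by rewrite mulr_ge0// sqr_ge0.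
move=> u h u0 uh0 us uhs; have := bounded_kernelM_conj s0 c0 IH u0 uh0 us uhs.
rewrite addnS; set j := (q.+1 + n)%N.
have kE (v : C) : v^*%C * kern j q.+1 v = kern j.+1 q.+1 v.
  by rewrite /kern [v^*%C ^+ j.+1]exprS mulrA.
rewrite !kE/=; set x := h * _ - _; set y := h * _ - _; suff -> : x = y by [].
rewrite /x /y /kern.
have -> : u^*%C * (j%:R * (u^*%C ^+ j.-1 / u ^+ q.+1)) = j%:R * (u^*%C ^+ j / u ^+ q.+1).
  case: (j) => [|i]; first by rewrite !mul0r mulr0.
  by rewrite -[i.+1.-1]/i [u^*%C ^+ i.+1]exprS; ring.
have pE' : j.+1%:R = j%:R + 1 :> C by rewrite -addn1 natrD.
by rewrite pE' [u^*%C ^+ j.+1]exprS; ring.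
Qed.

(** As [t] is at most twice the larger of [m] and [m'], the power [1 - alpha / 2] of [t] can
be spent on that distance.  What is left is [t ^ (1 + alpha / 2)], better than first order,
times a singularity at one of the poles of exponent [alpha / 2 - 2], which is integrable. *)
Lemma two_pole_interpolation (m m' t alpha : R) : 0 < m -> 0 < m' -> 0 <= t ->
  t <= m + m' -> 0 < alpha -> alpha <= 1 ->
  t ^+ 2 * m^-1 ^+ 2 * m'^-1 * m `^ alpha <=
  2 * t `^ (1 + alpha / 2) * (m `^ (alpha / 2 - 2) + m' `^ (alpha / 2 - 2)).
Proof.
move=> m0 m'0 t0 tmm al0 al1; have [->|t1] := eqVneq t 0.
  rewrite expr0n !mul0r !mulr_ge0 ?addr_ge0 ?powR_ge0//.
have tp : 0 < t by rewrite lt0r t1.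
have mi : m^-1 = m `^ (-1) by rewrite powR_inv1// ltW.
have mi' : m'^-1 = m' `^ (-1) by rewrite powR_inv1// ltW.
have m1 : m != 0 by rewrite gt_eqF.
have m1' : m' != 0 by rewrite gt_eqF.
have pD (x a b : R) : x != 0 -> x `^ (a + b) = x `^ a * x `^ b.
  by move=> x0; rewrite powRD// x0 implybT.
have pow2 (x : R) : x != 0 -> 0 <= x -> x ^+ 2 = x `^ 2 by move=> _ x0; rewrite powR_mulrn.
have half_exp : 0 <= 1 - alpha / 2 <= 1 by apply/andP; split; lra.
have tE : t ^+ 2 = t `^ (1 + alpha / 2) * t `^ (1 - alpha / 2).
  by rewrite -pD// -powR_mulrn//; congr (_ `^ _); lra.
have mE : m^-1 ^+ 2 * m'^-1 * m `^ alpha = m `^ (alpha - 2) * m'^-1.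
  rewrite exprVn -powR_mulrn ?ltW// -powRN mulrAC -pD//; congr (_ * _).
  by congr (_ `^ _); ring.
have -> : t ^+ 2 * m^-1 ^+ 2 * m'^-1 * m `^ alpha =
    t `^ (1 + alpha / 2) * (t `^ (1 - alpha / 2) * (m `^ (alpha - 2) * m'^-1)).
  by rewrite mulrA -tE -mE; ring.
rewrite [2 * _]mulrC -!mulrA ler_wpM2l ?powR_ge0//.
have bnd (M : R) : 0 < M -> t <= 2 * M -> t `^ (1 - alpha / 2) <= 2 * M `^ (1 - alpha / 2).
  move=> M0 tM; case/andP: half_exp => h1 h2.
  have M20 : 0 <= 2 * M by rewrite mulr_ge0// ltW.
  apply: (le_trans (ge0_ler_powR h1 t0 M20 tM)).
  by rewrite powRM ?(ltW M0)// ler_wpM2r ?powR_ge0// ler1_powR// ler1n.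
case: (leP m m') => mm.
- have tM : t <= 2 * m' by lra.
  apply: (@le_trans _ _ (2 * m' `^ (1 - alpha / 2) * (m `^ (alpha - 2) * m'^-1))).
    by rewrite ler_wpM2r ?bnd// mulr_ge0 ?powR_ge0// invr_ge0 ltW.
  rewrite mi' -!mulrA ler_wpM2l// mulrCA -pD//.
  apply: (@le_trans _ _ (m `^ (alpha / 2 - 2))); last by rewrite lerDl powR_ge0.
  rewrite (_ : alpha / 2 - 2 = (alpha - 2) + - (alpha / 2)); last by lra.
  rewrite [leRHS]pD// ler_wpM2l ?powR_ge0//.
  rewrite (_ : 1 - alpha / 2 + -1 = - (alpha / 2)); last by lra.
  rewrite !powRN lef_pV2 ?posrE ?powR_gt0// ge0_ler_powR ?nnegrE//; lra.
- have tM : t <= 2 * m by lra.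
  apply: (@le_trans _ _ (2 * m `^ (1 - alpha / 2) * (m `^ (alpha - 2) * m'^-1))).
    by rewrite ler_wpM2r ?bnd// mulr_ge0 ?powR_ge0// invr_ge0 ltW.
  rewrite mi' -!mulrA ler_wpM2l// mulrA -pD//.
  apply: (@le_trans _ _ (m' `^ (alpha / 2 - 2))); last by rewrite lerDr powR_ge0.
  rewrite (_ : alpha / 2 - 2 = (alpha / 2 - 1) + -1); last by lra.
  rewrite [leRHS]pD// ler_wpM2r ?powR_ge0//.
  rewrite (_ : 1 - alpha / 2 + (alpha - 2) = - (1 - alpha / 2)); last by lra.
  rewrite (_ : alpha / 2 - 1 = - (1 - alpha / 2)); last by lra.
  rewrite !powRN lef_pV2 ?posrE ?powR_gt0// ge0_ler_powR ?nnegrE//; lra.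
Qed.

End KernelEstimates.

(** * Wirtinger derivatives *)

Section Wirtinger.
Variable R : realType.
Local Notation C := R[i].
Implicit Types (F G : C -> C) (z h A B : C) (r e c : R).

(** Real differentiability in Wirtinger form: [A] and [B] are the derivatives along [z] and
[conj z].  The remainder is of Hoelder type because this is what the estimates of
singular integrals give. *)
Definition wdiff F z A B := exists c e d : R, [/\ 0 < e <= 1, 0 < d <= 1, 0 <= c &
  forall h, cabs h < d ->
    cabs (F (z + h) - F z - (A * h + B * h^*%C)) <= c * cabs h `^ (1 + e)].

Lemma powR_exp_anti (x a b : R) : 0 <= x -> x <= 1 -> a <= b -> 0 < a ->
  x `^ b <= x `^ a.
Proof.
move=> x0 x1 ab a0; have [->|xn] := eqVneq x 0.
  by rewrite !powR0// gt_eqF// (lt_le_trans a0).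
by apply: ger_powR => //; rewrite lt0r xn x0.
Qed.

Lemma wdiffD F G z A B A' B' : wdiff F z A B -> wdiff G z A' B' ->
  wdiff (fun w => F w + G w) z (A + A') (B + B').
Proof.
move=> [c1 [e1 [d1 [/andP[e10 e11] /andP[d10 d11] c10 FE]]]].
move=> [c2 [e2 [d2 [/andP[e20 e21] /andP[d20 d21] c20 GE]]]].
exists (c1 + c2), (Num.min e1 e2), (Num.min d1 d2); split.
- by rewrite lt_min e10 e20 ge_min e11.
- by rewrite lt_min d10 d20 ge_min d11.
- exact: addr_ge0.
move=> h; rewrite lt_min => /andP[h1 h2].
have hl1 : cabs h <= 1 by rewrite (le_trans (ltW h1)).
rewrite (_ : _ - _ = (F (z + h) - F z - (A * h + B * h^*%C)) +
   (G (z + h) - G z - (A' * h + B' * h^*%C))); last by ring.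
rewrite mulrDl; apply: cabsD_le.
  apply: le_trans (FE h h1) _; rewrite ler_wpM2l// powR_exp_anti ?cabs_ge0//.
    by rewrite lerD2l ge_min lexx.
  by rewrite addr_gt0// lt_min e10.
apply: le_trans (GE h h2) _; rewrite ler_wpM2l// powR_exp_anti ?cabs_ge0//.
  by rewrite lerD2l ge_min lexx orbT.
by rewrite addr_gt0// lt_min e10.
Qed.

Lemma wdiffZ F z A B (a : C) : wdiff F z A B ->
  wdiff (fun w => a * F w) z (a * A) (a * B).
Proof.
move=> [c [e [d [e0 d0 c0 FE]]]]; exists (cabs a * c), e, d; split => //.
  by rewrite mulr_ge0 ?cabs_ge0.
move=> h hd; rewrite (_ : _ - _ = a * (F (z + h) - F z - (A * h + B * h^*%C))); last by ring.
by rewrite -mulrA; apply: cabsM_le => //; exact: FE.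
Qed.

Lemma wdiff_cst z (a : C) : wdiff (fun=> a) z 0 0.
Proof.
exists 0, 1, 1; split => //; rewrite ?ltr01 ?lexx//.
by move=> h _; rewrite !mul0r addr0 subrr subr0 cabs0.
Qed.

Lemma wdiff_local F G z A B r : 0 < r ->
  (forall w, cabs (w - z) < r -> F w = G w) -> wdiff F z A B -> wdiff G z A B.
Proof.
move=> r0 FG [c [e [d [e0 /andP[d0 d1] c0 FE]]]].
exists c, e, (Num.min d r); split => //; first by rewrite lt_min d0 r0 ge_min d1.
move=> h; rewrite lt_min => /andP[hd hr]; rewrite -!FG; first exact: FE.
  by rewrite subrr cabs0.
by rewrite addrC addKr.
Qed.

Lemma wdiffM_conj F z A B : wdiff F z A B ->
  wdiff (fun w => w^*%C * F w) z (z^*%C * A) (z^*%C * B + F z).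
Proof.
move=> [c [e [d [/andP[e0 e1] /andP[d0 d1] c0 FE]]]].
exists ((cabs z + 1) * c + (cabs A + cabs B)), e, d; split.
- by rewrite e0 e1.
- by rewrite d0.
- by rewrite addr_ge0 ?mulr_ge0 ?addr_ge0 ?cabs_ge0.
move=> h hd; set X := F (z + h) - F z - (A * h + B * h^*%C).
have h1 : cabs h <= 1 by rewrite (le_trans (ltW hd)).
rewrite (_ : _ - _ = (z + h)^*%C * X + h^*%C * (A * h + B * h^*%C)); last first.
  by rewrite /X !rmorphD /=; ring.
rewrite mulrDl; apply: cabsD_le.
  rewrite -mulrA; apply: cabsM_le; last exact: FE.
  by rewrite cabs_conj (le_trans (cabsD _ _))// lerD2l.
apply: (@le_trans _ _ ((cabs A + cabs B) * cabs h `^ 2)).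
  rewrite powR_mulrn ?cabs_ge0// expr2 mulrCA; apply: cabsM_le; first by rewrite cabs_conj.
  by rewrite mulrDl; apply: cabsD_le; rewrite cabsM ?cabs_conj.
rewrite ler_wpM2l ?addr_ge0 ?cabs_ge0// powR_exp_anti ?cabs_ge0//; lra.
Qed.

Lemma wdiff_conjX z n : wdiff (fun w => w^*%C ^+ n) z 0 (n%:R * z^*%C ^+ n.-1).
Proof.
elim: n => [|n IH]; first by rewrite mul0r; exact: wdiff_cst.
have := wdiffM_conj IH; rewrite mulr0.
have -> : z^*%C * (n%:R * z^*%C ^+ n.-1) + z^*%C ^+ n = n.+1%:R * z^*%C ^+ n.+1.-1.
  rewrite -addn1 natrD /= mulrDl mul1r addn1 /=; congr (_ + _).
  by case: n {IH} => [|n]; rewrite ?mul0r ?mulr0//= exprS mulrCA.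
by congr wdiff; apply/funext => w; rewrite exprS.
Qed.

Lemma conj_realM (t : R) (v : C) : (t%:C * v)^*%C = t%:C * v^*%C.
Proof. by case: v => a b; simpc. Qed.

Lemma small_power_eq0 (x c e d : R) : 0 < e -> 0 < d -> 0 <= x ->
  (forall t, 0 < t -> t < d -> x <= c * t `^ e) -> x = 0.
Proof.
move=> e0 d0 x0 xt; apply/eqP; rewrite eq_le x0 andbT.
rewrite -(mulr0 c).
have cv : c * t `^ e @[t --> 0^'+] --> c * 0 by apply: cvgMr; exact: powR_cvg0.
rewrite -(cvg_lim _ cv)//; apply: limr_ge; first exact: cvgP cv.
near=> t; apply: xt; near: t; [exact: nbhs_right_gt|exact: nbhs_right_lt].
Unshelve. all: end_near. Qed.

Lemma wdiff_unique F z A B A' B' : wdiff F z A B -> wdiff F z A' B' ->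
  A = A' /\ B = B'.
Proof.
move=> FA /(wdiffZ (-1))/(wdiffD FA).
have -> : (fun w => F w + -1 * F w) = fun=> 0.
  by apply/funext => w; rewrite mulN1r subrr.
rewrite !mulN1r => -[c [e [d [/andP[e0 e1] /andP[d0 d1] c0 E]]]].
set a := A - A' in E; set b := B - B' in E.
have ab (v : C) : cabs v = 1 -> a * v + b * v^*%C = 0.
  move=> v1; apply/eqP; rewrite -cabs_eq0; apply/eqP.
  apply: (@small_power_eq0 _ c e d) => //; first exact: cabs_ge0.
  move=> t t0 td; have tv : cabs (t%:C * v) = t by rewrite cabsM cabs_real v1 mulr1 gtr0_norm.
  have := E (t%:C * v); rewrite tv subrr sub0r cabsN => /(_ td).
  rewrite conj_realM.
  rewrite (_ : a * _ + _ = t%:C * (a * v + b * v^*%C)); last by ring.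
  rewrite cabsM cabs_real gtr0_norm// powRD; last by rewrite (gt_eqF t0) implybT.
  by rewrite powRr1 ?(ltW t0)// mulrCA ler_pM2l.
have h1 := ab 1 (cabs1 R); have h2 := ab 'i%C (cabs_i R).
have conji : ('i%C : C)^*%C = - 'i%C by simpc.
move: h1 h2; rewrite conjc1 conji !mulr1 mulrN -mulrBl => h1 h2.
have {}h2 : a - b = 0.
  by move/eqP: h2; rewrite mulf_eq0 => /orP[/eqP//|]; rewrite -cabs_eq0 cabs_i oner_eq0.
have a0 : a = 0.
  apply: (mulfI (x := 2)); first by rewrite pnatr_eq0.
  by rewrite mulr0 -[RHS](addr0 0) -{1}h1 -h2; ring.
have b0 : b = 0 by rewrite -h1 a0 add0r.
by split; apply/eqP; rewrite -subr_eq0; [rewrite -/a a0|rewrite -/b b0].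
Qed.

(** The partial derivatives are defined componentwise along real lines; this is the real
one-variable statement to which they reduce. *)
Lemma slice_derivative (s : R -> R) (L c e d : R) : 0 < e -> 0 < d ->
  (forall t, `|t| < d -> `|s t - s 0 - t * L| <= c * `|t| `^ (1 + e)) ->
  derivable s 0 1 /\ derive1 s 0 = L.
Proof.
move=> e0 d0 sL.
have cv : (fun h : R => h^-1 *: (s (h *: 1 + 0) - s 0)) @ 0^' --> L.
  apply/cvgrPdist_le => /= eps eps0.
  pose x := eps / (`|c| + 1); have x0 : 0 < x by rewrite divr_gt0// ltr_wpDl.
  pose del := x `^ e^-1; have del0 : 0 < del by rewrite powR_gt0.
  near=> h.
  have h0 : h != 0 by near: h; exact: nbhs_dnbhs_neq.
  have hd : `|h| < d by near: h; exact: dnbhs0_lt.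
  have hdel : `|h| < del by near: h; exact: dnbhs0_lt.
  have nh : 0 < `|h| by rewrite normr_gt0.
  have -> : L - h^-1 *: (s (h *: 1 + 0) - s 0) = - (h^-1 * (s h - s 0 - h * L)).
    by rewrite /GRing.scale/= mulr1 addr0; field.
  rewrite normrN normrM normfV ler_pdivrMl//.
  apply: le_trans (sL h hd) _.
  rewrite powRD; last by rewrite (gt_eqF nh) implybT.
  rewrite powRr1// mulrCA ler_pM2l//.
  have hx : `|h| `^ e <= x.
    rewrite -[x]powRr1 ?(ltW x0)// -(mulVf (lt0r_neq0 e0)) powRrM.
    by apply: ge0_ler_powR; rewrite ?nnegrE ?(ltW e0) ?(ltW del0) ?(ltW hdel).
  apply: (@le_trans _ _ (`|c| * x)).
    apply: (@le_trans _ _ (`|c| * `|h| `^ e)).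
      by rewrite ler_wpM2r ?powR_ge0// ler_norm.
    by rewrite ler_wpM2l.
  by rewrite /x mulrCA ler_piMr ?(ltW eps0)// ler_pdivrMr ?ltr_wpDl// mul1r lerDl.
split; first by apply: cvgP cv.
by rewrite derive1E; apply: cvg_lim cv.
Unshelve. all: end_near. Qed.

Lemma cabs_pdir (b : bool) : cabs (pdir R b) = 1.
Proof. by case: b; rewrite /pdir ?cabs_i ?cabs1. Qed.

Lemma wdiff_pderiv F z A B (b : bool) : wdiff F z A B ->
  pderivable b F z /\ pderiv b F z = A * pdir R b + B * (pdir R b)^*%C.
Proof.
move=> [c [e [d [/andP[e0 _] /andP[d0 _] c0 FE]]]].
set L := A * pdir R b + B * (pdir R b)^*%C.
have est t : `|t| < d ->
    cabs (F (z + t%:C * pdir R b) - F z - t%:C * L) <= c * `|t| `^ (1 + e).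
  move=> td; have tv : cabs (t%:C * pdir R b) = `|t|.
    by rewrite cabsM cabs_real cabs_pdir mulr1.
  have := FE (t%:C * pdir R b); rewrite tv => /(_ td).
  by congr (cabs (_ - _) <= _); rewrite /L conj_realM; ring.
have z0 : z + 0%:C * pdir R b = z by rewrite mul0r addr0.
have ReE (X Y W : C) t : complex.Re (X - Y - t%:C * W) =
    complex.Re X - complex.Re Y - t * complex.Re W.
  by case: X Y W => [a1 a2] [b1 b2] [l1 l2] /=; ring.
have ImE (X Y W : C) t : complex.Im (X - Y - t%:C * W) =
    complex.Im X - complex.Im Y - t * complex.Im W.
  by case: X Y W => [a1 a2] [b1 b2] [l1 l2] /=; ring.
have [dR LR] : derivable (slice_Re F b z) 0 1 /\
    derive1 (slice_Re F b z) 0 = complex.Re L.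
  apply: (slice_derivative (c := c) e0 d0) => t td.
  apply: le_trans (est t td); rewrite /slice_Re z0.
  by rewrite -ReE; exact: Re_le_cabs.
have [dI LI] : derivable (slice_Im F b z) 0 1 /\
    derive1 (slice_Im F b z) 0 = complex.Im L.
  apply: (slice_derivative (c := c) e0 d0) => t td.
  apply: le_trans (est t td); rewrite /slice_Im z0.
  by rewrite -ImE; exact: Im_le_cabs.
by split => //; rewrite /pderiv LR LI complex_eta.
Qed.

Lemma pderiv_local F G z r (b : bool) : 0 < r ->
  (forall w, cabs (w - z) < r -> F w = G w) -> pderiv b F z = pderiv b G z /\
  (pderivable b G z -> pderivable b F z).
Proof.
move=> r0 FG.
have nr : \forall t \near (0:R^o), F (z + t%:C * pdir R b) = G (z + t%:C * pdir R b).
  near=> t; apply: FG; rewrite addrC addKr cabsM cabs_real cabs_pdir mulr1.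
  near: t; exact: (@nbhs0_lt _ R^o).
have nR : {near (0:R^o), slice_Re F b z =1 slice_Re G b z}.
  by near=> t; rewrite /slice_Re; congr complex.Re; near: t.
have nI : {near (0:R^o), slice_Im F b z =1 slice_Im G b z}.
  by near=> t; rewrite /slice_Im; congr complex.Im; near: t.
split.
  by rewrite /pderiv !derive1E (near_eq_derive _ nR) (near_eq_derive _ nI).
move=> [gR gI]; split.
  by apply: near_eq_derivable gR; apply: filterS nR => t ->.
by apply: near_eq_derivable gI; apply: filterS nI => t ->.
Unshelve. all: end_near. Qed.

End Wirtinger.

(** * Derivatives of potentials *)

Section PotentialDerivatives.
Variable R : realType.
Local Notation C := R[i].
Implicit Types (F G g k A B : C -> C) (z w h : C) (r M c alpha : R).

(** Differentiation under the integral sign: a remainder of the size of the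
hypothesis integrates to [O(|h| ^ (1 + alpha / 2))] by interpolation. *)
Lemma wdiff_convolution r c alpha k A B g z : 0 < r -> cabs z < r ->
  0 < alpha -> alpha <= 1 -> 0 <= c ->
  (forall w, cabs w <= r -> pintegrable (fun v => k (v - w) * g v)) ->
  pintegrable (fun v => A (v - z) * g v) -> pintegrable (fun v => B (v - z) * g v) ->
  (forall v, r < cabs v -> g v = 0) ->
  (forall h v, v - z != 0 -> v - z - h != 0 -> cabs v <= r -> cabs (z + h) <= r ->
    cabs ((k (v - z - h) - k (v - z) - (h * A (v - z) - h^*%C * B (v - z))) * g v) <=
    c * (cabs h ^+ 2 * (cabs (v - z))^-1 ^+ 2 * (cabs (v - z - h))^-1 *
      cabs (v - z) `^ alpha)) ->
  wdiff (fun w => pint (fun v => k (v - w) * g v)) z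
    (pint (fun v => A (v - z) * g v)) (- pint (fun v => B (v - z) * g v)).
Proof.
move=> r0 zr al0 al1 c0 ik iA iB g0 kE.
exists (c * 2 * sing_mass r (alpha / 2)), (alpha / 2), (Num.min (r - cabs z) 1).
have b0 : 0 < alpha / 2 by rewrite divr_gt0.
split.
- by rewrite b0 /=; lra.
- by rewrite lt_min subr_gt0 zr ltr01 ge_min lexx orbT.
- by rewrite mulr_ge0 ?sing_mass_ge0// mulr_ge0.
move=> h; rewrite lt_min => /andP[hr _].
have zh : cabs (z + h) <= r by apply: le_trans (cabsD _ _) _; lra.
have zr' := ltW zr.
have E v : k (v - (z + h)) * g v - k (v - z) * g v -
    (h * (A (v - z) * g v) - h^*%C * (B (v - z) * g v)) =
    (k (v - z - h) - k (v - z) - (h * A (v - z) - h^*%C * B (v - z))) * g v.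
  by rewrite opprD addrA; ring.
have i1 : pintegrable (fun v => k (v - (z + h)) * g v - k (v - z) * g v).
  by apply: pintegrableB; exact: ik.
have i2 : pintegrable (fun v => h * (A (v - z) * g v) - h^*%C * (B (v - z) * g v)).
  by apply: pintegrableB; exact: pintegrableZ.
rewrite (_ : _ - _ = pint (fun v =>
    (k (v - z - h) - k (v - z) - (h * A (v - z) - h^*%C * B (v - z))) * g v)); last first.
  under [RHS]eq_pint do rewrite -E.
  rewrite pintB// pintB; [|exact: ik|exact: ik].
  rewrite pintB; [|exact: pintegrableZ|exact: pintegrableZ].
  by rewrite !pintZ//; ring.
have mF : pmeasurable (fun v =>
    (k (v - z - h) - k (v - z) - (h * A (v - z) - h^*%C * B (v - z))) * g v).
  by rewrite -(funext E); exact: cintegrable_measurable (pintegrableB i1 i2).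
have P0 : 0 <= c * (2 * cabs h `^ (1 + alpha / 2)).
  by rewrite mulr_ge0// mulr_ge0// powR_ge0.
have F0 v : r < cabs v ->
    (k (v - z - h) - k (v - z) - (h * A (v - z) - h^*%C * B (v - z))) * g v = 0.
  by move=> rv; rewrite g0// mulr0.
rewrite (_ : c * 2 * _ * _ =
   (c * (2 * cabs h `^ (1 + alpha / 2))) * sing_mass r (alpha / 2)); last by ring.
apply: (weak_singular_pair r0 b0 P0 mF zr' zh F0 _).2.
move=> v vz vzh vr.
have uz : v - z != 0 by rewrite subr_eq0.
have uzh : v - z - h != 0 by rewrite -addrA -opprD subr_eq0.
apply: le_trans (kE h v uz uzh vr zh) _.
rewrite -[leRHS]mulrA ler_wpM2l//.
have -> : v - (z + h) = v - z - h by rewrite opprD addrA.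
apply: two_pole_interpolation => //; rewrite ?cabs_gt0 ?cabs_ge0//.
by rewrite -{1}[h](subKr (v - z)); exact: cabsB.
Qed.

Lemma pintegrable_kern_holder r alpha L p q g z : 0 < r -> cabs z <= r ->
  0 < alpha -> 0 <= L -> pmeasurable g -> (forall v, r < cabs v -> g v = 0) ->
  (forall v, cabs v <= r -> cabs (g v) <= L * cabs (v - z) `^ alpha) ->
  (q = p.+2) -> pintegrable (fun v => kern p q (v - z) * g v).
Proof.
move=> r0 zr al0 L0 mg g0 gL qE.
apply: (weak_singular (z := z) (b := alpha) (c := L) r0 al0 L0 _ zr _ _).1.
- by apply: pmeasurableM => //; exact: pmeasurable_kern.
- by move=> v rv; rewrite g0// mulr0.
move=> v vz vr; have m0 : cabs (v - z) != 0 by rewrite cabs_eq0 subr_eq0.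
have -> : cabs (v - z) `^ (alpha - 2) = (cabs (v - z))^-1 ^+ 2 * cabs (v - z) `^ alpha.
  have -> : alpha - 2 = - 2 + alpha by ring.
  rewrite powRD; last by rewrite m0 implybT.
  by rewrite powRN powR_mulrn ?cabs_ge0// exprVn.
rewrite mulrCA; apply: cabsM_le; last exact: gL.
rewrite qE /kern cabsM cabsV !cabsX cabs_conj exprVn.
by rewrite le_eqVlt; apply/orP; left; apply/eqP; rewrite -addn2 exprD; field;
  rewrite m0 expf_neq0.
Qed.

Lemma wdiff_potential r M p q g z : 0 < r -> cabs z < r -> weight r M g ->
  (0 < q <= p)%N ->
  wdiff (potential p q g) z (q%:R * potential p q.+1 g z)
    (- (p%:R * potential p.-1 q g z)).
Proof.
move=> r0 zr wg /andP[q0 qp]; have [mg gM g0] := wg.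
have M0 : 0 <= M by exact: le_trans (cabs_ge0 _) (gM 0).
have zr' := ltW zr.
have [c c0 kc] := @bounded_kern R p q (2 * r) (introT andP (conj q0 qp)) (mulr_gt0 (ltr0Sn _ 1) r0).
have p0 : (0 < p)%N by exact: leq_trans qp.
have i1 : pintegrable (fun v => kern p q.+1 (v - z) * g v).
  by apply: (pintegrable_potential r0 wg).
have i2 : pintegrable (fun v => kern p.-1 q (v - z) * g v).
  by apply: (pintegrable_potential r0 wg) => //; rewrite prednK.
have := @wdiff_convolution r (c * M) 1 (kern p q) (fun u => q%:R * kern p q.+1 u)
  (fun u => p%:R * kern p.-1 q u) g z r0 zr ltr01 (lexx _).
rewrite mulr_ge0// => /(_ isT).
have E (a : C) f : pintegrable (fun v => f (v - z) * g v) ->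
    pintegrable (fun v => a * f (v - z) * g v) /\
    pint (fun v => a * f (v - z) * g v) = a * pint (fun v => f (v - z) * g v).
  move=> i; have -> : (fun v => a * f (v - z) * g v) = (fun v => a * (f (v - z) * g v)).
    by apply/funext => v; rewrite mulrA.
  by split; [exact: pintegrableZ|rewrite pintZ].
have [j1 ->] := E q%:R _ i1; have [j2 ->] := E p%:R _ i2.
apply => //.
  by move=> w wr; apply: (pintegrable_potential r0 wg) => //; rewrite leqW.
move=> h v uz uzh vr zh.
have vz2 : cabs (v - z) <= 2 * r by exact: cabs_sub_disk.
have vzh2 : cabs (v - z - h) <= 2 * r.
  by rewrite -addrA -opprD; exact: cabs_sub_disk.
have [_ _ kE] := kc (v - z) h uz uzh vz2 vzh2.
apply: le_trans (cabsM_le kE (gM v)) _ => /=.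
have m0 : cabs (v - z) != 0 by rewrite cabs_eq0.
rewrite powRr1 ?cabs_ge0// le_eqVlt; apply/orP; left; apply/eqP.
by move: (cabs (v - z - h))^-1 => m'; field.
Qed.

(** The kernels of the derivatives have degree [-2] and are not integrable; the vanishing of
[g] at [z] makes up for it. *)
Lemma wdiff_potential_vanishing r alpha L p g z : 0 < r -> cabs z < r ->
  0 < alpha -> alpha <= 1 -> 0 <= L -> pmeasurable g ->
  (forall v, r < cabs v -> g v = 0) ->
  (exists M, forall v, cabs (g v) <= M) ->
  (forall v, cabs v <= r -> cabs (g v) <= L * cabs (v - z) `^ alpha) ->
  wdiff (potential p p.+1 g) z (p.+1%:R * potential p p.+2 g z)
    (- (p%:R * potential p.-1 p.+1 g z)).
Proof.
move=> r0 zr al0 al1 L0 mg g0 [M gM] gL.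
have wg : weight r M g by [].
have M0 : 0 <= M by exact: le_trans (cabs_ge0 _) (gM 0).
have zr' := ltW zr.
have [c c0 kc] := @singular_kern R p.
have i1 : pintegrable (fun v => kern p p.+2 (v - z) * g v).
  exact: pintegrable_kern_holder al0 L0 mg g0 gL _.
have i2 : pintegrable (fun v => kern p.-1 p.+1 (v - z) * g v).
  case: (p) => [|n]; first exact: (pintegrable_potential r0 wg).
  exact: pintegrable_kern_holder al0 L0 mg g0 gL _.
have := @wdiff_convolution r (c * L) alpha (kern p p.+1) (fun u => p.+1%:R * kern p p.+2 u)
  (fun u => p%:R * kern p.-1 p.+1 u) g z r0 zr al0 al1.
rewrite mulr_ge0// => /(_ isT).
have E (a : C) f : pintegrable (fun v => f (v - z) * g v) ->
    pintegrable (fun v => a * f (v - z) * g v) /\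
    pint (fun v => a * f (v - z) * g v) = a * pint (fun v => f (v - z) * g v).
  move=> i; have -> : (fun v => a * f (v - z) * g v) = (fun v => a * (f (v - z) * g v)).
    by apply/funext => v; rewrite mulrA.
  by split; [exact: pintegrableZ|rewrite pintZ].
have [j1 ->] := E p.+1%:R _ i1; have [j2 ->] := E p%:R _ i2.
apply => //.
  by move=> w wr; apply: (pintegrable_potential r0 wg).
move=> h v uz uzh vr zh.
have [_ _ kE] := kc (v - z) h uz uzh.
apply: le_trans (cabsM_le kE (gL v vr)) _ => /=.
by rewrite le_eqVlt; apply/orP; left; apply/eqP; ring.
Qed.

(** A Cauchy integral of the polynomial [conj (v - z) ^ p]: a power of [conj z]. *)
Lemma potential_disk_pole1 r p z : 0 < r -> cabs z <= r ->
  potential p 1 (@disk_ind R r) z = ((pi : R)%:C * (-1) ^+ p.+1 / p.+1%:R) * z^*%C ^+ p.+1.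
Proof.
move=> r0 zr; have [P PE P'E] := kern_poly z^*%C p.
have [iP EP] := pint_cauchy_poly P r0 zr.
transitivity ((-1) ^+ p * pint (fun w => disk_ind r w * (P^`().[w^*%C] / (w - z)))).
  rewrite -pintZ//; apply: eq_pint => w; rewrite P'E /kern expr1 rmorphB /=.
  rewrite -[w^*%C - z^*%C]opprB (exprNn (z^*%C - w^*%C)); ring.
rewrite EP !PE subrr subr0 expr0n/= oppr0 mul0r [(-1) ^+ p.+1]exprS.
have pp : p.+1%:R != 0 :> C by rewrite pnatr_eq0.
by move: (p.+1%:R) pp ((-1) ^+ p) (z^*%C ^+ p.+1) => y y0 e f; field.
Qed.

(** The potential with a simple pole is antiholomorphic, so its derivative along [z], which
is [potential p 2], vanishes; and so on by differentiating zero. *)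
Lemma potential_disk_eq0 r p q z : 0 < r -> cabs z < r -> (q < p)%N ->
  potential p q.+2 (@disk_ind R r) z = 0.
Proof.
move=> r0; have wd := weight_disk_ind r.
elim: q z => [|q IH] z zr qp.
  have := @wdiff_potential r 1 p 1 _ z r0 zr wd; rewrite qp => /(_ isT) d1.
  set a : C := (pi : R)%:C * (-1) ^+ p.+1 / p.+1%:R.
  have d2 : wdiff (potential p 1 (@disk_ind R r)) z 0 (a * (p.+1%:R * z^*%C ^+ p)).
    rewrite -(mulr0 a); apply: (wdiff_local _ _ (wdiffZ a (wdiff_conjX z p.+1)) (r := r - cabs z)).
      by rewrite subr_gt0; exact: zr.
    move=> w wz; rewrite potential_disk_pole1//.
    by have := cabsD (w - z) z; rewrite subrK; lra.
  by have [] := wdiff_unique d1 d2; rewrite mul1r.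
have := @wdiff_potential r 1 p q.+2 _ z r0 zr wd; rewrite /= qp => /(_ isT) d1.
have d2 : wdiff (potential p q.+2 (@disk_ind R r)) z 0 0.
  apply: (wdiff_local _ _ (wdiff_cst z 0) (r := r - cabs z)) => [|w wz].
    by rewrite subr_gt0; exact: zr.
  rewrite IH//; last exact: ltnW.
  by have := cabsD (w - z) z; rewrite subrK; lra.
have [/eqP + _] := wdiff_unique d1 d2.
by rewrite mulf_eq0 pnatr_eq0/= => /eqP.
Qed.

End PotentialDerivatives.

(** * Hoelder functions on the disk *)

Section HolderWeights.
Variable R : realType.
Local Notation C := R[i].
Local Notation RR := (measurableTypeR R * measurableTypeR R)%type.
Local Notation toC := (@toC R).
Implicit Types (f g : C -> C) (z w : C) (r L alpha : R).

Definition holder_const r alpha L f := 0 <= L /\ forall z w, cabs z <= r ->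
  cabs w <= r -> cabs (f z - f w) <= L * cabs (z - w) `^ alpha.

Lemma holderP r alpha f : holder r alpha f <-> exists L, holder_const r alpha L f.
Proof.
split=> [[L Lub]|[L [L0 fL]]].
  exists (Num.max 0 L); split; first by rewrite le_max lexx.
  move=> z w zr wr; have [->|zw] := eqVneq z w.
    by rewrite !subrr cabs0 mulr_ge0 ?powR_ge0// le_max lexx.
  have d0 : 0 < cabs (z - w) `^ alpha by rewrite powR_gt0// cabs_gt0 subr_eq0.
  rewrite -ler_pdivrMr//; apply: (@le_trans _ _ L); last by rewrite le_max lexx orbT.
  by apply: Lub; exists z, w.
exists L => _ [z [w [zr wr zw ->]]].
by rewrite ler_pdivrMr ?fL// powR_gt0// cabs_gt0 subr_eq0.
Qed.

(** There are countably many cells on which the two integer parts are constant. *)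
Lemma measurable_floor_pair (N : R) (Phi : int -> int -> R) :
  measurable_fun setT (fun p : RR => Phi (Num.floor (N * p.1)) (Num.floor (N * p.2))).
Proof.
move=> _ Y mY; rewrite setTI.
have mcell (i : int) : measurable [set x : measurableTypeR R | Num.floor (N * x) = i].
  have -> : [set x : measurableTypeR R | Num.floor (N * x) = i] =
      setT `&` ( *%R N) @^-1` `[i%:~R, (i + 1)%:~R[%classic.
    apply/seteqP; split => x /=.
      by move=> <-; split => //=; rewrite in_itv/=; exact: floor_itv.
    by move=> [_]; rewrite in_itv/= => /floor_def.
  exact: (@mulrl_measurable R setT N).
have -> : (fun p : RR => Phi (Num.floor (N * p.1)) (Num.floor (N * p.2))) @^-1` Y =
  \bigcup_(ij in [set: int * int]) (if `[< Y (Phi ij.1 ij.2) >] then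
    [set x : measurableTypeR R | Num.floor (N * x) = ij.1] `*`
    [set x : measurableTypeR R | Num.floor (N * x) = ij.2] else set0).
  apply/seteqP; split => [[x y] /= Yxy|[x y] [[i j] _] /=].
    exists (Num.floor (N * x), Num.floor (N * y)) => //=.
    by case: asboolP.
  by case: asboolP => // Yij [/= -> ->].
apply: countable_bigcupT_measurable; first exact: countableP.
by move=> ij; case: ifP => // _; exact: measurableX.
Qed.

(** The radial retraction onto the disk moves [w] by its distance to the disk, at most its
distance to [z]. *)
Lemma retract_near r z w : 0 < r -> cabs z <= r ->
  let v := if cabs w <= r then w else (r / cabs w)%:C * w in
  cabs v <= r /\ cabs (v - z) <= 2 * cabs (w - z).
Proof.
move=> r0 zr v; rewrite /v; case: (leP (cabs w) r) => wr.
  by split; rewrite // ler_peMl ?cabs_ge0// ler1n.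
have w0 : 0 < cabs w by exact: lt_trans wr.
have q0 : 0 <= r / cabs w by rewrite divr_ge0 ?ltW.
split; first by rewrite cabsM cabs_real ger0_norm// divfK// gt_eqF.
have wv : cabs ((r / cabs w)%:C * w - w) = cabs w - r.
  have -> : (r / cabs w)%:C * w - w = (r / cabs w - 1)%:C * w.
    by rewrite rmorphB rmorph1 mulrBl mul1r.
  rewrite cabsM cabs_real.
  rewrite distrC ger0_norm; last by rewrite subr_ge0 ler_pdivrMr// mul1r ltW.
  by rewrite mulrBl mul1r divfK// gt_eqF.
have t1 := cabs_triangle ((r / cabs w)%:C * w) w z.
have t2 := cabsD (w - z) z; rewrite subrK in t2.
rewrite wv in t1; lra.
Qed.

(** A Hoelder function on the closed disk is there a limit of step functions on finer and
finer grids, where a grid point lying outside the disk is first retracted onto it. *)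
Lemma measurable_holder_cut r alpha L (u : C -> R) : 0 < r -> 0 < alpha -> 0 <= L ->
  (forall z w, cabs z <= r -> cabs w <= r ->
     `|u z - u w| <= L * cabs (z - w) `^ alpha) ->
  measurable_fun setT (fun p : RR => if cabs (toC p) <= r then u (toC p) else 0).
Proof.
move=> r0 al0 L0 uL.
pose rho w : C := if cabs w <= r then w else (r / cabs w)%:C * w.
(* [rho] sends the grid points back into the disk, where [u] is controlled. *)
pose grid (n : nat) (i j : int) : C := (i%:~R / n.+1%:R) +i* (j%:~R / n.+1%:R).
pose h n (p : RR) := if cabs (toC p) <= r then
   u (rho (grid n (Num.floor (n.+1%:R * p.1)) (Num.floor (n.+1%:R * p.2)))) else 0.
have mb : measurable_fun setT (fun p : RR => cabs (toC p) <= r).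
  by apply: measurable_fun_ler => //; apply: measurable_cabs; exact: cmeasurable_toC.
apply: (@measurable_fun_cvg _ _ _ _ h).
  move=> n; apply: measurable_fun_ifT => //.
  exact: (measurable_floor_pair n.+1%:R (fun i j => u (rho (grid n i j)))).
move=> [x y] _; rewrite /h; case: ifP => pr; last exact: cvg_cst.
apply/cvgrPdist_le => /= eps eps0.
pose X := eps / (L + 1); have X0 : 0 < X by rewrite divr_gt0// ltr_wpDl.
pose del := X `^ alpha^-1; have del0 : 0 < del by rewrite powR_gt0.
have near_n : \forall n \near \oo, del^-1 * 4 < n.+1%:R.
  near=> n; apply: (@lt_trans _ _ n%:R); last by rewrite ltr_nat.
  by near: n; exact: nbhs_infty_gtr.
near=> n; set w := grid _ _ _.
have N0 : 0 < n.+1%:R :> R by [].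
have cell (t : R) : `|(Num.floor (n.+1%:R * t))%:~R / n.+1%:R - t| <= n.+1%:R^-1.
  have /andP[] := floor_itv (n.+1%:R * t); rewrite intrD.
  set F := (Num.floor _)%:~R => f1 f2.
  have -> : F / n.+1%:R - t = - ((n.+1%:R * t - F) / n.+1%:R).
    by field; rewrite gt_eqF.
  rewrite normrN ger0_norm; last by rewrite divr_ge0// subr_ge0.
  by rewrite ler_pdivrMr// mulVf ?gt_eqF// lerBlDl ltW.
have wz : cabs (w - toC (x, y)) <= 2 / n.+1%:R.
  apply: le_trans (cabs_le_ReIm _) _ => /=.
  by rewrite mulr2n mulrDl mul1r lerD//; exact: cell.
have [vr vz] := retract_near w r0 pr; rewrite -/(rho w) in vr vz.
rewrite distrC; apply: le_trans (uL _ _ vr pr) _.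
have vz' : cabs (rho w - toC (x, y)) <= del.
  apply: le_trans vz _; apply: (@le_trans _ _ (4 / n.+1%:R)).
    by rewrite (_ : 4 / _ = 2 * (2 / n.+1%:R)) ?ler_wpM2l//; ring.
  by rewrite ler_pdivrMr// -ler_pdivrMl// ltW//; near: n; exact: near_n.
apply: (@le_trans _ _ (L * X)).
  rewrite ler_wpM2l// -[X]powRr1 ?(ltW X0)// -(mulVf (lt0r_neq0 al0)) powRrM.
  by apply: ge0_ler_powR; rewrite ?nnegrE ?(ltW al0) ?(ltW del0) ?cabs_ge0.
by rewrite /X mulrCA ler_piMr ?(ltW eps0)// ler_pdivrMr ?ltr_wpDl// mul1r lerDl.
Unshelve. all: end_near. Qed.

Lemma holder_const_Re r alpha L f : holder_const r alpha L f ->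
  forall z w, cabs z <= r -> cabs w <= r ->
     `|complex.Re (f z) - complex.Re (f w)| <= L * cabs (z - w) `^ alpha.
Proof.
move=> [_ fL] z w zr wr; apply: le_trans (fL z w zr wr).
by apply: le_trans (Re_le_cabs _); case: (f z) (f w) => [a b] [].
Qed.

Lemma holder_const_Im r alpha L f : holder_const r alpha L f ->
  forall z w, cabs z <= r -> cabs w <= r ->
     `|complex.Im (f z) - complex.Im (f w)| <= L * cabs (z - w) `^ alpha.
Proof.
move=> [_ fL] z w zr wr; apply: le_trans (fL z w zr wr).
by apply: le_trans (Im_le_cabs _); case: (f z) (f w) => [a b] [].
Qed.

Lemma weight_holder r alpha L f : 0 < r -> 0 < alpha -> holder_const r alpha L f ->
  weight r (cabs (f 0) + L * r `^ alpha) (fun v => disk_ind r v * f v).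
Proof.
move=> r0 al0 fL; have L0 := fL.1.
have M0 : 0 <= cabs (f 0) + L * r `^ alpha.
  by rewrite addr_ge0 ?cabs_ge0// mulr_ge0 ?powR_ge0.
split.
- have mR := measurable_holder_cut r0 al0 L0 (holder_const_Re fL).
  have mI := measurable_holder_cut r0 al0 L0 (holder_const_Im fL).
  split; [move: mR|move: mI]; congr measurable_fun; apply/funext => p;
    by rewrite /disk_ind; case: ifP => _; rewrite ?mul1r ?mul0r.
- move=> z; have [zr|rz] := leP (cabs z) r; last by rewrite disk_ind0// mul0r cabs0.
  rewrite disk_ind1// mul1r -[f z](subrK (f 0)) addrC; apply: cabsD_le => //.
  have c0 : cabs (0 : C) <= r by rewrite cabs0 ltW.
  apply: le_trans (fL.2 z 0 zr c0) _; rewrite ler_wpM2l// subr0.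
  by apply: (ge0_ler_powR (ltW al0)) => //; rewrite nnegrE ?cabs_ge0// ltW.
- by move=> z rz; rewrite disk_ind0// mul0r.
Qed.

End HolderWeights.

(** * Singular integrals of degree -2 *)

Section Beurling.
Variable R : realType.
Local Notation C := R[i].
Implicit Types (f g : C -> C) (z w : C) (r L alpha : R) (p : nat).

(** The principal value of [int kern p p.+2 (v - z) * f v], regularized by
subtracting [f z]: the kernel has principal value zero on the disk. *)
Definition beurling r p f z : C :=
  pint (fun v => kern p p.+2 (v - z) * (disk_ind r v * (f v - f z))).

Lemma pmeasurable_increment r alpha L f z : 0 < r -> 0 < alpha ->
  holder_const r alpha L f -> pmeasurable (fun v => disk_ind r v * (f v - f z)).
Proof.
move=> r0 al0 fL; have [mg _ _] := weight_holder r0 al0 fL.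
have -> : (fun v => disk_ind r v * (f v - f z)) =
    (fun v => disk_ind r v * f v - disk_ind r v * f z).
  by apply/funext => v; rewrite mulrBr.
apply: pmeasurableB => //; apply: pmeasurableM; last exact: pmeasurable_cst.
exact: pmeasurable_disk_ind.
Qed.

Lemma increment_outside r f z v : r < cabs v -> disk_ind r v * (f v - f z) = 0.
Proof. by move=> rv; rewrite disk_ind0// mul0r. Qed.

Lemma increment_le r alpha L f z v : holder_const r alpha L f -> cabs z <= r ->
  cabs v <= r -> cabs (disk_ind r v * (f v - f z)) <= L * cabs (v - z) `^ alpha.
Proof. by move=> fL zr vr; rewrite disk_ind1// mul1r; apply: fL.2. Qed.

Lemma pintegrable_beurling r alpha L p f z : 0 < r -> 0 < alpha ->
  holder_const r alpha L f -> cabs z <= r ->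
  pintegrable (fun v => kern p p.+2 (v - z) * (disk_ind r v * (f v - f z))).
Proof.
move=> r0 al0 fL zr; apply: (pintegrable_kern_holder r0 zr al0 fL.1) => //.
- exact: pmeasurable_increment fL.
- by move=> v rv; exact: increment_outside.
- by move=> v vr; exact: increment_le.
Qed.

(** The term [- pi] is the delta function in the derivative of [1 / u] along [conj u]; for
[p > 0] the potential vanishes inside the disk by [potential_disk_eq0]. *)
Lemma wdiff_potential_disk r p z : 0 < r -> cabs z < r ->
  wdiff (potential p p.+1 (@disk_ind R r)) z 0 (if p is 0 then - (pi : R)%:C else 0).
Proof.
move=> r0 zr; have rz : 0 < r - cabs z by rewrite subr_gt0.
have near w : cabs (w - z) < r - cabs z -> cabs w < r.
  by have := cabsD (w - z) z; rewrite subrK; lra.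
case: p => [|p].
  have := wdiffZ (- (pi : R)%:C) (wdiff_conjX z 1).
  rewrite mulr0 mul1r expr0 mulr1; apply: wdiff_local rz _ => w /near/ltW wr.
  by rewrite potential_disk_pole1// expr1 divr1 mulrN1.
apply: (wdiff_local rz _ (wdiff_cst z 0)) => w /near wr.
by rewrite potential_disk_eq0.
Qed.

(** Splitting [f] as an increment vanishing at [z] plus the constant [f z]; the
potential of a constant is explicit. *)
Lemma wdiff_potential_holder r alpha L p f z : 0 < r -> 0 < alpha -> alpha <= 1 ->
  holder_const r alpha L f -> cabs z < r ->
  wdiff (potential p p.+1 (fun v => disk_ind r v * f v)) z
    (p.+1%:R * beurling r p f z)
    (if p is p'.+1 then - (p%:R * beurling r p' f z) else - (pi : R)%:C * f z).
Proof.
move=> r0 al0 al1 fL zr; have wg := weight_holder r0 al0 fL.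
pose h v := disk_ind r v * (f v - f z).
have mh : pmeasurable h by exact: pmeasurable_increment fL.
have h0 v : r < cabs v -> h v = 0 by exact: increment_outside.
have hL v : cabs v <= r -> cabs (h v) <= L * cabs (v - z) `^ alpha.
  by move=> vr; apply: increment_le => //; exact: ltW.
have hM : exists M, forall v, cabs (h v) <= M.
  exists (L * (2 * r) `^ alpha) => v; have [vr|rv] := leP (cabs v) r; last first.
    by rewrite h0// cabs0 mulr_ge0 ?powR_ge0// fL.1.
  apply: le_trans (hL v vr) _; rewrite ler_wpM2l ?fL.1//.
  apply: (ge0_ler_powR (ltW al0)); rewrite ?nnegrE ?cabs_ge0//.
    by rewrite mulr_ge0// ltW.
  by apply: cabs_sub_disk => //; exact: ltW.
have [M hM'] := hM; have wh : weight r M h by [].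
have d1 := wdiff_potential_vanishing p r0 zr al0 al1 fL.1 mh h0 hM hL.
have d2 := wdiffZ (f z) (wdiff_potential_disk p r0 zr).
have rz : 0 < r - cabs z by rewrite subr_gt0.
have := wdiffD d1 d2; rewrite mulr0 addr0.
have -> : - (p%:R * potential p.-1 p.+1 h z) +
     f z * (if p is 0 then - (pi : R)%:C else 0) =
   if p is p'.+1 then - (p%:R * beurling r p' f z) else - (pi : R)%:C * f z.
  by case: (p) => [|p']; rewrite ?mul0r ?oppr0 ?add0r ?mulr0 ?addr0// mulrC.
apply: wdiff_local rz _ => w wz.
have wr : cabs w <= r by have := cabsD (w - z) z; rewrite subrK; lra.
have iw : pintegrable (fun v => kern p p.+1 (v - w) * disk_ind r v).
  by apply: (pintegrable_potential r0 (weight_disk_ind r)).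
rewrite /potential -pintZ// -pintD; last 2 first.
- by apply: (pintegrable_potential r0 wh).
- exact: pintegrableZ.
by apply: eq_pint => v; rewrite /h; ring.
Qed.

Lemma potential_translate p q g (c z : C) : pmeasurable g ->
  pintegrable (fun v => kern p q (v - c - z) * g (v - c)) ->
  potential p q (fun v => g (v - c)) (c + z) = potential p q g z.
Proof.
move=> mg i; rewrite /potential.
have E : (fun v => kern p q (v - (c + z)) * g (v - c)) =
   (fun v => kern p q (v - c - z) * g (v - c)).
  by apply/funext => v; rewrite opprD addrA.
rewrite E; apply: (pint_translate (F := fun v => kern p q (v - z) * g v) (z := - c)) => //.
by apply: pmeasurableM => //; exact: pmeasurable_kern.
Qed.

(** Near [c] the potentials of the indicators of the two disks differ by a constant, and the
integral is, up to the factor [p.+1], the derivative at [c] of that difference. *)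
Lemma pint_kern_complement_eq0 r eta p c : 0 < r -> 0 < eta -> cabs c + eta <= r ->
  pintegrable (fun v => kern p p.+2 (v - c) * (disk_ind r v - disk_ind eta (v - c))) /\
  pint (fun v => kern p p.+2 (v - c) * (disk_ind r v - disk_ind eta (v - c))) = 0.
Proof.
move=> r0 eta0 cr; pose g v : C := disk_ind r v - disk_ind eta (v - c).
have cr' : cabs c < r by apply: lt_le_trans cr; rewrite ltrDl.
have in_r v : cabs (v - c) <= eta -> cabs v <= r.
  by have := cabsD (v - c) c; rewrite subrK; lra.
have meta : pmeasurable (fun v => disk_ind eta (v - c)).
  exact: (pmeasurable_if_le eta c (pmeasurable_cst 1) (pmeasurable_cst 0)).
have mg : pmeasurable g by apply: pmeasurableB => //; exact: pmeasurable_disk_ind.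
have g0 v : r < cabs v -> g v = 0.
  move=> rv; rewrite /g disk_ind0// disk_ind0 ?subrr// ltNge.
  by apply/negP => /in_r; rewrite leNgt rv.
have gin v : cabs (v - c) <= eta -> g v = 0.
  by move=> vc; rewrite /g !disk_ind1 ?subrr//; exact: in_r.
have g1 v : cabs (g v) <= 1.
  rewrite /g; have [vc|vc] := leP (cabs (v - c)) eta.
    by rewrite !disk_ind1 ?subrr ?cabs0//; exact: in_r.
  rewrite [disk_ind eta _]disk_ind0// subr0 /disk_ind.
  by case: ifP; rewrite ?cabs0 ?cabs1.
have gL v : cabs v <= r -> cabs (g v) <= eta^-1 * cabs (v - c) `^ 1.
  move=> vr; rewrite powRr1 ?cabs_ge0//; have [vc|vc] := leP (cabs (v - c)) eta.
    by rewrite gin// cabs0 mulr_ge0 ?cabs_ge0// invr_ge0 ltW.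
  apply: le_trans (g1 v) _; rewrite mulrC ler_pdivlMr// mul1r; exact: ltW.
have eta1 : 0 <= eta^-1 by rewrite invr_ge0 ltW.
split; first exact: (pintegrable_kern_holder r0 (ltW cr') ltr01 eta1 mg g0 gL).
have d1 := wdiff_potential_vanishing p r0 cr' ltr01 (lexx 1) eta1 mg g0 (ex_intro _ 1 g1) gL.
pose K : C := if p is 0 then - ((pi : R)%:C * c^*%C) else 0.
have weta : weight r 1 (fun v => disk_ind eta (v - c)).
  split => // [v|v rv]; first by rewrite /disk_ind; case: ifP; rewrite ?cabs0 ?cabs1.
  by rewrite disk_ind0// ltNge; apply/negP => /in_r; rewrite leNgt rv.
have d2 : wdiff (potential p p.+1 g) c 0 0.
  apply: (wdiff_local eta0 _ (wdiff_cst c K)) => w wc.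
  have wr' : cabs w < r by have := cabsD (w - c) c; rewrite subrK; lra.
  have wr := ltW wr'.
  have i1 : pintegrable (fun v => kern p p.+1 (v - w) * disk_ind r v).
    by apply: (pintegrable_potential r0 (weight_disk_ind r)).
  have i2 : pintegrable (fun v => kern p p.+1 (v - w) * disk_ind eta (v - c)).
    by apply: (pintegrable_potential r0 weta).
  have -> : potential p p.+1 g w = potential p p.+1 (@disk_ind R r) w -
      potential p p.+1 (fun v => disk_ind eta (v - c)) w.
    by rewrite /potential -pintB//; apply: eq_pint => v; rewrite /g mulrBr.
  have wE : w = c + (w - c) by rewrite addrC subrK.
  rewrite [X in _ - potential _ _ _ X]wE potential_translate; last 2 first.
  - exact: pmeasurable_disk_ind.
  - by under eq_fun do rewrite -addrA -opprD -wE.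
  rewrite /K; case: (p) => [|n].
    rewrite !potential_disk_pole1 ?(ltW wc)// !expr1 rmorphB /= !divr1; ring.
  by rewrite !potential_disk_eq0// subrr.
have [/eqP + _] := wdiff_unique d1 d2.
by rewrite mulf_eq0 pnatr_eq0/= => /eqP.
Qed.

(** Far from the pole the kernel of degree [-2] varies like its gradient, of degree [-3]. *)
Lemma kern_difference_far p : exists2 k : R, 0 <= k & forall u h, u != 0 ->
  2 * cabs h <= cabs u ->
  cabs (kern p p.+2 (u - h) - kern p p.+2 u) <= k * cabs h * cabs u `^ (-3).
Proof.
have [c c0 sk] := @singular_kern R p; exists (6 * c); first by rewrite mulr_ge0.
move=> u h u0 hu; have m0 : 0 < cabs u by rewrite cabs_gt0.
have t0 := cabs_ge0 h.
have mm' : cabs u <= 2 * cabs (u - h).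
  by have := cabsD (u - h) h; rewrite subrK; lra.
have m'0 : 0 < cabs (u - h) by lra.
have uh0 : u - h != 0 by rewrite -cabs_gt0.
have [a1 a2 _] := sk u h u0 uh0; move: a1 a2 => /= a1 a2.
have kE (v : C) : kern p p.+2 v = kern p p.+1 v * v^-1.
  by rewrite /kern [v ^+ p.+2]exprSr [(v ^+ p.+1 * v)^-1]invfM mulrA.
set a := kern p p.+1 in a1 a2 kE *.
have -> : kern p p.+2 (u - h) - kern p p.+2 u =
    (a (u - h) - a u) * (u - h)^-1 + a u * (h * u^-1 * (u - h)^-1).
  by rewrite !kE; field; exact/andP.
have inv : (cabs (u - h))^-1 <= 2 * (cabs u)^-1.
  by rewrite -[leLHS]mul1r ler_pdivrMr// mulrAC ler_pdivlMr// mul1r.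
have b1 : cabs (u - h)^-1 <= 2 * (cabs u)^-1 by rewrite cabsV.
have b2 : cabs (h * u^-1 * (u - h)^-1) <= cabs h * (cabs u)^-1 * (2 * (cabs u)^-1).
  by apply: cabsM_le => //; rewrite cabsM cabsV.
apply: le_trans (cabsD_le (cabsM_le a2 b1) (cabsM_le a1 b2)) _.
rewrite powRN (powR_mulrn 3 (ltW m0)).
have -> : 6 * c * cabs h * (cabs u ^+ 3)^-1 =
   c * cabs h * (cabs u)^-1 * (2 * (cabs u)^-1) * (2 * (cabs u)^-1) +
   c * (cabs u)^-1 * (cabs h * (cabs u)^-1 * (2 * (cabs u)^-1)).
  by field; rewrite gt_eqF.
rewrite lerD2r ler_wpM2r ?mulr_ge0 ?invr_ge0 ?(ltW m0)//.
by rewrite ler_wpM2l// !mulr_ge0 ?invr_ge0 ?(ltW m0).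
Qed.

End Beurling.

(** * Increments of the singular integrals *)

Section BeurlingHolder.
Variable R : realType.
Local Notation C := R[i].
Local Notation mu2 := (@plane_measure R).
Local Notation toC := (@toC R).
Implicit Types (f g : C -> C) (z w : C) (r L alpha : R) (p : nat).

(** Classical splitting at the scale [eta]. The cancellation over the complement of
the ball of radius [eta] centred at [c] is what makes the increment
[f c - f z], constant in the variable of integration, harmless; this is why
[c] has to keep the distance [eta] to the circle. *)
Lemma beurling_increment r alpha L p f : 0 < r -> 0 < alpha -> alpha < 1 ->
  holder_const r alpha L f -> exists2 K, 0 <= K & forall c z eta, 0 < eta ->
  cabs c + eta <= r -> cabs z <= r -> cabs (z - c) <= 2 * eta ->
  cabs (beurling r p f z - beurling r p f c) <= K * eta `^ alpha.
Proof.
move=> r0 al0 al1 fL; have L0 := fL.1.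
have [k k0 kfar] := kern_difference_far R p.
have pi0 : 0 <= pi :> R by exact: pi_ge0.
have al1' : 0 < 1 - alpha by rewrite subr_gt0.
have [N1 [N10 N1E]] : exists N1, 0 <= N1 /\ N1 = 2 * pi * (6 / alpha).
  by eexists; split; last reflexivity; rewrite !mulr_ge0// invr_ge0 ltW.
have [F1 [F10 F1E]] : exists F1, 0 <= F1 /\ F1 = 2 * pi / (1 - alpha).
  by eexists; split; last reflexivity; rewrite !mulr_ge0// invr_ge0 ltW.
exists (2 * (3 * L * (N1 + N1) + 4 * k * L * F1)).
  by rewrite mulr_ge0// addr_ge0// !mulr_ge0// addr_ge0.
move=> c z eta eta0 cr zr zc.
have cr' : cabs c <= r by lra.
have eta60 : 0 < 6 * eta by rewrite mulr_gt0.
have eta40 : 0 < 4 * eta by rewrite mulr_gt0.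
have [ig Eg] := pint_kern_complement_eq0 p r0 eta0 cr.
have iz := pintegrable_beurling p r0 al0 fL zr.
have ic := pintegrable_beurling p r0 al0 fL cr'.
set g := fun v => kern p p.+2 (v - c) * _ in ig Eg.
pose Phi v := kern p p.+2 (v - z) * (disk_ind r v * (f v - f z)) -
   kern p p.+2 (v - c) * (disk_ind r v * (f v - f c)) - (f c - f z) * g v.
have iPhi : pintegrable Phi.
  by apply: pintegrableB; [exact: pintegrableB|exact: pintegrableZ].
have -> : beurling r p f z - beurling r p f c = pint Phi.
  rewrite pintB; [|exact: pintegrableB|exact: pintegrableZ].
  by rewrite pintB// pintZ// Eg mulr0 subr0.
(* [4 * eta] is twice the bound on [cabs (z - c)], so that the far part is in the range of
   [kern_difference_far]; the near part is then within [6 * eta] of both poles. *)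
pose near a v : R := if cabs (v - a) < 6 * eta then cabs (v - a) `^ (alpha - 2) else 0.
pose far v : R := if cabs (v - c) < 4 * eta then 0 else cabs (v - c) `^ (alpha - 1 - 2).
have near0 a v : 0 <= near a v by rewrite /near; case: ifP => // _; exact: powR_ge0.
have far0 v : 0 <= far v by rewrite /far; case: ifP => // _; exact: powR_ge0.
pose N := 2 * pi * ((6 * eta) `^ alpha / alpha).
pose F := 2 * pi * ((4 * eta) `^ (alpha - 1) / - (alpha - 1)).
have mnear a : mass_le mu2 (fun q => near a (toC q)) N by exact: mass_near.
have mfar : mass_le mu2 (fun q => far (toC q)) F by apply: mass_far => //; lra.
have L3 : 0 <= 3 * L by rewrite mulr_ge0.
have kL : 0 <= 4 * k * L * eta by rewrite !mulr_ge0// ltW.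
have mG := mass_leD (mass_leZ L3 (mass_leD (mnear z) (mnear c))) (mass_leZ kL mfar).
have Phi_le v : v != z -> v != c ->
    cabs (Phi v) <= 3 * L * (near z v + near c v) + 4 * k * L * eta * far v.
  move=> vz vc.
  have m0 : 0 < cabs (v - c) by rewrite cabs_gt0 subr_eq0.
  have m10 : 0 < cabs (v - z) by rewrite cabs_gt0 subr_eq0.
  have [vr|rv] := leP (cabs v) r; last first.
    have gv : g v = 0.
      rewrite /g disk_ind0// disk_ind0 ?subrr ?mulr0// ltNge; apply/negP => ve.
      by have := cabsD (v - c) c; rewrite subrK; lra.
    rewrite /Phi gv !increment_outside// !mulr0 !subrr cabs0.
    by rewrite addr_ge0 ?mulr_ge0 ?addr_ge0 ?(ltW eta0).
  have pD (x a b : R) : 0 < x -> x `^ (a + b) = x `^ a * x `^ b.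
    by move=> x0; rewrite powRD// (gt_eqF x0) implybT.
  have kern_le w : 0 < cabs (v - w) -> cabs (kern p p.+2 (v - w)) <= cabs (v - w) `^ (- 2).
    move=> w0; rewrite /kern cabsM cabsV !cabsX cabs_conj powRN powR_mulrn ?cabs_ge0//.
    rewrite le_eqVlt; apply/orP; left; apply/eqP.
    have -> : cabs (v - w) ^+ p.+2 = cabs (v - w) ^+ p * cabs (v - w) ^+ 2 by rewrite -addn2 exprD.
    by field; rewrite expf_neq0 gt_eqF.
  have inc_le w : cabs w <= r -> 0 < cabs (v - w) ->
      cabs (kern p p.+2 (v - w) * (disk_ind r v * (f v - f w))) <= L * cabs (v - w) `^ (alpha - 2).
    move=> wr w0; rewrite (_ : alpha - 2 = -2 + alpha); last by ring.
    rewrite pD// [leRHS]mulrCA; apply: cabsM_le; first exact: kern_le.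
    exact: increment_le.
  have fcz : cabs (f c - f z) <= L * (2 * eta) `^ alpha.
    apply: le_trans (fL.2 c z cr' zr) _; rewrite ler_wpM2l//.
    apply: (ge0_ler_powR (ltW al0)); rewrite ?nnegrE ?cabs_ge0//.
      by rewrite mulr_ge0// ltW.
    by rewrite cabsC.
  have two_pow : (2 : R) `^ alpha <= 2 by rewrite ler1_powR ?ler1n// ltW.
  have [vc4|vc4] := ltP (cabs (v - c)) (4 * eta).
    have gle : cabs ((f c - f z) * g v) <= 2 * L * cabs (v - c) `^ (alpha - 2).
      have [ve|ve] := leP (cabs (v - c)) eta.
        have gv : g v = 0.
          by rewrite /g !disk_ind1// subrr mulr0.
        by rewrite gv mulr0 cabs0 mulr_ge0 ?powR_ge0// mulr_ge0.
      have -> : g v = kern p p.+2 (v - c).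
        by rewrite /g disk_ind1// disk_ind0// subr0 mulr1.
      rewrite pD// mulrA; apply: cabsM_le; last exact: kern_le.
      apply: le_trans fcz _; rewrite powRM ?(ltW eta0)// mulrA [2 * L]mulrC.
      apply: ler_pM; rewrite ?mulr_ge0 ?powR_ge0//.
        by rewrite ler_wpM2l.
      by apply: (ge0_ler_powR (ltW al0)); rewrite ?nnegrE ?cabs_ge0 ?(ltW eta0) ?(ltW ve).
    have vz6 : cabs (v - z) < 6 * eta.
      have := cabs_triangle v c z; rewrite [cabs (c - z)]cabsC; lra.
    have vc6 : cabs (v - c) < 6 * eta by lra.
    rewrite /near vz6 vc6 /far vc4 mulr0 addr0.
    have i1 := inc_le z zr m10; have i2 := inc_le c cr' m0.
    apply: le_trans (cabsB _ _) _.
    apply: le_trans (lerD (cabsB _ _) (lexx _)) _.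
    apply: le_trans (lerD (lerD i1 i2) gle) _.
    have q1 : 0 <= L * cabs (v - z) `^ (alpha - 2) by rewrite mulr_ge0 ?powR_ge0.
    by rewrite -!mulrA in q1 *; lra.
  apply: (@le_trans _ _ (4 * k * L * eta * far v)); last first.
    by rewrite lerDr mulr_ge0// addr_ge0.
  rewrite /far ltNge vc4 /=.
  have gv : g v = kern p p.+2 (v - c).
    rewrite /g disk_ind1// disk_ind0 ?subr0 ?mulr1//; lra.
  have -> : Phi v = (kern p p.+2 (v - c - (z - c)) - kern p p.+2 (v - c)) * (f v - f z).
    have -> : v - c - (z - c) = v - z by ring.
    by rewrite /Phi gv !disk_ind1// !mul1r; ring.
  have v0 : v - c != 0 by rewrite subr_eq0.
  have kd : cabs (kern p p.+2 (v - c - (z - c)) - kern p p.+2 (v - c)) <=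
      k * (2 * eta) * cabs (v - c) `^ (-3).
    apply: le_trans (kfar (v - c) (z - c) v0 _) _; first by lra.
    by rewrite ler_wpM2r ?powR_ge0// ler_wpM2l.
  have fd : cabs (f v - f z) <= L * (2 * cabs (v - c) `^ alpha).
    apply: le_trans (fL.2 v z vr zr) _; rewrite ler_wpM2l//.
    apply: (@le_trans _ _ ((2 * cabs (v - c)) `^ alpha)).
      apply: (ge0_ler_powR (ltW al0)); rewrite ?nnegrE ?cabs_ge0//.
        by rewrite mulr_ge0 ?cabs_ge0.
      by have := cabs_triangle v c z; rewrite [cabs (c - z)]cabsC; lra.
    by rewrite powRM ?cabs_ge0// ler_wpM2r ?powR_ge0.
  apply: le_trans (cabsM_le kd fd) _.
  rewrite (_ : alpha - 1 - 2 = -3 + alpha); last by ring.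
  by rewrite pD// le_eqVlt; apply/orP; left; apply/eqP; ring.
have Phi_ae : {ae mu2, forall q, cabs (Phi (toC q)) <=
    3 * L * (near z (toC q) + near c (toC q)) + 4 * k * L * eta * far (toC q)}.
  by apply: filterS2 (ae_neq_point z) (ae_neq_point c) => q qz qc; exact: Phi_le.
apply: le_trans (cabs_cintegral_le (cintegrable_measurable iPhi) Phi_ae mG) _.
rewrite -[leRHS]mulrA ler_wpM2l//.
have ea0 : 0 <= eta `^ alpha by exact: powR_ge0.
have NE : N <= N1 * eta `^ alpha.
  have h6 : (6 * eta) `^ alpha <= 6 * eta `^ alpha.
    by rewrite powRM ?(ltW eta0)// ler_wpM2r// ler1_powR ?ler1n// ltW.
  rewrite (_ : N1 * _ = 2 * pi * (6 * eta `^ alpha / alpha)); last by rewrite N1E; ring.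
  by rewrite /N ler_wpM2l ?mulr_ge0// ler_wpM2r// invr_ge0 ltW.
have FE : eta * F <= F1 * eta `^ alpha.
  have h4 : eta * (4 * eta) `^ (alpha - 1) <= eta `^ alpha.
    rewrite -[leRHS](mulr_powRB1 (ltW eta0) al0) ler_wpM2l ?(ltW eta0)//.
    rewrite powRM ?(ltW eta0)// ler_piMl ?powR_ge0//.
    have -> : alpha - 1 = - (1 - alpha) by ring.
    by rewrite powRN invf_le1 ?powR_gt0// -[leLHS](powRr0 4) ler_powR ?ler1n// ltW.
  rewrite (_ : eta * F = 2 * pi / (1 - alpha) * (eta * (4 * eta) `^ (alpha - 1))).
    by rewrite -F1E ler_wpM2l.
  by rewrite /F opprB; ring.
have n1 := ler_wpM2l L3 (lerD NE NE).
have kL' : 0 <= 4 * k * L by rewrite !mulr_ge0.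
have n2 := ler_wpM2l kL' FE.
rewrite [leRHS]mulrDl; apply: lerD.
  by rewrite -[leRHS]mulrA [(N1 + N1) * _]mulrDl.
by rewrite -[leRHS]mulrA -[leLHS]mulrA.
Qed.

End BeurlingHolder.

(** * Regularity up to the boundary *)

Section Regularity.
Variable R : realType.
Local Notation C := R[i].
Implicit Types (f g F G A B : C -> C) (z w : C) (r L M alpha : R) (p q k j : nat).

(** Both points are compared with a common point [c], at a distance from the circle that is
comparable to their own distance. *)
Lemma beurling_holder r alpha L p f : 0 < r -> 0 < alpha -> alpha < 1 ->
  holder_const r alpha L f -> exists K, holder_const r alpha K (beurling r p f).
Proof.
move=> r0 al0 al1 fL; have [K K0 Kinc] := beurling_increment p r0 al0 al1 fL.
exists (K + K); split; first exact: addr_ge0.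
move=> z w zr wr; have [->|zw] := eqVneq z w.
  by rewrite !subrr cabs0 mulr_ge0 ?addr_ge0 ?powR_ge0.
have d0 : 0 < cabs (z - w) by rewrite cabs_gt0 subr_eq0.
pose eta := Num.min (cabs (z - w)) r.
have eta0 : 0 < eta by rewrite lt_min d0.
have etar : eta <= r by rewrite ge_min lexx orbT.
have etad : eta <= cabs (z - w) by rewrite ge_min lexx.
have q1 : 0 <= 1 - eta / r by rewrite subr_ge0 ler_pdivrMr// mul1r.
have q0 : 0 <= eta / r by rewrite divr_ge0// ltW.
(* [z] pulled towards the centre, so that the ball of radius [eta] around it lies in the
   disk of radius [r]. *)
pose c : C := (1 - eta / r)%:C * z.
have zE : z - c = (eta / r)%:C * z.
  by rewrite /c rmorphB rmorph1 mulrBl mul1r opprB addrC subrK.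
have zc : cabs (z - c) <= eta.
  rewrite zE cabsM cabs_real ger0_norm// mulrAC ler_pdivrMr//.
  by rewrite ler_wpM2l// ltW.
have cr : cabs c + eta <= r.
  rewrite /c cabsM cabs_real ger0_norm//.
  apply: (@le_trans _ _ ((1 - eta / r) * r + eta)); first by rewrite lerD2r ler_wpM2l.
  by rewrite mulrBl mul1r divfK ?subrK// gt_eqF.
have wc : cabs (w - c) <= 2 * eta.
  rewrite /eta; case: (leP (cabs (z - w)) r) => dr.
    have etaE : eta = cabs (z - w) by rewrite /eta min_l.
    have := cabs_triangle w z c; rewrite [cabs (w - z)]cabsC; move: zc; rewrite etaE; lra.
  have etaE : eta = r by rewrite /eta min_r// ltW.
  have -> : c = 0 by rewrite /c etaE divff ?gt_eqF// subrr mul0r.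
  rewrite subr0; lra.
have h1 := Kinc c z eta eta0 cr zr; have h2 := Kinc c w eta eta0 cr wr wc.
have {}h1 : cabs (beurling r p f z - beurling r p f c) <= K * eta `^ alpha.
  by apply: h1; lra.
have mono : eta `^ alpha <= cabs (z - w) `^ alpha.
  by apply: (ge0_ler_powR (ltW al0)); rewrite ?nnegrE ?cabs_ge0 ?(ltW eta0).
apply: le_trans (cabs_triangle _ (beurling r p f c) _) _.
rewrite [cabs (beurling r p f c - _)]cabsC.
apply: le_trans (lerD h1 h2) _; rewrite -mulrDl ler_wpM2l// addr_ge0//.
Qed.

(** Continuity up to the boundary of the potentials; any exponent below [1] would serve the
same purpose. *)
Lemma potential_half_holder r M p g : 0 < r -> weight r M g ->
  exists K, holder_const r 2^-1 K (potential p 1 g).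
Proof.
move=> r0 wg; have [mg gM g0] := wg.
have M0 : 0 <= M by exact: le_trans (cabs_ge0 _) (gM 0).
have [c c0 kc] : exists2 c : R, 0 <= c & forall u h : C, u != 0 -> u - h != 0 ->
    cabs u <= 2 * r -> cabs (u - h) <= 2 * r ->
    cabs (kern p 1 (u - h) - kern p 1 u) <= c * cabs h * (cabs u)^-1 * (cabs (u - h))^-1.
  have r20 : 0 < 2 * r by rewrite mulr_gt0.
  case: (p) => [|n].
    have [c c0 sk] := @singular_kern R 0; exists c => // u h u0 uh0 _ _.
    by have [] := sk u h u0 uh0.
  have [c c0 bk] := @bounded_kern R n.+1 1 _ isT r20; exists c => // u h u0 uh0 ur uhr.
  by have [] := bk u h u0 uh0 ur uhr.
exists (c * M * 2 * sing_mass r (1 / 2)); split.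
  by rewrite mulr_ge0 ?sing_mass_ge0// mulr_ge0// mulr_ge0.
move=> z w zr wr; have [->|zw] := eqVneq z w.
  by rewrite !subrr cabs0 mulr_ge0 ?powR_ge0// mulr_ge0 ?sing_mass_ge0// mulr_ge0// mulr_ge0.
have t0 : 0 < cabs (z - w) by rewrite cabs_gt0 subr_eq0.
have iz : pintegrable (fun v => kern p 1 (v - z) * g v).
  by apply: (pintegrable_potential r0 wg).
have iw : pintegrable (fun v => kern p 1 (v - w) * g v).
  by apply: (pintegrable_potential r0 wg).
rewrite /potential -pintB//.
set F := fun v => _ : C.
have iF : pintegrable F by exact: pintegrableB.
have P0 : 0 <= c * M * (2 * cabs (z - w) `^ 2^-1).
  by rewrite mulr_ge0 ?mulr_ge0 ?powR_ge0.
have F0 v : r < cabs v -> F v = 0 by move=> rv; rewrite /F g0// !mulr0 subrr.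
rewrite (_ : c * M * 2 * _ * _ =
   (c * M * (2 * cabs (z - w) `^ 2^-1)) * sing_mass r (1 / 2)); last by ring.
have half0 : 0 < 1 / 2 :> R by rewrite divr_gt0.
apply: (weak_singular_pair r0 half0 P0 (cintegrable_measurable iF) wr zr F0 _).2.
move=> v vw vz vr.
have u0 : v - w != 0 by rewrite subr_eq0.
have uE : v - w - (z - w) = v - z by ring.
have uh0 : v - w - (z - w) != 0 by rewrite uE subr_eq0.
have := kc (v - w) (z - w) u0 uh0; rewrite uE => /(_ _ _)/le_trans kE.
have -> : F v = (kern p 1 (v - z) - kern p 1 (v - w)) * g v by rewrite /F mulrBl.
have m0 : 0 < cabs (v - w) by rewrite cabs_gt0.
have m'0 : 0 < cabs (v - z) by rewrite cabs_gt0 -uE.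
have tri : cabs (z - w) <= cabs (v - w) + cabs (v - z).
  by have := cabs_triangle z v w; rewrite [cabs (z - v)]cabsC; lra.
have Q := two_pole_interpolation m0 m'0 (ltW t0) tri ltr01 (lexx 1).
have {}Q : cabs (z - w) * (cabs (v - w))^-1 * (cabs (v - z))^-1 <=
    2 * cabs (z - w) `^ 2^-1 * (cabs (v - w) `^ (1 / 2 - 2) + cabs (v - z) `^ (1 / 2 - 2)).
  rewrite -(ler_pM2l t0); apply: le_trans (le_trans _ Q) _.
    rewrite powRr1 ?cabs_ge0// le_eqVlt; apply/orP; left; apply/eqP.
    by move: (cabs (v - z))^-1 => m'; field; rewrite gt_eqF.
  have -> : cabs (z - w) `^ (1 + 1 / 2) = cabs (z - w) * cabs (z - w) `^ 2^-1.
    by rewrite mul1r powRD ?(gt_eqF t0) ?implybT// powRr1// ltW.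
  rewrite le_eqVlt; apply/orP; left; apply/eqP; ring.
have k1 : cabs (kern p 1 (v - z) - kern p 1 (v - w)) <=
    c * (cabs (z - w) * (cabs (v - w))^-1 * (cabs (v - z))^-1).
  have := kc (v - w) (z - w) u0 uh0; rewrite uE !mulrA; apply; exact: cabs_sub_disk.
apply: le_trans (cabsM_le k1 (gM v)) _.
rewrite (_ : c * M * _ * _ = c * (2 * cabs (z - w) `^ 2^-1 *
   (cabs (v - w) `^ (1 / 2 - 2) + cabs (v - z) `^ (1 / 2 - 2))) * M); last by ring.
by rewrite ler_wpM2r// ler_wpM2l.
Qed.

Lemma holder_const_continuous r alpha L F : 0 < alpha -> holder_const r alpha L F ->
  {within cdisk r : set C^o, continuous (F : C^o -> C^o)}.
Proof.
move=> al0 [L0 FL]; apply/subspace_continuousP => z zr.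
apply/cvgrPdist_le => /= eps eps0.
have [e e0 epsE] : exists2 e : R, 0 < e & eps = e%:C.
  exists (complex.Re eps); first by move: eps0; rewrite ltcE /= => /andP[_].
  by move: eps0; rewrite ltcE /= => /andP[/eqP i0 _]; case: eps i0 => a b /= ->.
pose X := e / (L + 1); have X0 : 0 < X by rewrite divr_gt0// ltr_wpDl.
pose del := X `^ alpha^-1; have del0 : 0 < del by rewrite powR_gt0.
rewrite /within /=; apply/nbhs_ballP; exists (del%:C) => /=; first by rewrite ltcR.
move=> w; rewrite -ball_normE /= => zw wr.
have {}zw : cabs (z - w) < del by rewrite -ltcR cabsE.
rewrite epsE -cabsE lecR; apply: le_trans (FL z w zr wr) _.
apply: (@le_trans _ _ (L * X)).
  rewrite ler_wpM2l// -[X]powRr1 ?(ltW X0)// -(mulVf (lt0r_neq0 al0)) powRrM.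
  by apply: (ge0_ler_powR (ltW al0)); rewrite ?nnegrE ?cabs_ge0 ?(ltW del0) ?(ltW zw).
by rewrite /X mulrCA ler_piMr ?(ltW e0)// ler_pdivrMr ?ltr_wpDl// mul1r lerDl.
Qed.

(** The [V j] are linear spaces in which the Wirtinger derivatives of [V j] fall into
[V j.+1].  Linearity turns Wirtinger derivatives into partial ones, so that all the
iterated partial derivatives of order [j], whatever the sequence of directions, are
in [V j] by induction. *)
Lemma holder_class_of_filtration k r alpha (V : nat -> (C -> C) -> Prop) F0 :
  (forall j a F, V j F -> V j (fun z => a * F z)) ->
  (forall j F G, V j F -> V j G -> V j (fun z => F z + G z)) ->
  (forall j F, (j < k)%N -> V j F -> exists A B, [/\ V j.+1 A, V j.+1 B &
     forall z, cabs z < r -> wdiff F z (A z) (B z)]) ->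
  (forall F, V k F -> holder r alpha F) ->
  {within cdisk r : set C^o, continuous (F0 : C^o -> C^o)} ->
  (exists2 F, V 0%N F & forall z, cabs z < r -> F0 z = F z) ->
  holder_class k r alpha F0.
Proof.
move=> VZ VD Vd VH cF0 VF0.
have local F G z b : cabs z < r -> (forall w, cabs w < r -> F w = G w) ->
    pderiv b F z = pderiv b G z /\ (pderivable b G z -> pderivable b F z).
  move=> zr FG; apply: (@pderiv_local _ _ _ _ (r - cabs z)); first by rewrite subr_gt0.
  by move=> w wz; apply: FG; have := cabsD (w - z) z; rewrite subrK; lra.
have step s : (size s <= k)%N -> exists2 F, V (size s) F &
    forall z, cabs z < r -> pderivs s F0 z = F z.
  elim: s => [|b s IH] /= sk; first exact: VF0.
  have [F VF FE] := IH (ltnW sk); have [A [B [VA VB dF]]] := Vd _ _ sk VF.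
  exists (fun z => pdir R b * A z + (pdir R b)^*%C * B z).
    by apply: VD; exact: VZ.
  move=> z zr; rewrite (local _ F z b zr FE).1 (wdiff_pderiv b (dF z zr)).2.
  by rewrite [A z * _]mulrC [B z * _]mulrC.
split => //.
- move=> s b sk z zr; have [F VF FE] := step s (ltnW sk).
  have [A [B [_ _ dF]]] := Vd _ _ sk VF.
  by apply: (local _ F z b zr FE).2; exact: (wdiff_pderiv b (dF z zr)).1.
- move=> s sk; have [F VF FE] := step s (eq_leq sk).
  exists F; first by apply: VH; rewrite -sk.
  by move=> z zr; rewrite FE.
Qed.

Inductive span (P : (C -> C) -> Prop) : (C -> C) -> Prop :=
| span_gen F : P F -> span P F
| span_scale a F : span P F -> span P (fun z => a * F z)
| span_add F G : span P F -> span P G -> span P (fun z => F z + G z).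

Definition cut r f v : C := disk_ind r v * f v.

(** Generators, up to scalars, of the derivatives of order [j] of [potential k.-1 1].  The
kernels have degree [p - q = k - 2 - j]; at order [k] they become singular integrals, to
which [f] itself is added by the delta function in the derivative of [1 / u]. *)
Definition derivative_level r f k j F : Prop :=
  if (j < k)%N then exists p q, [/\ (0 < q)%N, (p + j + 2 = k + q)%N &
    F = potential p q (cut r f)]
  else (exists p, F = beurling r p f) \/ F = f.

Lemma derivative_level_wdiff r alpha L f k j F : 0 < r -> 0 < alpha -> alpha <= 1 ->
  holder_const r alpha L f -> (j < k)%N -> derivative_level r f k j F ->
  exists A B, [/\ span (derivative_level r f k j.+1) A,
    span (derivative_level r f k j.+1) B &
    forall z, cabs z < r -> wdiff F z (A z) (B z)].
Proof.
move=> r0 al0 al1 fL jk; rewrite {1}/derivative_level jk => -[p [q [q0 pq ->]]].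
have wg := weight_holder r0 al0 fL; rewrite -/(cut r f) in wg.
have [jk1|jk1] := ltnP j.+1 k.
  have qp : (0 < q <= p)%N by rewrite q0; lia.
  exists (fun z => q%:R * potential p q.+1 (cut r f) z),
         (fun z => - p%:R * potential p.-1 q (cut r f) z); split.
  - apply: span_scale; apply: span_gen; rewrite /derivative_level jk1.
    by exists p, q.+1; split => //; lia.
  - apply: span_scale; apply: span_gen; rewrite /derivative_level jk1.
    by exists p.-1, q; split => //; lia.
  - by move=> z zr; rewrite mulNr; exact: wdiff_potential wg qp.
have kE : k = j.+1 by lia.
have qE : q = p.+1 by lia.
have notin : (j.+1 < k)%N = false by apply/negbTE; rewrite -leqNgt.
exists (fun z => p.+1%:R * beurling r p f z),
  (fun z => (if p is p'.+1 then - p%:R else - (pi : R)%:C) *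
            (if p is p'.+1 then beurling r p' f z else f z)); split.
- apply: span_scale; apply: span_gen; rewrite /derivative_level notin.
  by left; exists p.
- apply: span_scale; apply: span_gen; rewrite /derivative_level notin.
  by case: (p) => [|n]; [right|left; exists n].
- move=> z zr; rewrite qE.
  have := wdiff_potential_holder p r0 al0 al1 fL zr.
  by case: (p) => [|n] //; rewrite -mulNr.
Qed.

Lemma span_wdiff r alpha L f k j F : 0 < r -> 0 < alpha -> alpha <= 1 ->
  holder_const r alpha L f -> (j < k)%N -> span (derivative_level r f k j) F ->
  exists A B, [/\ span (derivative_level r f k j.+1) A,
    span (derivative_level r f k j.+1) B &
    forall z, cabs z < r -> wdiff F z (A z) (B z)].
Proof.
move=> r0 al0 al1 fL jk; elim=> {F} [F PF|a F _ [A [B [SA SB d]]]|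
    F G _ [A [B [SA SB d]]] _ [A' [B' [SA' SB' d']]]].
- exact: derivative_level_wdiff fL jk PF.
- exists (fun z => a * A z), (fun z => a * B z).
  by split; [exact: span_scale|exact: span_scale|move=> z zr; apply: wdiffZ; exact: d].
- exists (fun z => A z + A' z), (fun z => B z + B' z).
  split; [exact: span_add|exact: span_add|].
  by move=> z zr; apply: wdiffD; [exact: d|exact: d'].
Qed.

Lemma span_holder r alpha L f k F : 0 < r -> 0 < alpha -> alpha < 1 ->
  holder_const r alpha L f -> span (derivative_level r f k k) F ->
  exists K, holder_const r alpha K F.
Proof.
move=> r0 al0 al1 fL; elim=> {F} [F|a F _ [K [K0 FK]]|F G _ [K [K0 FK]] _ [K' [K'0 GK]]].
- rewrite /derivative_level ltnn => -[[p ->]|->]; last by exists L.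
  exact: beurling_holder fL.
- exists (cabs a * K); split; first by rewrite mulr_ge0 ?cabs_ge0.
  move=> z w zr wr; rewrite -mulrBr -mulrA; apply: cabsM_le => //; exact: FK.
- exists (K + K'); split; first exact: addr_ge0.
  move=> z w zr wr; rewrite opprD addrACA mulrDl; apply: cabsD_le; [exact: FK|exact: GK].
Qed.

Lemma span_potential r f k : (0 < k)%N ->
  span (derivative_level r f k 0) (potential k.-1 1 (cut r f)).
Proof.
move=> k0; apply: span_gen; rewrite /derivative_level k0.
by exists k.-1, 1%N; split => //; lia.
Qed.

End Regularity.

(** * The Cauchy operators *)

Section Operators.
Variable R : realType.
Local Notation C := R[i].
Implicit Types (f g F G : C -> C) (z w : C) (r alpha L M : R) (k : nat).

Lemma eq_area_int r F G : (forall v, cabs v <= r -> F v = G v) ->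
  area_int r F = area_int r G.
Proof.
move=> FG; rewrite !area_intE; apply: eq_pint => v.
by rewrite /disk_ind; case: ifPn => vr; rewrite ?mul0r ?FG.
Qed.

Lemma complex_pi_neq0 : (pi : R)%:C != 0.
Proof. by rewrite -cabs_eq0 cabs_real normr_eq0 gt_eqF// pi_gt0. Qed.

Lemma form_coef (c x : C) : c / two_pi_i R * (2%:R * 'i%C * x) = c / (pi : R)%:C * x.
Proof.
have i0 : ('i%C : C) != 0 by rewrite -cabs_eq0 cabs_i oner_eq0.
rewrite /two_pi_i; move: (pi : R)%:C complex_pi_neq0 => p p0.
by field; rewrite i0 p0.
Qed.

Lemma form_coefM (c d x : C) :
  c / (d * two_pi_i R) * (2%:R * 'i%C * x) = c / (d * (pi : R)%:C) * x.
Proof. by rewrite !(invfM d) ![c * (d^-1 * _)]mulrA form_coef. Qed.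

Lemma cauchyTE r f z :
  cauchyT r f z = - 1 / (pi : R)%:C * area_int r (fun v => f v / (v - z)).
Proof. exact: form_coef. Qed.

Lemma cauchyTbarE r f z : cauchyTbar r f z =
  - 1 / (pi : R)%:C * area_int r (fun v => f v / (v^*%C - z^*%C)).
Proof. exact: form_coef. Qed.

(** On the disk the function to which the operator is applied is a potential, by induction,
and the next one is given by [pint_cauchy_potential]. *)
Lemma cauchyT_iter r alpha L f k z : 0 < r -> 0 < alpha -> holder_const r alpha L f ->
  cabs z <= r ->
  iter k.+1 (cauchyT r) f z =
  (-1) ^+ k.+1 / (k`!%:R * (pi : R)%:C) * potential k 1 (cut r f) z.
Proof.
move=> r0 al0 fL; have wg := weight_holder r0 al0 fL; rewrite -/(cut r f) in wg.
elim: k z => [|k IH] z zr.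
  rewrite /= cauchyTE area_intE fact0 mul1r expr1; congr (_ * _).
  by apply: eq_pint => v; rewrite /kern /cut expr0 expr1; ring.
rewrite iterS cauchyTE (eq_area_int (G := fun v => (-1) ^+ k.+1 / (k`!%:R * (pi : R)%:C) *
    (potential k 1 (cut r f) v / (v - z)))); last first.
  by move=> v vr; rewrite IH// mulrA.
set c := _ / (k`!%:R * _).
have wc : weight r (cabs c * (cabs (f 0) + L * r `^ alpha)) (fun v => c * cut r f v).
  by apply: (weightM_le (h := fun=> c) wg); rewrite ?cabs_ge0//; exact: pmeasurable_cst.
have cE v : cabs v <= r -> c * potential k 1 (cut r f) v =
    potential k 1 (fun w => c * cut r f w) v.
  move=> vr; rewrite /potential -pintZ; last exact: pintegrable_potential wg vr _ _.
  by apply: eq_pint => w; rewrite mulrCA.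
rewrite (eq_area_int (G := fun v => potential k 1 (fun w => c * cut r f w) v / (v - z)));
  last first.
  by move=> v vr; rewrite -cE// mulrA.
rewrite area_intE (pint_cauchy_potential k r0 wc zr).
have -> : potential k.+1 1 (fun w => c * cut r f w) z = c * potential k.+1 1 (cut r f) z.
  rewrite /potential -pintZ; last exact: pintegrable_potential wg zr _ _.
  by apply: eq_pint => w; rewrite mulrCA.
have k0 : (k`!%:R : C) != 0 by rewrite pnatr_eq0 -lt0n fact_gt0.
rewrite factS natrM exprS /c; move: (pi : R)%:C complex_pi_neq0 => p p0.
by field; rewrite k0 p0 nat1r pnatr_eq0.
Qed.

Lemma potential_form r f k z : form_int r (fun v => (v^*%C - z^*%C) ^+ k * f v / (v - z)) =
  2%:R * 'i%C * potential k 1 (cut r f) z.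
Proof.
rewrite /form_int area_intE; congr (_ * _); apply: eq_pint => v.
by rewrite /kern /cut rmorphB expr1; ring.
Qed.

Lemma cauchyT_iter_form r alpha f k z : 0 < r -> 0 < alpha -> holder r alpha f ->
  (0 < k)%N -> cabs z <= r ->
  iter k (cauchyT r) f z = (-1) ^+ k / ((k.-1)`!%:R * two_pi_i R) *
    form_int r (fun v => (v^*%C - z^*%C) ^+ k.-1 * f v / (v - z)).
Proof.
move=> r0 al0 /holderP[L fL]; case: k => // k _ zr.
by rewrite (cauchyT_iter k r0 al0 fL zr) potential_form form_coefM.
Qed.

Lemma holder_constZ r alpha L (c : C) F : holder_const r alpha L F ->
  holder_const r alpha (cabs c * L) (fun z => c * F z).
Proof.
move=> [L0 FL]; split; first by rewrite mulr_ge0 ?cabs_ge0.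
by move=> z w zr wr; rewrite -mulrBr -mulrA; apply: cabsM_le => //; exact: FL.
Qed.

Lemma eq_holder_const r alpha L F G : (forall z, cabs z <= r -> F z = G z) ->
  holder_const r alpha L F -> holder_const r alpha L G.
Proof. by move=> FG [L0 FL]; split=> // z w zr wr; rewrite -!FG//; exact: FL. Qed.

Lemma holder_class_cauchyT r alpha f k : 0 < r -> 0 < alpha -> alpha < 1 ->
  holder r alpha f -> (0 < k)%N -> holder_class k r alpha (iter k (cauchyT r) f).
Proof.
move=> r0 al0 al1 /holderP[L fL] k0.
have wg := weight_holder r0 al0 fL; rewrite -/(cut r f) in wg.
pose c : C := (-1) ^+ k / ((k.-1)`!%:R * (pi : R)%:C).
have TE z : cabs z <= r -> iter k (cauchyT r) f z = c * potential k.-1 1 (cut r f) z.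
  by move=> zr; rewrite -(prednK k0) (cauchyT_iter _ r0 al0 fL zr) /c prednK.
apply: (@holder_class_of_filtration _ _ _ _ (fun j => span (derivative_level r f k j))).
- by move=> j a F; exact: span_scale.
- by move=> j F G; exact: span_add.
- by move=> j F jk; exact: span_wdiff r0 al0 (ltW al1) fL jk.
- by move=> F SF; apply/holderP; exact: span_holder fL SF.
- have [K PK] := potential_half_holder k.-1 r0 wg.
  apply: holder_const_continuous (eq_holder_const _ (holder_constZ c PK)) => //.
  by move=> z zr; rewrite TE.
- exists (fun z => c * potential k.-1 1 (cut r f) z).
    by apply: span_scale; exact: span_potential.
  by move=> z /ltW; exact: TE.
Qed.

(** In the absence of integrability both sides are zero by the conventions on infinite
values.  Hence the conjugation symmetry between the two operators is an identity of
functions. *)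
Lemma RintegralN d (T : measurableType d) (mu : {measure set T -> \bar R}) (D : set T)
  (f : T -> R) : Rintegral mu D (fun x => - f x) = - Rintegral mu D f.
Proof.
rewrite /Rintegral integralE [in RHS]integralE.
have -> : (fun x => (- f x)%:E) = (\- (fun x => (f x)%:E))%E by apply/funext.
rewrite funeposN funenegN.
by case: (integral _ _ (_ ^\-)%E) => [a||]; case: (integral _ _ (_ ^\+)%E) => [b||] //=;
  rewrite ?oppr0 ?opprB.
Qed.

Lemma conjM (c d : C) : (c * d)^*%C = c^*%C * d^*%C.
Proof. exact: rmorphM. Qed.

Lemma area_int_conj r F : area_int r (fun v => (F v)^*%C) = (area_int r F)^*%C.
Proof.
rewrite !area_intE /pint /cintegral /=; congr (_ +i* _).
  by apply: eq_Rintegral => p _; rewrite /disk_ind; case: ifP; rewrite ?mul1r ?mul0r ?cRe_conj.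
rewrite -RintegralN; apply: eq_Rintegral => p _.
by rewrite /disk_ind; case: ifP; rewrite ?mul1r ?mul0r ?cIm_conj//= oppr0.
Qed.

Lemma cauchyTbar_conj r f z :
  cauchyTbar r f z = (cauchyT r (fun v => (f v)^*%C) z)^*%C.
Proof.
rewrite cauchyTbarE cauchyTE conjM -area_int_conj; congr (_ * _).
  by rewrite rmorphM rmorphN rmorph1 fmorphV; congr (_ * _^-1); rewrite /= oppr0.
by congr area_int; apply/funext => v; rewrite conjM conjcK fmorphV rmorphB.
Qed.

Lemma iter_cauchyTbar_conj r f k : iter k (cauchyTbar r) f =
  (fun z => (iter k (cauchyT r) (fun v => (f v)^*%C) z)^*%C).
Proof.
elim: k => [|k IH]; first by apply/funext => z; rewrite /= conjcK.
apply/funext => z; rewrite !iterS IH cauchyTbar_conj; congr (_^*%C); congr (cauchyT r _ z).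
by apply/funext => v; rewrite conjcK.
Qed.

Lemma holder_conj r alpha F : holder r alpha F -> holder r alpha (fun z => (F z)^*%C).
Proof.
move=> /holderP[L [L0 FL]]; apply/holderP; exists L; split=> // z w zr wr.
by rewrite -rmorphB cabs_conj; exact: FL.
Qed.

Lemma pderiv_conj F z (b : bool) : pderivable b F z ->
  pderivable b (fun w => (F w)^*%C) z /\
  pderiv b (fun w => (F w)^*%C) z = (pderiv b F z)^*%C.
Proof.
move=> [dR dI].
have sR : slice_Re (fun w => (F w)^*%C) b z = slice_Re F b z.
  by apply/funext => t; rewrite /slice_Re cRe_conj.
have sI : slice_Im (fun w => (F w)^*%C) b z = - slice_Im F b z.
  by apply/funext => t; rewrite /slice_Im cIm_conj.
rewrite /pderivable /pderiv sR sI; split.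
  by split => //; exact: derivableN.
by rewrite !derive1E deriveN.
Qed.

Lemma holder_class_conj k r alpha F :
  holder_class k r alpha F -> holder_class k r alpha (fun z => (F z)^*%C).
Proof.
move=> [cF dF hF].
have E s : (size s <= k)%N -> forall z, odisk r z ->
    pderivs s (fun w => (F w)^*%C) z = (pderivs s F z)^*%C.
  elim: s => //= b s IH sk z zr.
  rewrite (@pderiv_local _ _ (fun w => (pderivs s F w)^*%C) z (r - cabs z) b _ _).1.
  - by apply: (pderiv_conj _).2; exact: dF.
  - by rewrite subr_gt0.
  - move=> w wz; apply: IH; first exact: ltnW.
    by rewrite /odisk /=; have := cabsD (w - z) z; rewrite subrK; lra.
split.
- apply/subspace_continuousP => z zr; have /subspace_continuousP/(_ z zr) := cF.
  move=> /cvgrPdist_le cz; apply/cvgrPdist_le => e e0.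
  by apply: filterS (cz e e0) => w; rewrite -rmorphB -!cabsE cabs_conj.
- move=> s b sk z zr; have sk' := ltnW sk.
  apply: (@pderiv_local _ _ (fun w => (pderivs s F w)^*%C) z (r - cabs z) b _ _).2.
  + by rewrite subr_gt0.
  + move=> w wz; apply: E => //.
    by rewrite /odisk /=; have := cabsD (w - z) z; rewrite subrK; lra.
  + by apply: (pderiv_conj _).1; exact: dF.
- move=> s sk; have [g hg gE] := hF s sk.
  exists (fun z => (g z)^*%C); first exact: holder_conj.
  by move=> z zr; rewrite gE// E// sk.
Qed.

End Operators.

Theorem theorem2p1 (R : realType) (r alpha : R) (f : R[i] -> R[i]) (k : nat)
    (r_gt0 : 0 < r) (alpha_gt0 : 0 < alpha) (alpha_lt1 : alpha < 1)
    (f_holder : holder r alpha f) (k_gt0 : (0 < k)%N) :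
  [/\ holder_class k r alpha (iter k (cauchyT r) f),
      holder_class k r alpha (iter k (cauchyTbar r) f),
      forall z : R[i], cdisk r z ->
        iter k (cauchyT r) f z =
          (- 1) ^+ k / ((k.-1)`!%:R * two_pi_i R) *
          form_int r (fun zeta : R[i] =>
            (zeta^*%C - z^*%C) ^+ k.-1 * f zeta / (zeta - z)) &
      forall z : R[i], cdisk r z ->
        iter k (cauchyTbar r) f z =
          (- 1) ^+ k / ((k.-1)`!%:R * two_pi_i R) *
          form_int r (fun zeta : R[i] =>
            (zeta - z) ^+ k.-1 * f zeta / (zeta^*%C - z^*%C))].
Proof.
have f'_holder := holder_conj f_holder.
split.
- exact: holder_class_cauchyT.
- by rewrite iter_cauchyTbar_conj; apply: holder_class_conj; exact: holder_class_cauchyT.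
- by move=> z zr; exact: cauchyT_iter_form f_holder _ _.
move=> z zr; rewrite iter_cauchyTbar_conj.
rewrite (cauchyT_iter_form r_gt0 alpha_gt0 f'_holder k_gt0 zr) /form_int !form_coefM conjM -area_int_conj; congr (_ * _).
  rewrite rmorphM rmorphXn rmorphN rmorph1 fmorphV rmorphM rmorph_nat.
  by congr (_ * _^-1); rewrite /= oppr0.
congr area_int; apply/funext => v.
rewrite !conjM conjcK rmorphXn fmorphV !rmorphB; congr ((_ - _) ^+ _ * _ / _); exact: conjcK.
Qed.
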